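(* Let $\kappa=(k_1,\dots,k_\ell)$ be a tuple of positive integers with $\sum_{i} k_i=2g-2$. For every $(X,\omega)\in\mathcal{H}_1(\kappa)$, $$\operatorname{c-rad}(X)\ge\sqrt{\frac{2}{3\sqrt{3}\cdot(2g+\ell-2)}}.$$
   Context: A translation surface $(X,\omega)$ is a compact connected Riemann surface $X$ with a nonzero holomorphic 1-form $\omega$; its singularities are the zeros of $\omega$, forming a finite set $\Sigma$, and $X$ carries the induced flat metric $d$ with cone points at $\Sigma$. $\mathcal{H}_1(\kappa)$ is the set of translation surfaces of genus $g$ and area $1$ with $\ell$ singularities of orders $k_1,\dots,k_\ell$. The covering radius $\operatorname{c-rad}(X)$ is the maximum over $x\in X$ of the distance $d(x,\Sigma)$ from $x$ to the set of singularities. *)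

(* Defs.v *)
From HB Require Import structures.
From mathcomp Require Import all_boot all_order all_algebra.
From mathcomp Require Import all_classical all_reals all_analysis.
From mathcomp Require Import complex.

Set Implicit Arguments.
Unset Strict Implicit.
Unset Printing Implicit Defensive.

Import Order.TTheory GRing.Theory Num.Theory.
Import numFieldNormedType.Exports.

Local Open Scope classical_set_scope.
Local Open Scope ring_scope.
Local Open Scope complex_scope.

(* R[i] is made a normed module over itself, with the topology of its norm, so
   that [derivable] and [derive1] are complex differentiability and the complex
   derivative. *)
HB.instance Definition _ (R : rcfType) :=
  NormedModule.copy R[i] (R[i] : numFieldType)^o.

Definition holomorphic_on (R : realType) (U : set R[i]) (f : R[i] -> R[i]) :=
  forall z, U z -> derivable f z 1.

Record chart (R : realType) (X : topologicalType) := Chart {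
  chart_dom : set X;
  chart_map : X -> R[i];
  chart_inv : R[i] -> X;
  chart_img := chart_map @` chart_dom;
  chart_open : open chart_dom;
  chart_open_img : open chart_img;
  chart_continuous : {within chart_dom, continuous chart_map};
  chart_inv_continuous : {within chart_img, continuous chart_inv};
  chart_mapK : forall x, chart_dom x -> chart_inv (chart_map x) = x }.

Definition transition (R : realType) (X : topologicalType) (c c' : chart R X)
  : R[i] -> R[i] := fun z => chart_map c' (chart_inv c z).

(* Second countability need not be required: it follows from compactness and
   the existence of charts. *)
Record compactRiemannSurface (R : realType) := CompactRiemannSurface {
  surface :> topologicalType;
  surface_hausdorff : hausdorff_space surface;
  surface_compact : compact [set: surface];
  surface_connected : connected [set: surface];
  chart_index : Type;
  atlas : chart_index -> chart R surface;
  atlas_cover : forall x, exists i, chart_dom (atlas i) x;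
  atlas_holomorphic : forall i j,
    holomorphic_on
      (chart_map (atlas i) @` (chart_dom (atlas i) `&` chart_dom (atlas j)))
      (transition (atlas i) (atlas j)) }.

(* In the chart z_i = atlas S i the form is (form_coef i z_i) dz_i; the values
   of form_coef i outside the image of the chart are irrelevant. *)
Record holomorphicForm (R : realType) (S : compactRiemannSurface R) :=
  HolomorphicForm {
  form_coef : chart_index S -> R[i] -> R[i];
  form_holomorphic : forall i,
    holomorphic_on (chart_img (atlas i)) (form_coef i);
  form_compatible : forall i j (x : S),
    chart_dom (atlas i) x -> chart_dom (atlas j) x ->
    form_coef i (chart_map (atlas i) x) =
    form_coef j (chart_map (atlas j) x)
      * derive1 (transition (atlas i) (atlas j)) (chart_map (atlas i) x) }.

Record translationSurface (R : realType) := TranslationSurface {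
  ts_surface :> compactRiemannSurface R;
  omega : holomorphicForm ts_surface;
  omega_neq0 : exists i z,
    chart_img (atlas i) z /\ form_coef omega i z != 0 }.

(* The genus as the complex dimension of the space of holomorphic 1-forms:
   there is a basis consisting of g forms. *)
Definition has_genus (R : realType) (S : compactRiemannSurface R) (g : nat) :=
  exists w : 'I_g -> holomorphicForm S, forall eta : holomorphicForm S,
    exists! a : 'rV[R[i]]_g, forall i z, chart_img (atlas i) z ->
      form_coef eta i z = \sum_(k < g) a ord0 k * form_coef (w k) i z.

Definition vanishing_order (R : realType) (f : R[i] -> R[i]) (z0 : R[i])
    (k : nat) :=
  exists (V : set R[i]) (h : R[i] -> R[i]),
    [/\ open V, V z0, holomorphic_on V h, h z0 != 0 &
        forall z, V z -> f z = (z - z0) ^+ k * h z].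

Section FlatGeometry.
Variables (R : realType) (T : translationSurface R).
Implicit Types (i : chart_index T) (x y : T).

Definition form_order (x : T) (k : nat) :=
  exists i, chart_dom (atlas i) x /\
    vanishing_order (form_coef (omega T) i) (chart_map (atlas i) x) k.

Definition singularities : set T :=
  [set x | exists i, chart_dom (atlas i) x /\
    form_coef (omega T) i (chart_map (atlas i) x) = 0].

Definition chart_plane_img i (B : set T)
  : set (measurableTypeR R * measurableTypeR R) :=
  [set p | (chart_map (atlas i) @` B) (p.1 +i* p.2)].

(* The integral over B of the area form |f|^2 dx dy of |omega|^2, for
   omega = f dz in the i-th chart and B contained in its domain. *)
Definition chart_area i (B : set T) : \bar R :=
  (\int[(@lebesgue_measure R) \x (@lebesgue_measure R)]_(p in
      chart_plane_img i B)
    (Normc.normc (form_coef (omega T) i (p.1 +i* p.2)) ^+ 2)%:E)%E.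

(* The area form is integrated over X by cutting X into finitely many Borel
   pieces, each inside a chart; the value depends neither on the pieces nor on
   the charts. *)
Definition has_area (A : \bar R) :=
  exists (n : nat) (i : 'I_n -> chart_index T) (B : 'I_n -> set T),
    [/\ trivIset [set: 'I_n] B,
        \bigcup_(m in [set: 'I_n]) B m = [set: T],
        forall m, B m `<=` chart_dom (atlas (i m)),
        forall m, measurable (chart_plane_img (i m) (B m)) &
        A = (\sum_(m < n) chart_area (i m) (B m))%E].

(* A C^1 map on [0, 1] is the restriction of a C^1 map on the whole line, so
   arcs are defined on R although only [0, 1] matters. *)
Definition C1_arc (a b : R -> R) :=
  [/\ forall t, derivable a t 1, forall t, derivable b t 1,
      continuous (derive1 a) & continuous (derive1 b)].

(* The length, i.e. the integral of |omega|, of t |-> a t + i b t, t in [0, 1],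
   read in the i-th chart. *)
Definition arc_length i (a b : R -> R) : \bar R :=
  (\int[@lebesgue_measure R]_(t in `[0%R, 1%R])
    (Normc.normc (form_coef (omega T) i (a t +i* b t))
      * Normc.normc (derive1 a t +i* derive1 b t))%:E)%E.

(* path_length x y L : some piecewise C^1 path from x to y has length L; the
   path is cut finely enough for each piece to be a C^1 arc inside a chart. *)
Inductive path_length (x : T) : T -> \bar R -> Prop :=
| path_length_refl : path_length x x 0%E
| path_length_arc y L i a b :
    path_length x y L ->
    C1_arc a b ->
    (forall t, 0 <= t <= 1 -> chart_img (atlas i) (a t +i* b t)) ->
    chart_inv (atlas i) (a 0 +i* b 0) = y ->
    path_length x (chart_inv (atlas i) (a 1 +i* b 1))
      (L + arc_length i a b)%E.

Definition flat_dist (x y : T) : \bar R :=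
  ereal_inf [set L | path_length x y L].

Definition dist_to_singularities (x : T) : \bar R :=
  ereal_inf [set flat_dist x s | s in singularities].

(* The supremum is a maximum because X is compact. *)
Definition c_rad : \bar R :=
  ereal_sup [set dist_to_singularities x | x in [set: T]].

End FlatGeometry.

Arguments singularities {R} T _.

(* Membership in H_1(kappa): genus g, area 1, and exactly l singularities, of
   orders kappa_1, ..., kappa_l. *)
Definition in_H1 (R : realType) (g l : nat) (kappa : l.-tuple nat)
    (T : translationSurface R) :=
  [/\ has_genus T g, has_area T 1%E &
    exists p : 'I_l -> T,
      [/\ injective p, range p = singularities T &
          forall j, form_order (p j) (tnth kappa j)]].

(* Main.v *)
(** Let b be the covering radius and K = 2g + l - 2, the sum of the k_j + 1.
    A flat disc of radius r immersed in the surface minus its zeros has its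
    centre at distance at least r from the zeros, so r <= b.  Develop the
    surface around a regular point x.  Among the immersed discs whose interior
    contains x, the one for which the power of x is the most negative has
    several zeros on its bounding circle, and x lies in one of the triangles
    obtained by fanning their convex hull out of one of them (a Delaunay
    triangulation).  Fix a generic direction y.  Each triangle has exactly one
    corner from which y or -y points inside it, triangles sharing such a corner
    and direction coincide, and a zero of order k is the origin of k + 1
    separatrices in each of the directions y and -y; hence there are at most 2K
    triangles.  Each of them is inscribed in a circle of radius at most b, so
    its area is at most (3 sqrt 3 / 4) b^2, and they cover a surface of area 1:
    1 <= 2K (3 sqrt 3 / 4) b^2. *)

From HB Require Import structures.
Require Import Defs.
From mathcomp Require Import all_boot all_order all_algebra.
From mathcomp Require Import all_classical all_reals all_analysis.
From mathcomp Require Import measurable_realfun complex ring lra.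

Set Implicit Arguments.
Unset Strict Implicit.
Unset Printing Implicit Defensive.

Import Order.TTheory GRing.Theory Num.Theory.
Import numFieldNormedType.Exports.

Local Open Scope classical_set_scope.
Local Open Scope ring_scope.
Local Open Scope complex_scope.

(** The obstacle is that the surface has no global flat coordinate. All geometry is done in the
    plane, through immersions of convex open sets that pull [omega] back to [dz]; two of them with a
    common value agree on their common domain. The negated power of x is a lower envelope of affine
    functions of the centre of the disc, hence concave: the first-order condition at its maximum
    says that x is in the convex hull of the zeros on the circle, and the choice of the maximiser
    farthest from x produces a third zero. Triangles sharing a corner and a direction coincide
    because neither disc may contain a zero reached by the other, which by the radical axis forces
    their centres to agree. The count by separatrices is the count of preimages of a small multiple
    of y or -y under a primitive of [omega] at a zero, a map close to z^(k+1). Area is defined chart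
    by chart with density |f|^2; it is carried to the plane by a local change of variables, proved
    by subdividing rectangles, and subadditivity over the triangles concludes. The number 3 sqrt 3 /
    4 is the area of the equilateral triangle inscribed in the unit circle. *)

Local Notation nc := Normc.normc.
Local Notation Re := complex.Re.
Local Notation Im := complex.Im.

(** * Plane geometry and complex derivatives *)

Section Plane.
Variable R : realType.
Local Notation C := R[i].
Implicit Types z w a b : C.

(* [conj a * b = dt a b + 'i * cr a b]. *)
Definition dt a b : R := Re a * Re b + Im a * Im b.
Definition cr a b : R := Re a * Im b - Im a * Re b.

Lemma nc_sqr z : nc z ^+ 2 = dt z z.
Proof. by case: z => x y; rewrite /= sqr_sqrtr ?addr_ge0 ?sqr_ge0 // /dt /= -!expr2. Qed.

Lemma nc_ge0 z : 0 <= nc z.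
Proof. by case: z => x y; exact: sqrtr_ge0. Qed.

Lemma nc0 : nc (0 : C) = 0.
Proof. exact: Normc.normc0. Qed.

Lemma nc_eq0 z : (nc z == 0) = (z == 0).
Proof.
by apply/eqP/eqP => [/Normc.eq0_normc //|->]; exact: nc0.
Qed.

Lemma nc_gt0 z : (0 < nc z) = (z != 0).
Proof. by rewrite lt_def nc_ge0 andbT nc_eq0. Qed.

Lemma ncM z w : nc (z * w) = nc z * nc w.
Proof. exact: Normc.normcM. Qed.

Lemma ncV z : nc z^-1 = (nc z)^-1.
Proof. exact: Normc.normcV. Qed.

Lemma ncX z n : nc (z ^+ n) = nc z ^+ n.
Proof.
elim: n => [|n IH]; first by rewrite !expr0; exact: Normc.normc1.
by rewrite !exprS ncM IH.
Qed.

Lemma ncD z w : nc (z + w) <= nc z + nc w.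
Proof. exact: le_normcD. Qed.

Lemma ncN z : nc (- z) = nc z.
Proof. exact: normcN. Qed.

Lemma ncB z w : nc (z - w) <= nc z + nc w.
Proof. by rewrite -(ncN w) ncD. Qed.

Lemma ncC z w : nc (z - w) = nc (w - z).
Proof. by rewrite -ncN opprB. Qed.

Lemma nc_tri y z w : nc (z - w) <= nc (z - y) + nc (y - w).
Proof. by rewrite (_ : z - w = (z - y) + (y - w)) ?ncD //; ring. Qed.

Lemma ncR (x : R) : nc x%:C = `|x|.
Proof. by rewrite /= expr0n /= addr0 sqrtr_sqr. Qed.

Lemma Re_nc z : `|Re z| <= nc z.
Proof.
by case: z => x y /=; rewrite -sqrtr_sqr ler_sqrt ?addr_ge0 ?sqr_ge0 // lerDl sqr_ge0.
Qed.

Lemma Im_nc z : `|Im z| <= nc z.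
Proof.
by case: z => x y /=; rewrite -[`|y|]sqrtr_sqr ler_sqrt ?addr_ge0 ?sqr_ge0 // lerDr sqr_ge0.
Qed.

Lemma nc_ReIm z : nc z <= `|Re z| + `|Im z|.
Proof.
case: z => x y; rewrite (_ : x +i* y = x%:C + 'i * y%:C); last first.
  by apply/eqP; rewrite eq_complex /=; simpc.
rewrite (le_trans (ncD _ _)) // ncM !ncR /=; simpc.
by rewrite expr0n expr1n /= add0r sqrtr1 mul1r.
Qed.

Lemma ReD z w : Re (z + w) = Re z + Re w. Proof. by case: z w => [? ?] [? ?]. Qed.
Lemma ImD z w : Im (z + w) = Im z + Im w. Proof. by case: z w => [? ?] [? ?]. Qed.
Lemma ReN z : Re (- z) = - Re z. Proof. by case: z. Qed.
Lemma ImN z : Im (- z) = - Im z. Proof. by case: z. Qed.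
Lemma ReM z w : Re (z * w) = Re z * Re w - Im z * Im w. Proof. by case: z w => [? ?] [? ?]. Qed.
Lemma ImM z w : Im (z * w) = Re z * Im w + Im z * Re w. Proof. by case: z w => [? ?] [? ?]. Qed.
Lemma ReR (x : R) : Re x%:C = x. Proof. by []. Qed.
Lemma ImR (x : R) : Im x%:C = 0. Proof. by []. Qed.
Definition ReImE := (ReD, ImD, ReN, ImN, ReM, ImM, ReR, ImR).

Lemma C_eqP z w : Re z = Re w -> Im z = Im w -> z = w.
Proof. by case: z w => [? ?] [? ?] /= -> ->. Qed.

Lemma dt_le a b : dt a b <= nc a * nc b.
Proof.
have [h|h] := leP (dt a b) 0; first by rewrite (le_trans h) ?mulr_ge0 ?nc_ge0.
rewrite -(ler_pXn2r (_ : (0 < 2)%N)) ?nnegrE ?mulr_ge0 ?nc_ge0 ?(ltW h) //.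
rewrite exprMn !nc_sqr /dt.
have := sqr_ge0 (cr a b); rewrite /cr; lra.
Qed.

Lemma nc_addsq a b : nc (a + b) ^+ 2 = nc a ^+ 2 + 2 * dt a b + nc b ^+ 2.
Proof. rewrite !nc_sqr /dt !ReImE; ring. Qed.

Lemma nc_subsq a b : nc (a - b) ^+ 2 = nc a ^+ 2 - 2 * dt a b + nc b ^+ 2.
Proof. rewrite !nc_sqr /dt !ReImE; ring. Qed.

Lemma nc_scale (t : R) z : nc (t%:C * z) = `|t| * nc z.
Proof. by rewrite ncM ncR. Qed.

Lemma normCE z : `|z| = (nc z)%:C.
Proof. by case: z => x y; rewrite normc_def. Qed.

Lemma nbhs_ncP z (U : set C) :
  nbhs z U <-> exists2 e : R, 0 < e & forall w, nc (w - z) < e -> U w.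
Proof.
split.
  move/nbhs_ballP => [e e0 sub]; have e0' : 0 < e := e0.
  have eE : e = (Re e)%:C.
    by move: e0'; case: (e) => x y; rewrite ltcE /= => /andP[/eqP -> _].
  exists (Re e) => [|w h].
    by move: e0'; rewrite ltcE /= => /andP[].
  apply: sub; rewrite -ball_normE /ball_ /= normCE eE ltcR.
  by rewrite ncC.
move=> [e e0 sub]; apply/nbhs_ballP; exists e%:C; first by rewrite /= ltcR.
move=> w; rewrite -ball_normE /ball_ /= normCE ltcR => h.
by apply: sub; rewrite ncC.
Qed.

Lemma openCP (U : set C) :
  open U <-> forall z, U z -> exists2 e : R, 0 < e & forall w, nc (w - z) < e -> U w.
Proof.
rewrite openE; split=> h z Uz; first by apply/nbhs_ncP; apply: h.
by rewrite /interior; apply/nbhs_ncP; exact: h.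
Qed.

(** Complex differentiability with the derivative as an argument, written without a quotient: the
    estimate also makes sense at [w = z], and the rules of calculus reduce to adding errors. *)
Definition cder (g : C -> C) z d := forall e : R, 0 < e ->
  exists2 t : R, 0 < t & forall w, nc (w - z) < t ->
    nc (g w - g z - d * (w - z)) <= e * nc (w - z).

Definition ccont (g : C -> C) z := forall e : R, 0 < e ->
  exists2 t : R, 0 < t & forall w, nc (w - z) < t -> nc (g w - g z) < e.

Lemma derivable_cder (f : C -> C) z : derivable f z 1 -> cder f z (derive1 f z).
Proof.
move=> df e e0; rewrite derive1E /derive.
move: df; rewrite /derivable.
set q := (fun h : C => _) => /cvg_ex[d qd].
rewrite (cvg_lim (@norm_hausdorff _ _) qd).
have /qd : nbhs d [set u | nc (u - d) < e] by apply/nbhs_ncP; exists e.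
rewrite /fmap /= /dnbhs /within /=; move/nbhs_ncP => [t t0 ht].
exists t => // w wt.
have [->|wz] := eqVneq w z; first by rewrite !subrr mulr0 subr0 nc0 mulr0.
have w0 : w - z != 0 by rewrite subr_eq0.
have := ht (w - z); rewrite subr0 => /(_ wt w0).
rewrite /q /= -[X in f X]/((w - z) * 1 + z) mulr1 subrK => /ltW h.
have -> : f w - f z - d * (w - z) = ((w - z)^-1 * (f w - f z) - d) * (w - z).
  by rewrite mulrBl mulrAC mulVf // mul1r.
by rewrite ncM; apply: ler_wpM2r => //; exact: nc_ge0.
Qed.

Lemma cder_cont g z d : cder g z d -> ccont g z.
Proof.
move=> gd e e0; have [t t0 ht] := gd 1 ltr01.
pose K := nc d + 1; have K0 : 0 < K by rewrite ltr_wpDl ?nc_ge0.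
exists (Num.min t (e / K)) => [|w]; first by rewrite lt_min t0 divr_gt0.
rewrite lt_min => /andP[wt we].
have := ht _ wt; rewrite mul1r => h.
have -> : g w - g z = (g w - g z - d * (w - z)) + d * (w - z) by ring.
rewrite (le_lt_trans (ncD _ _)) // ncM.
rewrite ltr_pdivlMr // in we; rewrite (le_lt_trans _ we) // /K.
by rewrite [leRHS]mulrC mulrDl mul1r addrC lerD2l.
Qed.

Lemma ccontP (g : C -> C) z : ccont g z <-> {for z, continuous g}.
Proof.
split.
  move=> h U /nbhs_ncP [e e0 sub]; have [t t0 ht] := h _ e0.
  by apply/nbhs_ncP; exists t => // w /ht /sub.
move=> h e e0; have /h : nbhs (g z) [set u | nc (u - g z) < e].
  by apply/nbhs_ncP; exists e.
by move/nbhs_ncP.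
Qed.

Lemma ccontX (X : topologicalType) (phi : C -> X) z :
  {for z, continuous phi} <-> forall O, open O -> O (phi z) ->
   exists2 t : R, 0 < t & forall w, nc (w - z) < t -> O (phi w).
Proof.
split=> [h O oO Oz|h U].
  have nO : nbhs (phi z) O by apply: open_nbhs_nbhs.
  by apply/nbhs_ncP; exact: h.
rewrite nbhsE; case=> O [oO Oz] sub; apply/nbhs_ncP.
by have [t t0 ht] := h O oO Oz; exists t => // w /ht /sub.
Qed.

Lemma cder_ext g1 g2 z d (r : R) : 0 < r ->
  (forall w, nc (w - z) < r -> g1 w = g2 w) -> cder g1 z d -> cder g2 z d.
Proof.
move=> r0 eg h e e0; have [t t0 ht] := h e e0.
exists (Num.min t r) => [|w]; first by rewrite lt_min t0.
by rewrite lt_min => /andP[wt wr]; rewrite -!eg ?subrr ?nc0 // ht.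
Qed.

Lemma cder_cst c z : cder (fun=> c) z 0.
Proof.
by move=> e e0; exists 1 => // w _; rewrite subrr mul0r subr0 nc0 mulr_ge0 ?nc_ge0 ?ltW.
Qed.

Lemma cder_id z : cder id z 1.
Proof.
by move=> e e0; exists 1 => // w _; rewrite mul1r subrr nc0 mulr_ge0 ?nc_ge0 ?ltW.
Qed.

Lemma cderD g1 g2 z d1 d2 : cder g1 z d1 -> cder g2 z d2 ->
  cder (fun w => g1 w + g2 w) z (d1 + d2).
Proof.
move=> h1 h2 e e0.
have [t1 t10 ht1] := h1 (e / 2) ltac:(lra); have [t2 t20 ht2] := h2 (e / 2) ltac:(lra).
exists (Num.min t1 t2) => [|w]; first by rewrite lt_min t10.
rewrite lt_min => /andP[w1 w2].
rewrite (_ : _ - _ = (g1 w - g1 z - d1 * (w - z)) + (g2 w - g2 z - d2 * (w - z))); last by ring.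
by rewrite (le_trans (ncD _ _)) // (le_trans (lerD (ht1 _ w1) (ht2 _ w2))) // -mulrDl -splitr.
Qed.

Lemma cderZ g z d c : cder g z d -> cder (fun w => c * g w) z (c * d).
Proof.
move=> h e e0; pose K := nc c + 1; have K0 : 0 < K by rewrite ltr_wpDl ?nc_ge0.
have [t t0 ht] := h (e / K) ltac:(by rewrite divr_gt0).
exists t => // w /ht hw.
rewrite (_ : _ - _ = c * (g w - g z - d * (w - z))); last by ring.
rewrite ncM (le_trans (ler_wpM2l (nc_ge0 _) hw)) // mulrA ler_wpM2r ?nc_ge0 //.
rewrite mulrCA ler_piMr ?(ltW e0) // ler_pdivrMr // mul1r /K; lra.
Qed.

Lemma cderN g z d : cder g z d -> cder (fun w => - g w) z (- d).
Proof.
move=> /(cderZ (-1)); rewrite mulN1r; apply: (cder_ext ltr01) => w _.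
by rewrite mulN1r.
Qed.

Lemma cderB g1 g2 z d1 d2 : cder g1 z d1 -> cder g2 z d2 ->
  cder (fun w => g1 w - g2 w) z (d1 - d2).
Proof. by move=> h1 h2; apply: cderD => //; apply: cderN. Qed.

Lemma cder_comp g f z d d' : cder g z d -> cder f (g z) d' ->
  cder (fun w => f (g w)) z (d' * d).
Proof.
move=> hg hf e e0.
pose K := nc d + 1; have K0 : 0 < K by rewrite ltr_wpDl ?nc_ge0.
pose K' := nc d' + 1; have K'0 : 0 < K' by rewrite ltr_wpDl ?nc_ge0.
have [s s0 hs] := hf (e / 2 / K) ltac:(by rewrite !divr_gt0).
have [u u0 hu] := cder_cont hg s0.
have [v v0 hv] := hg (Num.min 1 (e / 2 / K')) ltac:(by rewrite lt_min ltr01 !divr_gt0).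
exists (Num.min u v) => [|w]; first by rewrite lt_min u0.
rewrite lt_min => /andP[wu wv].
have := hs _ (hu _ wu); have := hv _ wv.
set A := g w - g z; set B := f _ - _; set n := nc (w - z) => h1 h2.
have n0 : 0 <= n by exact: nc_ge0.
rewrite (_ : _ - _ = (B - d' * A) + d' * (A - d * (w - z))); last by rewrite /A /B; ring.
rewrite (le_trans (ncD _ _)) // ncM.
have hA : nc A <= K * n.
  rewrite (_ : A = (A - d * (w - z)) + d * (w - z)); last by ring.
  rewrite (le_trans (ncD _ _)) // ncM -/n /K mulrDl mul1r addrC lerD2l.
  by rewrite (le_trans h1) // ler_piMl // ge_min lexx.
have h3 : nc (B - d' * A) <= e / 2 * n.
  rewrite (le_trans h2) // (le_trans (ler_wpM2l _ hA)) ?divr_ge0 ?(ltW e0) ?(ltW K0) //.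
  by rewrite mulrA divfK ?lexx ?(gt_eqF K0).
have h4 : nc d' * nc (A - d * (w - z)) <= e / 2 * n.
  have h5 : nc (A - d * (w - z)) <= e / 2 / K' * n.
    by rewrite (le_trans h1) // ler_wpM2r // ge_min lexx orbT.
  rewrite (le_trans (ler_wpM2l (nc_ge0 _) h5)) // mulrA ler_wpM2r //.
  rewrite mulrCA ler_piMr ?divr_ge0 ?(ltW e0) // ler_pdivrMr // mul1r /K'; lra.
by rewrite (le_trans (lerD h3 h4)) // -mulrDl -splitr.
Qed.

Lemma cderM g1 g2 z d1 d2 : cder g1 z d1 -> cder g2 z d2 ->
  cder (fun w => g1 w * g2 w) z (d1 * g2 z + g1 z * d2).
Proof.
move=> h1 h2 e e0.
pose K1 := nc (g1 z) + 1; have K10 : 0 < K1 by rewrite ltr_wpDl ?nc_ge0.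
pose K2 := nc (g2 z) + 1; have K20 : 0 < K2 by rewrite ltr_wpDl ?nc_ge0.
pose K3 := nc d1 + 1; have K30 : 0 < K3 by rewrite ltr_wpDl ?nc_ge0.
have [t1 t10 ht1] := h1 (e / 3 / K2) ltac:(by rewrite !divr_gt0).
have [t2 t20 ht2] := h2 (e / 3 / K1) ltac:(by rewrite !divr_gt0).
have e3 : 0 < Num.min 1 (e / 3 / K3) by rewrite lt_min ltr01 !divr_gt0.
have [t3 t30 ht3] := cder_cont h2 e3.
exists (Num.min t1 (Num.min t2 t3)) => [|w]; first by rewrite !lt_min t10 t20.
rewrite !lt_min => /and3P[/ht1 w1 /ht2 w2 /ht3 /ltW w3].
have n0 := nc_ge0 (w - z); set n := nc (w - z) in n0 w1 w2 *.
rewrite (_ : _ - _ = (g1 w - g1 z - d1 * (w - z)) * g2 w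
   + (d1 * (w - z)) * (g2 w - g2 z)
   + g1 z * (g2 w - g2 z - d2 * (w - z))); last by ring.
have b2 : nc (g2 w) <= K2.
  rewrite (_ : g2 w = (g2 w - g2 z) + g2 z); last by ring.
  rewrite (le_trans (ncD _ _)) // /K2 addrC lerD2l (le_trans w3) // ge_min lexx.
  by [].
have -> : e * n = e / 3 * n + e / 3 * n + e / 3 * n by field.
rewrite (le_trans (ncD _ _)) // lerD //; last first.
  rewrite ncM (le_trans (ler_wpM2l (nc_ge0 _) w2)) // mulrA ler_wpM2r //.
  rewrite mulrCA ler_piMr ?divr_ge0 ?(ltW e0) // ler_pdivrMr // mul1r /K1; lra.
rewrite (le_trans (ncD _ _)) // lerD //.
  rewrite ncM (le_trans (ler_pM (nc_ge0 _) (nc_ge0 _) w1 b2)) //.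
  by rewrite mulrAC divfK ?lexx ?(gt_eqF K20).
have w3' : nc (g2 w - g2 z) <= e / 3 / K3 by rewrite (le_trans w3) // ge_min lexx orbT.
rewrite !ncM -/n mulrAC ler_wpM2r // (le_trans (ler_wpM2l (nc_ge0 _) w3')) //.
rewrite mulrCA ler_piMr ?divr_ge0 ?(ltW e0) // ler_pdivrMr // mul1r /K3; lra.
Qed.

Lemma cderX n z : cder (fun w => w ^+ n.+1) z (n.+1%:R * z ^+ n).
Proof.
elim: n => [|n IH].
  by rewrite expr0 mulr1; apply: (cder_ext ltr01 _ (cder_id z)) => w _; rewrite expr1.
have := cderM (cder_id z) IH; rewrite mul1r.
rewrite (_ : _ + _ = n.+2%:R * z ^+ n.+1); last first.
  by rewrite /= mulrCA -exprS -[in RHS]add1n natrD mulrDl mul1r.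
by apply: (cder_ext ltr01) => w _; rewrite -exprS.
Qed.

Lemma cder_translate c z : cder (fun w => w + c) z 1.
Proof. by rewrite -[1]addr0; apply: cderD; [exact: cder_id|exact: cder_cst]. Qed.

(** The topology of [C] comes from its norm and not from a product, so compactness is imported from
    a square, the continuous image of a product of two segments; the disc is a closed part of it. *)
Lemma compact_disc (c : C) (M : R) : compact [set z : C | nc (z - c) <= M].
Proof.
pose S := [set z : C | `|Re (z - c)| <= M /\ `|Im (z - c)| <= M].
have cS : compact S.
  have -> : S = (fun p : R * R => c + (p.1 +i* p.2)) @` (`[- M, M]%classic `*` `[- M, M]%classic).
    apply/seteqP; split => [z [h1 h2]|_ [[x y] [/= h1 h2] <-]].
      exists (Re (z - c), Im (z - c)) => /=.
        by split; rewrite /= in_itv /= -ler_norml.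
      by apply: C_eqP; rewrite /= ?ReImE /= ?ReImE; ring.
    rewrite !in_itv /= -!ler_norml in h1 h2.
    have E : c + (x +i* y) - c = x +i* y by ring.
    by rewrite /S /= E.
  apply: continuous_compact; last by apply: compact_setX; exact: segment_compact.
  apply: continuous_subspaceT => -[x y] U /nbhs_ncP [e e0 sub].
  have h : nbhs (x, y) ([set x' | `|x - x'| < e / 2] `*` [set y' | `|y - y'| < e / 2]).
    exists ([set x' | `|x - x'| < e / 2], [set y' | `|y - y'| < e / 2]) => //.
    by split; apply/nbhs_ballP; exists (e / 2) => //=; rewrite ?divr_gt0.
  apply: filterS h => -[x' y'] /= [hx hy]; apply: sub.
  rewrite (_ : c + (x' +i* y') - (c + (x +i* y)) = ((x' - x) +i* (y' - y))); last first.
    apply: C_eqP; rewrite !ReImE.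
      by change (Re c + x' - (Re c + x) = x' - x); ring.
    by change (Im c + y' - (Im c + y) = y' - y); ring.
  rewrite (le_lt_trans (nc_ReIm _)) //= distrC (distrC y') [e]splitr ltrD //.
rewrite (_ : [set z | _] = S `&` [set z : C | nc (z - c) <= M]); last first.
  apply/seteqP; split => [z /= h|z [] //]; split=> //.
  by split; rewrite (le_trans _ h) ?Re_nc ?Im_nc.
apply: compact_closedI => //.
rewrite -openC; apply/openCP => z /= /negP; rewrite -ltNge => h.
exists (nc (z - c) - M) => [|w hw]; first by rewrite subr_gt0.
apply/negP; rewrite -ltNge.
have := nc_tri w z c; rewrite (ncC z w); lra.
Qed.

End Plane.

(** * Real induction and subdivision of rectangles *)

Section RealInduction.
Variable R : realType.

(** The supremum of the [t] up to which [P] holds satisfies [P] by the closing hypothesis, and the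
    opening one would push it further if it were below [b]. The continuation arguments along
    segments and arcs below have this form. *)
Lemma real_ind (P : R -> Prop) (a b : R) : a <= b -> P a ->
  (forall t, a <= t -> t < b -> (forall s, a <= s -> s <= t -> P s) ->
     exists2 d : R, 0 < d & forall s, t < s -> s < t + d -> s <= b -> P s) ->
  (forall t, a < t -> t <= b -> (forall s, a <= s -> s < t -> P s) -> P t) ->
  forall t, a <= t -> t <= b -> P t.
Proof.
move=> ab Pa Pr Pl.
pose S := [set t | a <= t /\ t <= b /\ forall s, a <= s -> s <= t -> P s].
have Sa : S a by split => //; split => // s h1 h2; rewrite (_ : s = a) //; apply/eqP; rewrite eq_le h2.
have ubS : ubound S b by move=> t [_ []].
have hsS : has_sup S by split; [exists a|exists b].
pose m := sup S.
have am : a <= m by apply: ub_le_sup => //; exists b.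
have mb : m <= b by apply: sup_le_ub => //; exists a.
have lt_m s : a <= s -> s < m -> P s.
  move=> h1 h2; have e0 : 0 < m - s by rewrite subr_gt0.
  have [t [_ [_ ht]] lt] := sup_adherent e0 hsS.
  by apply: ht => //; rewrite ltW // (_ : s = m - (m - s)) //; ring.
have Pm : P m.
  by have [<-//|/eqP nam] := eqVneq a m; apply: Pl => //; rewrite lt_neqAle am andbT; apply/eqP.
have le_m s : a <= s -> s <= m -> P s.
  by move=> h1; rewrite le_eqVlt => /orP[/eqP -> //|]; exact: lt_m.
suff mE : m = b by move=> t h1 h2; apply: le_m; rewrite ?mE.
apply/eqP; rewrite eq_le mb /= leNgt; apply/negP => mb'.
have [d d0 hd] := Pr m am mb' le_m.
pose s := Num.min b (m + d / 2).
have ms : m < s by rewrite lt_min mb' ltrDl divr_gt0.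
have : S s.
  split; first by rewrite (le_trans am) ?ltW.
  split; first by rewrite ge_min lexx.
  move=> u au us; have [um|mu] := leP u m; first exact: le_m.
  apply: hd => //; last by rewrite (le_trans us) // ge_min lexx.
  rewrite (le_lt_trans us) // gt_min; apply/orP; right; lra.
by move/(ub_le_sup (ex_intro _ b ubS)); rewrite leNgt ms.
Qed.

Definition quad := (R * R * R * R)%type.

Lemma halving_lt (K e : R) : 0 <= K -> 0 < e -> exists n, K / 2 ^+ n < e.
Proof.
move=> K0 e0; pose n := Num.bound (K / e).
have h : K / e < n%:R.
  by have := archi_boundP (_ : 0 <= K / e); apply; rewrite divr_ge0 ?(ltW e0).
exists n; rewrite ltr_pdivrMr ?exprn_gt0 // mulrC -ltr_pdivrMr //.
rewrite (lt_trans h) //; rewrite -natrX ltr_nat; exact: ltn_expl.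
Qed.

(* Cousin's lemma: a rectangle violating [P] has a bad quarter, and the nested
   bad quarters, all similar to the first one, shrink to a point. *)
Lemma rect_bisect (P : R -> R -> R -> R -> Prop) a0 b0 c0 d0 :
  a0 <= b0 -> c0 <= d0 ->
  (forall a b c d, a0 <= a -> a <= b -> b <= b0 -> c0 <= c -> c <= d -> d <= d0 ->
     let m := (a + b) / 2 in let n := (c + d) / 2 in
     P a m c n -> P m b c n -> P a m n d -> P m b n d -> P a b c d) ->
  (forall x y, a0 <= x -> x <= b0 -> c0 <= y -> y <= d0 ->
     exists2 e : R, 0 < e & forall a b c d,
       a0 <= a -> a <= x -> x <= b -> b <= b0 ->
       c0 <= c -> c <= y -> y <= d -> d <= d0 -> b - a < e -> d - c < e ->
       (b - a) * (d0 - c0) = (d - c) * (b0 - a0) -> P a b c d) ->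
  P a0 b0 c0 d0.
Proof.
move=> ab0 cd0 split loc; apply: contrapT => nP.
pose good (q : quad) (q' : quad) : Prop :=
  let: (a, b, c, d) := q in let: (a', b', c', d') := q' in
  [/\ a <= a' /\ b' <= b, c <= c' /\ d' <= d,
      b' - a' = (b - a) / 2, d' - c' = (d - c) / 2 & ~ P a' b' c' d'].
pose inv (q : quad) : Prop := let: (a, b, c, d) := q in
  [/\ a0 <= a /\ b <= b0, c0 <= c /\ d <= d0, a <= b, c <= d & ~ P a b c d].
have step q : exists q', inv q -> good q q'.
  case: q => -[[a b] c] d; have [[[aa bb] [cc dd] ab cd np]|h] := pselect (inv (a, b, c, d)); last by exists (a, b, c, d).
  have := split a b c d aa ab bb cc cd dd; set m := _ / 2; set n := _ / 2 => sp.
  have [p1|p1] := pselect (P a m c n); last first.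
    by exists (a, m, c, n) => _; split; rewrite /m /n //; (try split); lra.
  have [p2|p2] := pselect (P m b c n); last first.
    by exists (m, b, c, n) => _; split; rewrite /m /n //; (try split); lra.
  have [p3|p3] := pselect (P a m n d); last first.
    by exists (a, m, n, d) => _; split; rewrite /m /n //; (try split); lra.
  exists (m, b, n, d) => _; split; rewrite /m /n //; (try split); try lra.
  by move=> p4; apply: np; exact: sp.
have [f hf] := choice step.
pose q n := iter n f (a0, b0, c0, d0).
pose A n := (q n).1.1.1; pose B n := (q n).1.1.2; pose Cc n := (q n).1.2; pose D n := (q n).2.
have qE n : q n = (A n, B n, Cc n, D n) by rewrite /A /B /Cc /D; case: (q n) => -[[? ?] ?] ?.
have I n : inv (q n).
  elim: n => [|n IH]; first by split.
  have := hf _ IH; rewrite (_ : q n.+1 = f (q n)) //; case: (q n) IH => -[[a b] c] d [[? ?] [? ?] ? ? ?].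
  by case: (f _) => -[[a' b'] c'] d' [[? ?] [? ?] ? ? ?]; split; (try split) => //; lra.
have G n : good (q n) (q n.+1) by apply: hf.
have I' n : [/\ a0 <= A n /\ B n <= b0, c0 <= Cc n /\ D n <= d0, A n <= B n, Cc n <= D n
   & ~ P (A n) (B n) (Cc n) (D n)] by have := I n; rewrite qE.
have G' n : [/\ A n <= A n.+1 /\ B n.+1 <= B n, Cc n <= Cc n.+1 /\ D n.+1 <= D n,
  B n.+1 - A n.+1 = (B n - A n) / 2, D n.+1 - Cc n.+1 = (D n - Cc n) / 2
  & ~ P (A n.+1) (B n.+1) (Cc n.+1) (D n.+1)] by have := G n; rewrite !qE.
have szA n : B n - A n = (b0 - a0) / 2 ^+ n.
  elim: n => [|n IH]; first by rewrite expr0 divr1.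
  by have [_ _ -> _ _] := G' n; rewrite IH exprSr invfM mulrA.
have szC n : D n - Cc n = (d0 - c0) / 2 ^+ n.
  elim: n => [|n IH]; first by rewrite expr0 divr1.
  by have [_ _ _ -> _] := G' n; rewrite IH exprSr invfM mulrA.
have nest (U V : nat -> R) : (forall n, U n <= U n.+1) -> (forall n, V n.+1 <= V n) ->
    (forall n, U n <= V n) -> exists x, forall n, U n <= x /\ x <= V n.
  move=> Ui Vd UV.
  have Uk n k : U n <= U (n + k)%N.
    by elim: k => [|k IH]; rewrite ?addn0 ?addnS // (le_trans IH).
  have Vk n k : V (n + k)%N <= V n.
    by elim: k => [|k IH]; rewrite ?addn0 ?addnS // (le_trans (Vd _)).
  have ub n : ubound (range U) (V n).
    move=> _ [k _ <-]; rewrite (le_trans (Uk k n)) // (le_trans (UV _)) //.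
    by rewrite addnC; exact: Vk.
  exists (sup (range U)) => n; split.
    by apply: ub_le_sup; [exists (V 0%N)|exists n].
  by apply: sup_le_ub => //; exists (U 0%N); exists 0%N.
have [x hx] : exists x, forall n, A n <= x /\ x <= B n.
  by apply: nest => n; [have [[]] := G' n|have [[]] := G' n|have [] := I' n].
have [y hy] : exists y, forall n, Cc n <= y /\ y <= D n.
  by apply: nest => n; [have [_ []] := G' n|have [_ []] := G' n|have [] := I' n].
have [e e0 he] := loc x y (proj1 (hx 0%N)) (proj2 (hx 0%N)) (proj1 (hy 0%N)) (proj2 (hy 0%N)).
have mx0 : 0 <= Num.max (b0 - a0) (d0 - c0) by rewrite le_max subr_ge0 ab0.
have [n hn] := halving_lt mx0 e0.
have [[i1 i2] [i3 i4] i5 i6 i7] := I' n; apply: i7.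
have [h1 h2] := hx n; have [h3 h4] := hy n.
apply: he => //; rewrite ?szA ?szC.
- by rewrite (le_lt_trans _ hn) // ler_pM2r ?invr_gt0 ?exprn_gt0 // le_max lexx.
- by rewrite (le_lt_trans _ hn) // ler_pM2r ?invr_gt0 ?exprn_gt0 // le_max lexx orbT.
- by rewrite mulrAC [RHS]mulrAC [in RHS]mulrC [(b0 - a0) * _]mulrC mulrAC; ring.
Qed.

End RealInduction.

(** * Primitives of holomorphic functions *)

Section Goursat.
Variable R : realType.
Local Notation C := R[i].
Local Notation mu := (@lebesgue_measure R).
Implicit Types (v : R -> R) (u : R -> C).

Definition rcont v (t : R) := forall e : R, 0 < e -> exists2 d : R, 0 < d &
  forall s, `|s - t| < d -> `|v s - v t| < e.

Lemma rcontP v t : rcont v t -> {for t, continuous v}.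
Proof.
move=> h; apply/cvgrPdist_lt => e e0; have [d d0 hd] := h e e0.
apply/nbhs_ballP; exists d => // s; rewrite /ball /= => st.
by rewrite distrC hd // distrC.
Qed.

(** Two-sided continuity on the line at every point of the segment, rather than continuity of the
    restriction, so that it passes to subsegments at once. *)
Definition ccs (v : R -> R) a b := forall t, a <= t -> t <= b -> rcont v t.

Lemma ccs_within v a b : ccs v a b -> {within `[a, b], continuous v}.
Proof.
move=> h; apply: continuous_in_subspaceT => t; rewrite inE /= in_itv /= => /andP[h1 h2].
exact/rcontP/h.
Qed.

Lemma ccs_int v a b : ccs v a b -> mu.-integrable `[a, b] (EFin \o v).
Proof.
by move=> h; apply: continuous_compact_integrable; [exact: segment_compact|exact: ccs_within].
Qed.

Lemma ccsS v a b a' b' : a <= a' -> b' <= b -> ccs v a b -> ccs v a' b'.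
Proof. by move=> aa bb h t h1 h2; apply: h; [exact: le_trans aa h1|exact: le_trans h2 bb]. Qed.

Definition rint v a b : R := Rintegral mu `[a, b] v.

Lemma rint_split v a b c : a <= b -> b <= c -> ccs v a c ->
  rint v a c = rint v a b + rint v b c.
Proof.
move=> ab bc cv; rewrite /rint.
have := @Rintegral_itvB R v (BLeft a) (BRight c) b (ccs_int cv).
rewrite !bnd_simp => /(_ ab bc); rewrite Rintegral_itv_obnd_cbnd.
  by move=> <-; ring.
have cv' : ccs v b c by apply: ccsS cv.
by apply: integrableS (ccs_int cv') => //; exact: subset_itv_oc_cc.
Qed.

Lemma rint_aff (p q : R) a b : a <= b ->
  rint (fun t => p + q * t) a b = p * (b - a) + q * (b ^+ 2 - a ^+ 2) / 2.
Proof.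
rewrite le_eqVlt => /orP[/eqP <-|ab].
  by rewrite /rint set_itv1 Rintegral_set1; ring.
pose F (t : R) : R := p * t + q / 2 * t ^+ 2.
have dF t : is_derive t (1 : R) F (p + q * t).
  apply: is_derive_eq; rewrite /GRing.scale /=; lra.
have cF t : {for t, continuous F}.
  apply: differentiable_continuous; apply/derivable1_diffP; exact: ex_derive.
have cf : {within `[a, b], continuous (fun t : R => p + q * t)}.
  apply: continuous_subspaceT => t; apply: cvgD; first exact: cvg_cst.
  by apply: cvgM; [exact: cvg_cst|exact: cvg_id].
have := continuous_FTC2 ab cf (F := F).
rewrite /rint /Rintegral => ->.
- by rewrite /= /F; field.
- split => [t _||]; first exact: ex_derive.
    by apply: cvg_at_right_filter; exact: cF.
  by apply: cvg_at_left_filter; exact: cF.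
- by move=> t _; rewrite derive1E derive_val.
Qed.

Lemma ccs_aff (p q : R) a b : ccs (fun t => p + q * t) a b.
Proof.
move=> t _ _ e e0; exists (e / (`|q| + 1)); first by rewrite divr_gt0 // ltr_wpDl.
move=> s; rewrite ltr_pdivlMr ?ltr_wpDl // => h.
rewrite (_ : _ - _ = q * (s - t)); last by ring.
by rewrite normrM (le_lt_trans _ h) // mulrC ler_wpM2l // lerDl.
Qed.

Lemma rint_le v (p q : R) a b : a <= b -> ccs v a b ->
  (forall t, a <= t -> t <= b -> v t <= p + q * t) ->
  rint v a b <= p * (b - a) + q * (b ^+ 2 - a ^+ 2) / 2.
Proof.
move=> ab cv h; rewrite -rint_aff //; apply: le_Rintegral => //.
- exact: ccs_int.
- by apply: ccs_int; exact: ccs_aff.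
- by move=> t /=; rewrite in_itv /= => /andP[]; exact: h.
Qed.

Lemma rint_ge v (p q : R) a b : a <= b -> ccs v a b ->
  (forall t, a <= t -> t <= b -> p + q * t <= v t) ->
  p * (b - a) + q * (b ^+ 2 - a ^+ 2) / 2 <= rint v a b.
Proof.
move=> ab cv h; rewrite -rint_aff //; apply: le_Rintegral => //.
- by apply: ccs_int; exact: ccs_aff.
- exact: ccs_int.
- by move=> t /=; rewrite in_itv /= => /andP[]; exact: h.
Qed.

Definition cint u a b : C := (rint (fun t => Re (u t)) a b) +i* (rint (fun t => Im (u t)) a b).

Definition cccs u a b := ccs (fun t => Re (u t)) a b /\ ccs (fun t => Im (u t)) a b.

Lemma cccsS u a b a' b' : a <= a' -> b' <= b -> cccs u a b -> cccs u a' b'.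
Proof. by move=> aa bb [h1 h2]; split; apply: ccsS; eassumption. Qed.

Lemma cint_split u a b c : a <= b -> b <= c -> cccs u a c ->
  cint u a c = cint u a b + cint u b c.
Proof.
by move=> ab bc [h1 h2]; apply: C_eqP; rewrite ReImE /=; exact: rint_split.
Qed.

(** Affine functions are integrated exactly, so only the approximation error remains; the factor 2
    comes from treating real and imaginary parts separately. In Goursat's argument the affine part
    is the first-order expansion of [f]. *)
Lemma cint_aff u (al be : C) (e : R) a b : a <= b -> cccs u a b ->
  (forall t, a <= t -> t <= b -> nc (u t - (al + be * t%:C)) <= e) ->
  nc (cint u a b - (al * (b - a)%:C + be * ((b ^+ 2 - a ^+ 2) / 2)%:C)) <= 2 * e * (b - a).
Proof.
move=> ab [h1 h2] h.
have hR t : a <= t -> t <= b -> `|Re (u t) - (Re al + Re be * t)| <= e.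
  move=> ta tb; apply: le_trans (h t ta tb); apply: le_trans (Re_nc _).
  by rewrite !ReImE /= !mulr0 subr0.
have hI t : a <= t -> t <= b -> `|Im (u t) - (Im al + Im be * t)| <= e.
  move=> ta tb; apply: le_trans (h t ta tb); apply: le_trans (Im_nc _).
  by rewrite !ReImE /= !mulr0 add0r.
apply: (le_trans (nc_ReIm _)); rewrite !ReImE /= !mulr0 ?subr0 ?add0r.
have bd v (p q : R) : ccs v a b -> (forall t, a <= t -> t <= b -> `|v t - (p + q * t)| <= e) ->
    `|rint v a b - (p * (b - a) + q * ((b ^+ 2 - a ^+ 2) / 2))| <= e * (b - a).
  move=> cv hv.
  have k1 := @rint_le v (p + e) q a b ab cv.
  have k2 := @rint_ge v (p - e) q a b ab cv.
  rewrite ler_distl; apply/andP; split.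
    apply: le_trans (k2 _).
      by rewrite mulrA; lra.
    by move=> t ta tb; have := hv t ta tb; rewrite ler_distl => /andP[]; lra.
  apply: (le_trans (k1 _)).
    by move=> t ta tb; have := hv t ta tb; rewrite ler_distl => /andP[]; lra.
  by rewrite mulrA; lra.
have := bd _ _ _ h1 hR; have := bd _ _ _ h2 hI; lra.
Qed.

(** Quantitative differentiability of an integral in its upper end; the absolute values let [x'] lie
    on either side of [x], as a derivative requires. *)
Lemma cint_diff u (al : C) (e : R) A B x x' : A <= x -> x <= B -> A <= x' -> x' <= B ->
  cccs u A B -> (forall t, `|t - x| <= `|x' - x| -> nc (u t - al) <= e) ->
  nc (cint u A x' - cint u A x - al * (x' - x)%:C) <= 2 * e * `|x' - x|.
Proof.
wlog xx : x x' / x <= x' => [hw|].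
  have [|/ltW xx] := leP x x'; first exact: hw.
  move=> h1 h2 h3 h4 cu h.
  have k (a b : R) : a <= b -> A <= a -> b <= B -> (forall t, a <= t -> t <= b -> nc (u t - al) <= e) ->
     nc (cint u A b - cint u A a - al * (b - a)%:C) <= 2 * e * (b - a).
    move=> ab Aa bB hh.
    rewrite (cint_split Aa ab); last by apply: cccsS cu.
    rewrite [X in nc X](_ : _ = cint u a b - (al * (b - a)%:C + 0 * ((b ^+ 2 - a ^+ 2) / 2)%:C)); last by ring.
    apply: cint_aff => //; first exact: cccsS cu.
    by move=> t ta tb; rewrite mul0r addr0; exact: hh.
  rewrite (_ : _ - _ - _ = - (cint u A x - cint u A x' - al * (x - x')%:C)); last first.
    by rewrite !rmorphB /=; ring.
  have n1 : `|x' - x| = x - x' by rewrite distrC ger0_norm ?subr_ge0.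
  rewrite ncN n1; apply: k => // t ta tb.
  by apply: h; rewrite n1 ler0_norm; lra.
move=> h1 h2 h3 h4 cu h.
rewrite (cint_split h1 xx); last by apply: cccsS cu.
rewrite [X in nc X](_ : _ = cint u x x' - (al * (x' - x)%:C + 0 * ((x' ^+ 2 - x ^+ 2) / 2)%:C)); last by ring.
rewrite ger0_norm ?subr_ge0 //; apply: cint_aff => //; first exact: cccsS cu.
move=> t ta tb; rewrite mul0r addr0; apply: h; rewrite !ger0_norm ?subr_ge0 //; lra.
Qed.

Section Rectangle.
Variables (f : C -> C) (A B A' B' : R).
Hypotheses (AB : A < B) (AB' : A' < B').
Hypothesis df : forall x y, A <= x -> x <= B -> A' <= y -> y <= B' ->
  exists d, cder f (x +i* y) d.

Let H y a b := cint (fun t => f (t +i* y)) a b.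
Let V x a b := cint (fun t => f (x +i* t)) a b.

Lemma hor_cccs y : A' <= y -> y <= B' -> cccs (fun t => f (t +i* y)) A B.
Proof.
move=> h1 h2; split => t ta tb e e0; have [d hd] := df ta tb h1 h2;
  have [r r0 hr] := cder_cont hd e0; exists r => // s st.
  rewrite -ReN -ReD; apply: le_lt_trans (Re_nc _) (hr _ _).
  by rewrite (le_lt_trans (nc_ReIm _)) // !ReImE /= subrr normr0 addr0.
rewrite -ImN -ImD; apply: le_lt_trans (Im_nc _) (hr _ _).
by rewrite (le_lt_trans (nc_ReIm _)) // !ReImE /= subrr normr0 addr0.
Qed.

Lemma ver_cccs x : A <= x -> x <= B -> cccs (fun t => f (x +i* t)) A' B'.
Proof.
move=> h1 h2; split => t ta tb e e0; have [d hd] := df h1 h2 ta tb;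
  have [r r0 hr] := cder_cont hd e0; exists r => // s st.
  rewrite -ReN -ReD; apply: le_lt_trans (Re_nc _) (hr _ _).
  by rewrite (le_lt_trans (nc_ReIm _)) // !ReImE /= subrr normr0 add0r.
rewrite -ImN -ImD; apply: le_lt_trans (Im_nc _) (hr _ _).
by rewrite (le_lt_trans (nc_ReIm _)) // !ReImE /= subrr normr0 add0r.
Qed.

Let I a b c d := H c a b + 'i * V b c d - H d a b - 'i * V a c d.

Lemma ri_eq (x y : R) : x +i* y = x%:C + 'i * y%:C.
Proof. by apply/eqP; rewrite eq_complex /=; simpc. Qed.

(** Goursat's theorem. A bound by [eta] times the squared half-perimeter is inherited from the four
    quarters, whose half-perimeters are halved, and it holds on small rectangles because the affine
    part of [f] has integral zero around them; [eta] is arbitrary. *)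
Lemma rect0 b d : A <= b -> b <= B -> A' <= d -> d <= B' -> I A b A' d = 0.
Proof.
move=> Ab bB Ad dB; apply/eqP; rewrite -nc_eq0 eq_le nc_ge0 andbT.
apply/ler_addgt0Pl => e e0; rewrite addr0.
pose K := ((b - A) + (d - A')) ^+ 2 + 1.
have K0 : 0 < K by rewrite ltr_wpDl // sqr_ge0.
pose eta := e / K; have eta0 : 0 < eta by rewrite divr_gt0.
suff h : nc (I A b A' d) <= eta * ((b - A) + (d - A')) ^+ 2.
  apply: (le_trans h); rewrite /eta mulrAC ler_pdivrMr // ler_pM2l // /K; lra.
apply: (@rect_bisect R (fun a b c d => nc (I a b c d) <= eta * ((b - a) + (d - c)) ^+ 2)) => //.
  move=> a b1 c d1 Aa ab bb Ac cd dd m n p1 p2 p3 p4.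
  have E : I a b1 c d1 = I a m c n + I m b1 c n + I a m n d1 + I m b1 n d1.
    have am : a <= m by rewrite /m; lra.
    have mb : m <= b1 by rewrite /m; lra.
    have cn : c <= n by rewrite /n; lra.
    have nd : n <= d1 by rewrite /n; lra.
    have sH y : A' <= y -> y <= B' -> H y a b1 = H y a m + H y m b1.
      move=> h1 h2; apply: cint_split => //.
      by apply: cccsS (hor_cccs h1 h2) => //; lra.
    have sV x : A <= x -> x <= B -> V x c d1 = V x c n + V x n d1.
      move=> h1 h2; apply: cint_split => //.
      by apply: cccsS (ver_cccs h1 h2) => //; lra.
    have q1 : H c a b1 = H c a m + H c m b1 by apply: sH; lra.
    have q2 : H d1 a b1 = H d1 a m + H d1 m b1 by apply: sH; lra.
    have q3 : V a c d1 = V a c n + V a n d1 by apply: sV; lra.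
    have q4 : V b1 c d1 = V b1 c n + V b1 n d1 by apply: sV; lra.
    by rewrite /I q1 q2 q3 q4; ring.
  rewrite E.
  have -> : eta * (b1 - a + (d1 - c)) ^+ 2 =
     eta * (m - a + (n - c)) ^+ 2 + eta * (b1 - m + (n - c)) ^+ 2
     + eta * (m - a + (d1 - n)) ^+ 2 + eta * (b1 - m + (d1 - n)) ^+ 2.
    by rewrite /m /n; field.
  by rewrite (le_trans (ncD _ _)) // lerD // (le_trans (ncD _ _)) // lerD //
     (le_trans (ncD _ _)) // lerD.
move=> x y Ax xb Ay yd.
have [D hD] := df Ax (le_trans xb bB) Ay (le_trans yd dB).
(* Each side contributes at most [2 * (eta / 4 * w)] times its length, and the four lengths add up
   to [2 * w]: the total is [eta * w ^+ 2]. *)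
have [r r0 hr] := hD (eta / 4) ltac:(by rewrite divr_gt0).
exists (r / 2); first by rewrite divr_gt0.
move=> a b1 c d1 Aa ax xb1 bb Ac cy yd1 dd sb sd _.
set z := x +i* y in hD hr.
pose al := f z - D * z.
pose w := (b1 - a) + (d1 - c).
have w0 : 0 <= w by rewrite /w; lra.
have ap s t : a <= s -> s <= b1 -> c <= t -> t <= d1 ->
    nc (f (s +i* t) - (al + D * (s +i* t))) <= eta / 4 * w.
  move=> h1 h2 h3 h4.
  have hw : nc (s +i* t - z) <= w.
    apply: (le_trans (nc_ReIm _)); rewrite !ReImE /= /w.
    by apply: lerD; rewrite ler_norml; apply/andP; split; lra.
  have := hr (s +i* t); rewrite (_ : f _ - _ - _ = f (s +i* t) - (al + D * (s +i* t))).
    move=> k; apply: (le_trans (k _)); first by rewrite (le_lt_trans hw) // /w; lra.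
    by rewrite ler_wpM2l // divr_ge0 // ltW.
  by rewrite /al; ring.
have bH t : c <= t -> t <= d1 -> nc (H t a b1 - ((al + D * ('i * t%:C)) * (b1 - a)%:C
     + D * ((b1 ^+ 2 - a ^+ 2) / 2)%:C)) <= 2 * (eta / 4 * w) * (b1 - a).
  move=> h1 h2; apply: cint_aff; [lra| |].
    by apply: cccsS (hor_cccs _ _); lra.
  move=> s h3 h4; have := ap s t h3 h4 h1 h2; rewrite ri_eq.
  by rewrite (_ : al + D * ('i * t%:C) + _ = al + D * (s%:C + 'i * t%:C)) //; ring.
have bV s : a <= s -> s <= b1 -> nc (V s c d1 - ((al + D * s%:C) * (d1 - c)%:C
     + (D * 'i) * ((d1 ^+ 2 - c ^+ 2) / 2)%:C)) <= 2 * (eta / 4 * w) * (d1 - c).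
  move=> h1 h2; apply: cint_aff; [lra| |].
    by apply: cccsS (ver_cccs _ _); lra.
  move=> t h3 h4; have := ap s t h1 h2 h3 h4; rewrite ri_eq.
  by rewrite (_ : al + D * s%:C + _ = al + D * (s%:C + 'i * t%:C)) //; ring.
have ncI (u : C) : nc ('i * u) = nc u.
  rewrite ncM (_ : nc 'i = 1) ?mul1r //.
  by rewrite /= expr0n expr1n /= add0r sqrtr1.
pose e1 := H c a b1 - ((al + D * ('i * c%:C)) * (b1 - a)%:C + D * ((b1 ^+ 2 - a ^+ 2) / 2)%:C).
pose e2 := V b1 c d1 - ((al + D * b1%:C) * (d1 - c)%:C + (D * 'i) * ((d1 ^+ 2 - c ^+ 2) / 2)%:C).
pose e3 := H d1 a b1 - ((al + D * ('i * d1%:C)) * (b1 - a)%:C + D * ((b1 ^+ 2 - a ^+ 2) / 2)%:C).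
pose e4 := V a c d1 - ((al + D * a%:C) * (d1 - c)%:C + (D * 'i) * ((d1 ^+ 2 - c ^+ 2) / 2)%:C).
have E : I a b1 c d1 = e1 + 'i * e2 - e3 - 'i * e4.
  rewrite /I /e1 /e2 /e3 /e4 !rmorphB /=.
  by ring.
rewrite E.
have k1 : nc e1 <= 2 * (eta / 4 * w) * (b1 - a) by apply: bH; lra.
have k2 : nc e2 <= 2 * (eta / 4 * w) * (d1 - c) by apply: bV; lra.
have k3 : nc e3 <= 2 * (eta / 4 * w) * (b1 - a) by apply: bH; lra.
have k4 : nc e4 <= 2 * (eta / 4 * w) * (d1 - c) by apply: bV; lra.
have q1 := ncB (e1 + 'i * e2 - e3) ('i * e4).
have q2 := ncB (e1 + 'i * e2) e3.
have q3 := ncD e1 ('i * e2).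
rewrite ncI in q1; rewrite ncI in q3.
rewrite (_ : eta * _ = 2 * (eta / 4 * w) * (b1 - a) + 2 * (eta / 4 * w) * (d1 - c)
  + 2 * (eta / 4 * w) * (b1 - a) + 2 * (eta / 4 * w) * (d1 - c)); last by rewrite /w; field.
lra.
Qed.

Definition rect_prim (z : C) : C := H A' A (Re z) + 'i * V (Re z) A' (Im z).

Lemma rect_primP z : A < Re z -> Re z < B -> A' < Im z -> Im z < B' ->
  cder rect_prim z (f z).
Proof.
case: z => x y /= Ax xB Ay yB e e0.
have [D hD] := df (ltW Ax) (ltW xB) (ltW Ay) (ltW yB).
have e40 : 0 < e / 4 by rewrite divr_gt0.
have [r r0 hr] := cder_cont hD e40.
pose t := Num.min (r / 2) (Num.min (Num.min (x - A) (B - x)) (Num.min (y - A') (B' - y))).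
exists t; first by rewrite !lt_min !subr_gt0 Ax xB Ay yB divr_gt0.
case=> x' y' hw.
have hx : `|x' - x| < t by exact: le_lt_trans (Re_nc (x' +i* y' - (x +i* y))) hw.
have hy : `|y' - y| < t by exact: le_lt_trans (Im_nc (x' +i* y' - (x +i* y))) hw.
move: hx hy; rewrite !lt_min => /and3P[hx /andP[hx1 hx2] _] /and3P[hy _ /andP[hy1 hy2]].
have [Ax' x'B] : A <= x' /\ x' <= B.
  by move: hx1 hx2; rewrite !ltr_norml => /andP[? ?] /andP[? ?]; lra.
have [Ay' y'B] : A' <= y' /\ y' <= B'.
  by move: hy1 hy2; rewrite !ltr_norml => /andP[? ?] /andP[? ?]; lra.
(* By [rect0] the other path, first upwards and then across, gives the same value. The step from [z]
   to [x' +i* y'] then splits into a horizontal one at height [y'] and a vertical one at abscissa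
   [x], both close to [z]. *)
have E1 : rect_prim (x' +i* y') = 'i * V A A' y' + H y' A x'.
  have := rect0 Ax' x'B Ay' y'B; rewrite /I /rect_prim /= => h.
  by apply/eqP; rewrite -subr_eq0 -h; apply/eqP; ring.
have E2 : rect_prim (x +i* y') = 'i * V A A' y' + H y' A x.
  have := rect0 (ltW Ax) (ltW xB) Ay' y'B; rewrite /I /rect_prim /= => h.
  by apply/eqP; rewrite -subr_eq0 -h; apply/eqP; ring.
have b1 : nc (H y' A x' - H y' A x - f (x +i* y) * (x' - x)%:C) <= 2 * (e / 4) * `|x' - x|.
  apply: cint_diff Ax' x'B (hor_cccs Ay' y'B) _ => //; try lra.
  move=> s hs; apply/ltW/hr; apply: (le_lt_trans (nc_ReIm _)); rewrite !ReImE /=.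
  rewrite (le_lt_trans (lerD hs (lexx _))) //; lra.
have b2 : nc (V x A' y' - V x A' y - f (x +i* y) * (y' - y)%:C) <= 2 * (e / 4) * `|y' - y|.
  apply: cint_diff Ay' y'B (ver_cccs (ltW Ax) (ltW xB)) _ => //; try lra.
  move=> s hs; apply/ltW/hr; apply: (le_lt_trans (nc_ReIm _)); rewrite !ReImE /=.
  by rewrite subrr normr0 add0r (le_lt_trans hs) //; lra.
have ncI (u : C) : nc ('i * u) = nc u.
  rewrite ncM (_ : nc 'i = 1) ?mul1r //.
  by rewrite /= expr0n expr1n /= add0r sqrtr1.
rewrite (_ : rect_prim (x' +i* y') - _ - _ =
   (H y' A x' - H y' A x - f (x +i* y) * (x' - x)%:C)
   + 'i * (V x A' y' - V x A' y - f (x +i* y) * (y' - y)%:C)); last first.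
  rewrite (_ : rect_prim (x' +i* y') = rect_prim (x +i* y') + (H y' A x' - H y' A x)).
    by rewrite /rect_prim /= !ri_eq !rmorphB /=; ring.
  by rewrite E1 E2; ring.
rewrite (le_trans (ncD _ _)) // ncI (le_trans (lerD b1 b2)) //.
have k1 : `|x' - x| <= nc (x' +i* y' - (x +i* y)) by exact: Re_nc (x' +i* y' - (x +i* y)).
have k2 : `|y' - y| <= nc (x' +i* y' - (x +i* y)) by exact: Im_nc (x' +i* y' - (x +i* y)).
rewrite -mulrDr (_ : 2 * (e / 4) = e / 2); last by field.
rewrite -mulrA ler_pM2l // mulrC ler_pdivrMr //.
by apply: (le_trans (lerD k1 k2)); rewrite mulr_natr.
Qed.

End Rectangle.

End Goursat.

Section Goursat2.
Variable R : realType.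
Local Notation C := R[i].
(** The square with half-side [r / 4] lies inside the disc where [f] is differentiable, and
    [rect_prim] is a primitive in its interior. Primitives are only used locally, so the loss in
    radius is harmless. *)
Theorem primitive (f : C -> C) (z0 : C) (r : R) : 0 < r ->
  (forall z, nc (z - z0) < r -> exists d, cder f z d) ->
  exists2 F : C -> C, F z0 = 0 & forall z, nc (z - z0) < r / 4 -> cder F z (f z).
Proof.
move=> r0 df.
have df' x y : Re z0 - r / 4 <= x -> x <= Re z0 + r / 4 -> Im z0 - r / 4 <= y -> y <= Im z0 + r / 4 ->
   exists d, cder f (x +i* y) d.
  move=> h1 h2 h3 h4; apply: df; apply: (le_lt_trans (nc_ReIm _)); rewrite !ReImE /=.
  have k1 : `|x - Re z0| <= r / 4 by rewrite ler_distl; apply/andP; split; lra.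
  have k2 : `|y - Im z0| <= r / 4 by rewrite ler_distl; apply/andP; split; lra.
  by rewrite (le_lt_trans (lerD k1 k2)) //; lra.
pose G := rect_prim f (Re z0 - r / 4) (Im z0 - r / 4).
exists (fun z => G z - G z0); first by rewrite subrr.
move=> z hz; rewrite -[f z]subr0; apply: cderB; last exact: cder_cst.
have h1 := le_lt_trans (Re_nc _) hz; have h2 := le_lt_trans (Im_nc _) hz.
move: h1 h2; rewrite !ReImE !ltr_distl => /andP[? ?] /andP[? ?].
by apply: (rect_primP df'); lra.
Qed.

End Goursat2.

Arguments Normc.normc {R} x : simpl never.

(** * Mean value inequality and local inverses *)

Section Inverse.
Variable R : realType.
Local Notation C := R[i].
Implicit Types (F f : C -> C) (z w c a y : C).

Definition seg (w z : C) (t : R) : C := w + t%:C * (z - w).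

Lemma seg0 w z : seg w z 0 = w. Proof. by rewrite /seg mul0r addr0. Qed.
Lemma seg1 w z : seg w z 1 = z. Proof. by rewrite /seg mul1r addrC subrK. Qed.
Lemma segB w z s t : seg w z s - seg w z t = (s - t)%:C * (z - w).
Proof. by rewrite /seg rmorphB /=; ring. Qed.
Lemma nc_segB w z s t : nc (seg w z s - seg w z t) = `|s - t| * nc (z - w).
Proof. by rewrite segB nc_scale. Qed.

Lemma seg_ball (c w z : C) (r t : R) : 0 <= t -> t <= 1 ->
  nc (w - c) < r -> nc (z - c) < r -> nc (seg w z t - c) < r.
Proof.
move=> t0 t1 hw hz.
have -> : seg w z t - c = (1 - t)%:C * (w - c) + t%:C * (z - c).
  by rewrite /seg rmorphB rmorph1 /=; ring.
rewrite (le_lt_trans (ncD _ _)) // !nc_scale !ger0_norm ?subr_ge0 //.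
have [->|t0'] := eqVneq t 0; first by rewrite mul0r addr0 subr0 mul1r.
have tp : 0 < t by rewrite lt_def t0'.
have -> : r = (1 - t) * r + t * r by ring.
by apply: ler_ltD; [rewrite ler_wpM2l ?subr_ge0 // ltW|rewrite ltr_pM2l].
Qed.

(** For each [e > 0] the bound with constant [M + e] propagates along the segment by real induction;
    the slack [e] absorbs the differentiability error at each point. *)
Lemma seg_mvt F f w z (M : R) :
  (forall t : R, 0 <= t -> t <= 1 -> cder F (seg w z t) (f (seg w z t)) /\ nc (f (seg w z t)) <= M) ->
  nc (F z - F w) <= M * nc (z - w).
Proof.
move=> h; apply/ler_addgt0Pl => e0 e00.
pose n := nc (z - w); have n0 : 0 <= n by exact: nc_ge0.
pose e := e0 / (n + 1); have ep : 0 < e by rewrite divr_gt0 // ltr_wpDl.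
have en : e * n <= e0.
  by rewrite /e mulrAC ler_pdivrMr ?ltr_wpDl // ler_pM2l //; lra.
suff H : forall t : R, 0 <= t -> t <= 1 -> nc (F (seg w z t) - F w) <= (M + e) * t * n.
  by have := H 1 ler01 (lexx _); rewrite seg1 -/n => H1; apply: (le_trans H1); lra.
have key t : 0 <= t -> t <= 1 -> exists2 d : R, 0 < d & forall s, `|s - t| < d ->
   nc (F (seg w z s) - F (seg w z t)) <= (M + e) * `|s - t| * n.
  move=> t0 t1; have [hd hM] := h t t0 t1; have [d d0 hd'] := hd e ep.
  exists (d / (n + 1)); first by rewrite divr_gt0 // ltr_wpDl.
  move=> s; rewrite ltr_pdivlMr ?ltr_wpDl // => hs.
  have := hd' (seg w z s); rewrite nc_segB -/n => /(_ ltac:(rewrite (le_lt_trans _ hs) // ler_wpM2l //; lra)) k.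
  rewrite (_ : F (seg w z s) - F (seg w z t) = (F (seg w z s) - F (seg w z t)
     - f (seg w z t) * (seg w z s - seg w z t)) + f (seg w z t) * (seg w z s - seg w z t)); last by ring.
  rewrite (le_trans (ncD _ _)) // ncM nc_segB -/n -mulrA addrC mulrDl.
  by rewrite lerD // ler_wpM2r // mulr_ge0.
apply: (@real_ind R (fun t => nc (F (seg w z t) - F w) <= (M + e) * t * n)) => //.
- by rewrite seg0 subrr nc0 mulr0 mul0r.
- move=> t t0 t1 hp; have [d d0 hd] := key t t0 (ltW t1); exists d => // s ts sd _.
  have := hd s; rewrite gtr0_norm ?subr_gt0 // => /(_ ltac:(lra)) k.
  apply: (le_trans (nc_tri (F (seg w z t)) _ _)).
  by apply: (le_trans (lerD k (hp t t0 (lexx _)))); rewrite -mulrDl -mulrDr subrK.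
- move=> t t0 t1 hp; have [d d0 hd] := key t (ltW t0) t1.
  pose s := Num.max 0 (t - d / 2).
  have s0 : 0 <= s by rewrite le_max lexx.
  have st : s < t by rewrite gt_max t0 /=; lra.
  have sd : `|s - t| < d.
    by rewrite ltr0_norm ?subr_lt0 // opprB; have : t - d / 2 <= s; [rewrite le_max lexx orbT|lra].
  have := hd s sd; rewrite ltr0_norm ?subr_lt0 // opprB ncC => k.
  apply: (le_trans (nc_tri (F (seg w z s)) _ _)).
  by apply: (le_trans (lerD k (hp s s0 st))); rewrite -mulrDl -mulrDr subrK.
Qed.

(** The mean value inequality for [F] minus its linear part: where [f] stays close to [a], [F] is
    close to multiplication by [a]. The inverse theorem and the distortion estimates for areas rest
    on it. *)
Lemma ball_mvt F f c (r : R) a (e : R) :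
  (forall z, nc (z - c) < r -> cder F z (f z) /\ nc (f z - a) <= e) ->
  forall z w, nc (z - c) < r -> nc (w - c) < r -> nc (F z - F w - a * (z - w)) <= e * nc (z - w).
Proof.
move=> h z w hz hw.
rewrite (_ : _ - _ - _ = (F z - a * z) - (F w - a * w)); last by ring.
apply: (@seg_mvt (fun z => F z - a * z) (fun z => f z - a)) => t t0 t1.
have [h1 h2] := h _ (seg_ball t0 t1 hw hz); split => //.
by apply: cderB => //; rewrite -{2}[a]mulr1; apply: cderZ; exact: cder_id.
Qed.

Lemma ball_const F c (r : R) : (forall z, nc (z - c) < r -> cder F z 0) ->
  forall z w, nc (z - c) < r -> nc (w - c) < r -> F z = F w.
Proof.
move=> h z w hz hw; apply/eqP; rewrite -subr_eq0 -nc_eq0 eq_le nc_ge0 andbT.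
have := @ball_mvt F (fun=> 0) c r 0 0 _ z w hz hw; rewrite !mul0r !subr0; apply => u hu.
by split; [exact: h|rewrite nc0].
Qed.

Lemma within_cont (g : C -> R) (A : set C) :
  (forall z, A z -> forall e : R, 0 < e -> exists2 t : R, 0 < t & forall w, nc (w - z) < t -> `|g w - g z| < e) ->
  {within A, continuous g}.
Proof.
move=> h; apply: continuous_in_subspaceT => z; rewrite inE => Az.
move=> U /nbhs_ballP[e e0 sub]; have [t t0 ht] := h z Az e e0.
by apply/nbhs_ncP; exists t => // w /ht hw; apply: sub; rewrite /ball /= distrC.
Qed.

Lemma nc_dist (a b : C) : `|nc a - nc b| <= nc (a - b).
Proof.
have h1 := ncD (a - b) b; rewrite subrK in h1.
have h2 := ncD (b - a) a; rewrite subrK (ncC b) in h2.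
rewrite ler_distl; apply/andP; split; lra.
Qed.

(** Where [f] is close to [f z0], [F] multiplies distances by at least [nc (f z0) / 2], whence
    injectivity. For surjectivity [nc (F w - y)] is minimised over a closed disc: the minimum is
    reached inside, and a nonzero minimum would be lowered by a small Newton step. *)
Lemma local_inverse F f (z0 : C) (r : R) : 0 < r -> (forall z, nc (z - z0) < r -> cder F z (f z)) ->
  ccont f z0 -> f z0 != 0 ->
  exists d : R, exists e : R, exists G : C -> C, [/\ 0 < d /\ d <= r, 0 < e,
    forall z w, nc (z - z0) < d -> nc (w - z0) < d -> nc (f z0) / 2 * nc (z - w) <= nc (F z - F w),
    forall z, nc (z - z0) < d -> f z != 0
  & forall y, nc (y - F z0) < e -> nc (G y - z0) < d /\ F (G y) = y].
Proof.
move=> r0 dF cf f0.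
pose a := nc (f z0); have a0 : 0 < a by rewrite nc_gt0.
have a20 : 0 < a / 2 by rewrite divr_gt0.
have [d0 d00 hd0] := cf _ a20.
pose d := Num.min d0 r; have dp : 0 < d by rewrite lt_min d00.
have dd0 z : nc (z - z0) < d -> nc (z - z0) < d0 by rewrite lt_min => /andP[].
have dr z : nc (z - z0) < d -> nc (z - z0) < r by rewrite lt_min => /andP[].
have low z w : nc (z - z0) < d -> nc (w - z0) < d -> a / 2 * nc (z - w) <= nc (F z - F w).
  move=> hz hw.
  have k : nc (F z - F w - f z0 * (z - w)) <= a / 2 * nc (z - w).
    apply: (@ball_mvt F f z0 d) => // u hu; split; first by apply: dF; exact: dr.
    exact/ltW/hd0/dd0.
  have := ncB (F z - F w - f z0 * (z - w)) (F z - F w).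
  rewrite (_ : _ - _ - _ - _ = - (f z0 * (z - w))); last by ring.
  rewrite ncN ncM -/a; lra.
have fn0 z : nc (z - z0) < d -> f z != 0.
  move=> hz; apply/eqP => fz; have := hd0 _ (dd0 _ hz).
  by rewrite fz sub0r ncN -/a; lra.
(* On the circle of radius [d / 2] the values of [F] are at least [a * d / 4], twice [e], away from
   [F z0], hence farther than [e] from [y]; the centre does better. *)
pose e := a * d / 8; have e0 : 0 < e by rewrite divr_gt0 ?mulr_gt0.
have surj y : exists w, nc (y - F z0) < e -> nc (w - z0) < d /\ F w = y.
  have [hy|hy] := pselect (nc (y - F z0) < e); last by exists 0.
  pose K := [set w : C | nc (w - z0) <= d / 2].
  have Kd w : K w -> nc (w - z0) < d by move=> h; apply: (le_lt_trans h); lra.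
  have K0 : K z0 by rewrite /K /= subrr nc0 divr_ge0 // ltW.
  have Kn : K !=set0 by exists z0.
  have cK : {within K, continuous (fun w => nc (F w - y))}.
    apply: within_cont => z Kz e1 e10.
    have [t t0 ht] := cder_cont (dF _ (dr _ (Kd _ Kz))) e10.
    exists t => // w /ht hw; apply: (le_lt_trans (nc_dist _ _)).
    by rewrite (_ : _ - _ - _ = F w - F z) //; ring.
  have [w] := compact_EVT_min Kn (@compact_disc R z0 (d / 2)) cK.
  rewrite inE => Kw wmin; pose m := nc (F w - y).
  have m0 := wmin z0; rewrite inE in m0; have {}m0 := m0 K0.
  rewrite (ncC (F z0)) in m0; have me : m < e by exact: le_lt_trans m0 hy.
  have wd : nc (w - z0) < d / 2.
    rewrite lt_neqAle Kw andbT; apply/eqP => E.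
    have z0d : nc (z0 - z0) < d by rewrite subrr nc0.
    have := low w z0 (Kd _ Kw) z0d; rewrite E.
    have := nc_tri y (F w) (F z0); rewrite -/m /e in me *.
    move: hy; rewrite /e; move: (nc (F w - F z0)) (nc (y - F z0)) => p q ? ? ?.
    have : a / 2 * (d / 2) = 2 * (a * d / 8) by field.
    move: me; lra.
  exists w => _; split; first exact: Kd.
  apply/eqP; rewrite -subr_eq0 -nc_eq0 eq_le nc_ge0 andbT leNgt; apply/negP; rewrite -/m => mp.
  have fw := fn0 _ (Kd _ Kw); have nfw : 0 < nc (f w) by rewrite nc_gt0.
  have fw2 : 0 < nc (f w) / 2 by rewrite divr_gt0.
  have [t1 t10 ht1] := dF _ (dr _ (Kd _ Kw)) _ fw2.
  pose q := m / nc (f w); have q0 : 0 < q by rewrite divr_gt0.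
  pose rho := Num.min t1 (d / 2 - nc (w - z0)).
  have rho0 : 0 < rho by rewrite lt_min t10 subr_gt0.
  (* A fraction [t] of the Newton step, short enough for the differentiability estimate and for
     staying in the disc. It replaces [m] by at most [(1 - t) * m + t * m / 2]. *)
  pose t := Num.min 1 (rho / 2 / q).
  have tp : 0 < t by rewrite lt_min ltr01 !divr_gt0.
  have tl1 : t <= 1 by rewrite ge_min lexx.
  have tq : t * q < rho.
    rewrite -ltr_pdivlMr //; apply: (@le_lt_trans _ _ (rho / 2 / q)); first by rewrite ge_min lexx orbT.
    by rewrite ltr_pM2r ?invr_gt0 //; lra.
  pose s := t%:C * ((y - F w) / f w).
  have ns : nc s = t * q.
    by rewrite /s nc_scale gtr0_norm // ncM ncV ncC.
  have ws : w + s - w = s by ring.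
  have := ht1 (w + s); rewrite ws ns => /(_ ltac:(by apply: (lt_le_trans tq); rewrite ge_min lexx)) k.
  have Kws : K (w + s).
    rewrite /K /= (_ : w + s - z0 = s + (w - z0)); last by ring.
    rewrite (le_trans (ncD _ _)) // ns -lerBrDr; apply/ltW/(lt_le_trans tq).
    by rewrite ge_min lexx orbT.
  have := wmin (w + s); rewrite inE => /(_ Kws); rewrite -/m leNgt => /negP; apply.
  have -> : F (w + s) - y = (F (w + s) - F w - f w * s) + (1 - t)%:C * (F w - y).
    have -> : f w * s = t%:C * (y - F w) by rewrite /s mulrCA [f w * _]mulrC divfK.
    by rewrite rmorphB rmorph1 /=; ring.
  rewrite (le_lt_trans (ncD _ _)) // nc_scale ger0_norm ?subr_ge0 // -/m.
  apply: (le_lt_trans (lerD k (lexx _))).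
  have -> : nc (f w) / 2 * (t * q) = t * m / 2 by rewrite /q; field; rewrite gt_eqF.
  have : 0 < t * m by rewrite mulr_gt0.
  clear -R; lra.
have [G hG] := choice surj.
exists d, e, G; split => //.
by split => //; rewrite ge_min lexx orbT.
Qed.

Lemma cder_inv F G (y d : C) (a e : R) : 0 < a -> 0 < e -> d != 0 ->
  cder F (G y) d ->
  (forall y', nc (y' - y) < e -> F (G y') = y' /\ a * nc (G y' - G y) <= nc (y' - y)) ->
  cder G y d^-1.
Proof.
move=> a0 e0 dn0 dF h e1 e10.
have nd : 0 < nc d by rewrite nc_gt0.
have e2 : 0 < e1 * a * nc d by rewrite !mulr_gt0.
have [t t0 ht] := dF _ e2.
exists (Num.min e (t * a)) => [|y']; first by rewrite lt_min e0 mulr_gt0.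
rewrite lt_min => /andP[ye yt]; have [FG lip] := h _ ye.
have [FGy _] : F (G y) = y /\ a * nc (G y - G y) <= nc (y - y) by apply: h; rewrite subrr nc0.
have ut : nc (G y' - G y) < t by rewrite -(ltr_pM2r a0) mulrC (le_lt_trans lip).
have := ht _ ut; rewrite FG FGy => k.
have -> : G y' - G y - d^-1 * (y' - y) = - (d^-1 * (y' - y - d * (G y' - G y))).
  by field.
rewrite ncN ncM ncV ler_pdivrMl // (le_trans k) //.
rewrite (_ : e1 * a * nc d * nc (G y' - G y) = nc d * (e1 * (a * nc (G y' - G y)))); last by ring.
by rewrite ler_pM2l // ler_pM2l.
Qed.

End Inverse.

(** * Flat immersions of plane domains *)

Section Immersion.
Variables (R : realType) (T : translationSurface R).
Local Notation C := R[i].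
Local Notation f := (form_coef (omega T)).
Local Notation ch i := (chart_map (atlas i)).
Local Notation chi i := (chart_inv (atlas i)).
Local Notation dom i := (chart_dom (atlas i)).
Local Notation img i := (chart_img (atlas i)).
Local Notation sing := (singularities T).
Implicit Types (i j : chart_index T) (x y p : T) (phi psi : C -> T) (z w a : C).

Lemma T_hausdorff : hausdorff_space T.
Proof. exact: surface_hausdorff. Qed.

Lemma ch_img i x : dom i x -> img i (ch i x).
Proof. by move=> dx; exists x. Qed.

Lemma chK i x : dom i x -> chi i (ch i x) = x.
Proof. exact: chart_mapK. Qed.

Lemma chi_dom i z : img i z -> dom i (chi i z).
Proof. by case=> x dx <-; rewrite chK. Qed.

Lemma chiK i z : img i z -> ch i (chi i z) = z.
Proof. by case=> x dx <-; rewrite chK. Qed.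

Lemma ch_cont i x : dom i x -> {for x, continuous (ch i)}.
Proof.
move=> dx; have := chart_continuous (c := atlas i).
rewrite continuous_open_subspace; last exact: chart_open.
by apply; rewrite inE.
Qed.

Lemma chi_cont i z : img i z -> {for z, continuous (chi i)}.
Proof.
move=> dz; have := chart_inv_continuous (c := atlas i).
rewrite continuous_open_subspace; last exact: chart_open_img.
by apply; rewrite inE.
Qed.

Lemma img_ball i z : img i z -> exists2 r : R, 0 < r & forall w, nc (w - z) < r -> img i w.
Proof. by move: (z); apply/openCP; exact: chart_open_img. Qed.

Lemma dom_open i x : dom i x -> nbhs x (dom i).
Proof. by move=> dx; apply: open_nbhs_nbhs; split=> //; exact: chart_open. Qed.

Lemma sing_chart i x : dom i x -> sing x <-> f i (ch i x) = 0.
Proof.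
move=> dx; split; last by move=> h; exists i.
by case=> j [dj fj]; rewrite (form_compatible (omega T) dx dj) fj mul0r.
Qed.

Lemma f_cder i z : img i z -> exists d, cder (f i) z d.
Proof.
move=> hz; exists (derive1 (f i) z); apply: derivable_cder.
exact: (form_holomorphic (h := omega T)).
Qed.

Lemma f_cont i z : img i z -> ccont (f i) z.
Proof. by move=> /f_cder[d]; exact: cder_cont. Qed.

Lemma transition_cder i j x : dom i x -> dom j x ->
  cder (transition (atlas i) (atlas j)) (ch i x) (derive1 (transition (atlas i) (atlas j)) (ch i x)).
Proof.
move=> di dj; apply: derivable_cder; apply: (@atlas_holomorphic R T i j).
by exists x.
Qed.

(* The pull-back of [omega] by [phi] is [dz]: [phi] is a translation in flat
   charts. *)
Definition imm_at phi z := [/\ ~ sing (phi z), {for z, continuous phi} &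
  forall i, dom i (phi z) -> cder (fun w => ch i (phi w)) z (f i (ch i (phi z)))^-1].

Definition imm (U : set C) phi := forall z, U z -> imm_at phi z.

(** One chart is enough: by the chain rule and the transition rule of the coefficients, the inverse
    of one coefficient is turned into the inverse of the other. *)
Lemma imm_at1 i phi z : dom i (phi z) -> ~ sing (phi z) -> {for z, continuous phi} ->
  cder (fun w => ch i (phi w)) z (f i (ch i (phi z)))^-1 -> imm_at phi z.
Proof.
move=> di ns cphi dphi; split => // j dj.
have fi0 : f i (ch i (phi z)) != 0 by apply/eqP => /(sing_chart di).
have E := form_compatible (omega T) di dj.
set t := derive1 _ _ in E.
have t0 : t != 0 by apply: contraNneq fi0 => h; rewrite E h mulr0.
have fj0 : f j (ch j (phi z)) != 0 by apply: contraNneq fi0 => h; rewrite E h mul0r.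
have -> : (f j (ch j (phi z)))^-1 = t * (f i (ch i (phi z)))^-1.
  by rewrite E invfM mulrCA mulfV // mulr1.
have [r r0 hr] := (proj1 (ccontX phi z)) cphi _ (chart_open (atlas i)) di.
apply: (cder_ext r0 _ (cder_comp dphi (transition_cder di dj))) => w wr.
by rewrite /transition chK //; exact: hr.
Qed.

Lemma imm_at_ext phi psi z (r : R) : 0 < r -> (forall w, nc (w - z) < r -> phi w = psi w) ->
  imm_at phi z -> imm_at psi z.
Proof.
move=> r0 e [h1 h2 h3]; have ez : phi z = psi z by apply: e; rewrite subrr nc0.
split; first by rewrite -ez.
  apply/ccontX => O oO Oz; rewrite -ez in Oz.
  have [t t0 ht] := (proj1 (ccontX phi z)) h2 O oO Oz.
  exists (Num.min t r) => [|w]; first by rewrite lt_min t0.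
  by rewrite lt_min => /andP[wt wr]; rewrite -e //; exact: ht.
move=> i di; rewrite -ez in di *; apply: (cder_ext r0 _ (h3 i di)) => w wr.
by rewrite e.
Qed.

Lemma imm_at_shift phi a z : imm_at phi (z + a) -> imm_at (fun w => phi (w + a)) z.
Proof.
case=> h1 h2 h3; split; first exact: h1.
  apply/ccontX => O oO Oz; have [t t0 ht] := (proj1 (ccontX phi _)) h2 O oO Oz.
  by exists t => // w hw; apply: ht; rewrite (_ : w + a - (z + a) = w - z) //; ring.
move=> i di; rewrite -[_^-1]mulr1.
exact: (cder_comp (cder_translate a z) (h3 i di)).
Qed.

(* [F] is a primitive of [omega] in the chart [i] around the regular point [x],
   with inverse [G] on the disc of radius [e]. *)
Definition flatbox x i (d e a : R) (F G : C -> C) : Prop :=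
  [/\ [/\ dom i x, 0 < d, 0 < e, 0 < a & F (ch i x) = 0],
      forall z, nc (z - ch i x) < d -> [/\ img i z, f i z != 0 & cder F z (f i z)],
      forall z w, nc (z - ch i x) < d -> nc (w - ch i x) < d -> a * nc (z - w) <= nc (F z - F w)
    & forall y : C, nc y < e -> nc (G y - ch i x) < d /\ F (G y) = y].

Lemma flatbox_ex i x : dom i x -> ~ sing x -> exists d e a : R, exists F G, flatbox x i d e a F G.
Proof.
move=> dx ns; have fi0 : f i (ch i x) != 0 by apply/eqP => /(sing_chart dx).
have [r r0 hr] := img_ball (ch_img dx).
have [F F0 dF] := primitive r0 (fun z hz => f_cder (hr z hz)).
have r40 : 0 < r / 4 by rewrite divr_gt0.
have [d [e [G [[d0 dr] e0 low fn0 hG]]]] := local_inverse r40 dF (f_cont (ch_img dx)) fi0.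
exists d, e, (nc (f i (ch i x)) / 2), F, G; split => //.
- by split => //; rewrite divr_gt0 // nc_gt0.
- move=> z zd; have zr := lt_le_trans zd dr.
  split; [apply: hr|exact: fn0|exact: dF].
  by apply: (lt_trans zr); rewrite ltr_pdivrMr // ltr_pMr //; lra.
- by move=> y hy; apply: hG; rewrite F0 subr0.
Qed.

Section FlatBox.
Variables (x : T) (i : chart_index T) (d e a : R) (F G : C -> C).
Hypothesis fb : flatbox x i d e a F G.

Lemma fb_inj z w : nc (z - ch i x) < d -> nc (w - ch i x) < d -> F z = F w -> z = w.
Proof.
case: fb => -[_ _ _ a0 _] _ low _ hz hw E; apply/eqP; rewrite -subr_eq0 -nc_eq0 eq_le nc_ge0 andbT.
by have := low z w hz hw; rewrite E subrr nc0 pmulr_rle0.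
Qed.

Lemma fb_G_cder (y : C) : nc y < e -> cder G y (f i (G y))^-1.
Proof.
move=> hy; case: fb => -[dx d0 e0 a0 F0] h low hG.
have [gd FG] := hG y hy; have [gi gn0 gc] := h _ gd.
have ey : 0 < e - nc y by rewrite subr_gt0.
apply: (cder_inv a0 ey gn0 gc) => y' hy'.
have y'e : nc y' < e by have := ncD (y' - y) y; rewrite subrK; lra.
have [gd' FG'] := hG y' y'e; split => //.
by rewrite -[X in _ <= nc (X - _)]FG' -[X in _ <= nc (_ - X)]FG; exact: low.
Qed.

Lemma fb_imm : imm [set y : C | nc y < e] (fun y : C => chi i (G y)).
Proof.
move=> y /= hy; case: (fb) => -[dx d0 e0 a0 F0] h low hG.
have [gd FG] := hG y hy; have [gi gn0 gc] := h _ gd.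
have dG := chi_dom gi; have cG := fb_G_cder hy.
apply: (@imm_at1 i) => //.
- by move/(sing_chart dG); rewrite chiK //; apply/eqP.
- apply: continuous_comp; first by apply/ccontP; exact: cder_cont cG.
  exact: chi_cont.
- rewrite chiK //.
  have ey : 0 < e - nc y by rewrite subr_gt0.
  apply: (cder_ext ey _ cG) => w hw.
  have we : nc w < e by have := ncD (w - y) y; rewrite subrK; lra.
  by have [gd' _] := hG w we; have [gi' _ _] := h _ gd'; rewrite chiK.
Qed.

Lemma fb0 : chi i (G 0) = x.
Proof.
case: (fb) => -[dx d0 e0 a0 F0] h low hG; have [gd FG] := hG 0 ltac:(by rewrite nc0).
rewrite (_ : G 0 = ch i x) ?chK //; apply: fb_inj => //; first by rewrite subrr nc0.
by rewrite FG F0.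
Qed.

Lemma fb_F_cont z : nc (z - ch i x) < d -> ccont F z.
Proof. by case: fb => _ h _ _ /h[_ _]; exact: cder_cont. Qed.

Lemma fb_nbhs (eta : R) : 0 < eta -> exists2 O : set T, open O /\ O x &
  forall y, O y -> [/\ dom i y, nc (ch i y - ch i x) < d & nc (F (ch i y)) < eta].
Proof.
move=> eta0; case: (fb) => -[dx d0 e0 a0 F0] h low hG.
have hx : nc (ch i x - ch i x) < d by rewrite subrr nc0.
have [t t0 ht] := fb_F_cont hx eta0.
have nx : nbhs x (dom i `&` [set y | nc (ch i y - ch i x) < Num.min d t]).
  apply: filterI; first exact: dom_open.
  have nV : nbhs (ch i x) [set w | nc (w - ch i x) < Num.min d t].
    by apply/nbhs_ncP; exists (Num.min d t) => //; rewrite lt_min d0.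
  exact: (ch_cont dx nV).
move: nx; rewrite nbhsE => -[ O oO sub]; exists O; first by case: oO.
move=> y /sub[dy]; rewrite /= lt_min => /andP[yd yt]; split => //.
by have := ht _ yt; rewrite F0 subr0.
Qed.

Lemma fb_chi_F y : dom i y -> nc (ch i y - ch i x) < d -> nc (F (ch i y)) < e -> chi i (G (F (ch i y))) = y.
Proof.
case: (fb) => -[dx d0 e0 a0 F0] h low hG dy yd ye; have [gd FG] := hG _ ye.
by rewrite (fb_inj gd yd FG) chK.
Qed.

(** In the flat coordinate [F] of the box every immersion is a translation. *)
Lemma fb_lift phi z : imm_at phi z -> dom i (phi z) -> nc (ch i (phi z) - ch i x) < d ->
  cder (fun w => F (ch i (phi w))) z 1.
Proof.
case=> _ _ h3 di hd; case: (fb) => _ h _ _; have [_ fn0 Fc] := h _ hd.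
by have := cder_comp (h3 i di) Fc; rewrite mulfV.
Qed.

End FlatBox.

(** Read in a flat box, the two maps differ by a function of derivative zero that vanishes at [z];
    injectivity of [F] does the rest. *)
Lemma imm_uniq_loc phi psi z (r : R) : 0 < r ->
  (forall w, nc (w - z) < r -> imm_at phi w /\ imm_at psi w) -> phi z = psi z ->
  exists2 r' : R, 0 < r' & forall w, nc (w - z) < r' -> phi w = psi w.
Proof.
move=> r0 hi e; have [h1 h2] := hi z ltac:(by rewrite subrr nc0).
have [i di] := atlas_cover (phi z); have ns : ~ sing (phi z) by case: h1.
have [d [e1 [a [F [G fb]]]]] := flatbox_ex di ns.
have [ O [oO Oz] hO] := fb_nbhs fb ltr01.
have [c1 c2] : {for z, continuous phi} /\ {for z, continuous psi} by case: h1; case: h2.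
have [t1 t10 ht1] := (proj1 (ccontX phi z)) c1 O oO Oz.
have [t2 t20 ht2] := (proj1 (ccontX psi z)) c2 O oO ltac:(by rewrite -e).
exists (Num.min r (Num.min t1 t2)) => [|w]; first by rewrite !lt_min r0 t10.
move=> hw; have h w' : nc (w' - z) < Num.min r (Num.min t1 t2) ->
   [/\ imm_at phi w', imm_at psi w', O (phi w') & O (psi w')].
  by rewrite !lt_min => /and3P[/hi[? ?] /ht1 ? /ht2 ?].
have zz : nc (z - z) < Num.min r (Num.min t1 t2) by rewrite subrr nc0 !lt_min r0 t10.
have := @ball_const R (fun w => F (ch i (phi w)) - F (ch i (psi w))) z _ _ w z hw zz.
rewrite e subrr => E.
have {}E : F (ch i (phi w)) = F (ch i (psi w)).
  apply/eqP; rewrite -subr_eq0; apply/eqP/E => w' /h[i1 i2 /hO[k1 k2 _] /hO[k3 k4 _]].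
  by rewrite -(subrr 1); apply: cderB; apply: (fb_lift fb).
have [_ _ /hO[k1 k2 _] /hO[k3 k4 _]] := h w hw.
by rewrite -(chK k1) -(chK k3) (fb_inj fb k2 k4 E).
Qed.

Definition oset (U : set C) := forall z, U z -> exists2 r : R, 0 < r & forall w, nc (w - z) < r -> U w.
Definition cvx (U : set C) := forall w z t, U w -> U z -> 0 <= t -> t <= 1 -> U (seg w z t).

Lemma oset_ball z (r : R) : oset [set w | nc (w - z) < r].
Proof.
move=> w /= hw; exists (r - nc (w - z)) => [|u hu]; first by rewrite subr_gt0.
by have := nc_tri w u z; lra.
Qed.

Lemma cvx_ball z (r : R) : cvx [set w | nc (w - z) < r].
Proof. by move=> w u t /= hw hu t0 t1; exact: seg_ball. Qed.

Lemma osetI U V : oset U -> oset V -> oset (U `&` V).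
Proof.
move=> oU oV z [Uz Vz]; have [r r0 hr] := oU z Uz; have [s s0 hs] := oV z Vz.
exists (Num.min r s) => [|w]; first by rewrite lt_min r0.
by rewrite lt_min => /andP[/hr ? /hs ?].
Qed.

Lemma cvxI U V : cvx U -> cvx V -> cvx (U `&` V).
Proof. by move=> cU cV w z t [? ?] [? ?] ? ?; split; [exact: cU|exact: cV]. Qed.

Lemma imm_along U phi w z (t : R) O : imm U phi -> U (seg w z t) -> open O -> O (phi (seg w z t)) ->
  exists2 d : R, 0 < d & forall s, `|s - t| < d -> O (phi (seg w z s)).
Proof.
move=> hi Ut oO Ot; have [_ c _] := hi _ Ut.
have [d d0 hd] := (proj1 (ccontX phi _)) c O oO Ot.
exists (d / (nc (z - w) + 1)); first by rewrite divr_gt0 // ltr_wpDl ?nc_ge0.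
move=> s; rewrite ltr_pdivlMr ?ltr_wpDl ?nc_ge0 // => hs; apply: hd.
by rewrite nc_segB (le_lt_trans _ hs) // ler_wpM2l // lerDl.
Qed.

Lemma left_approx (t d : R) : 0 < t -> 0 < d -> exists s : R, [/\ 0 <= s, s < t & `|s - t| < d].
Proof.
move=> t0 d0; exists (Num.max 0 (t - d / 2)).
have h1 : 0 <= Num.max 0 (t - d / 2) by rewrite le_max lexx.
have h2 : Num.max 0 (t - d / 2) < t by rewrite gt_max t0 /=; lra.
have h3 : t - d / 2 <= Num.max 0 (t - d / 2) by rewrite le_max lexx orbT.
by split => //; rewrite ltr0_norm ?subr_lt0 //; lra.
Qed.

(** Continuation along a segment: agreement spreads by [imm_uniq_loc] and passes to limits because
    the surface is Hausdorff. One common value thus determines a development; domains are kept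
    convex for this purpose. *)
Lemma imm_uniq U phi psi z w : oset U -> cvx U -> imm U phi -> imm U psi ->
  U z -> U w -> phi z = psi z -> phi w = psi w.
Proof.
move=> oU cU i1 i2 Uz Uw e.
suff H : forall t : R, 0 <= t -> t <= 1 -> phi (seg z w t) = psi (seg z w t).
  by have := H 1 ler01 (lexx _); rewrite seg1.
have Us t : 0 <= t -> t <= 1 -> U (seg z w t) by move=> *; exact: cU.
apply: real_ind => //; first by rewrite seg0.
- move=> t t0 t1 h; have Ut := Us t t0 (ltW t1).
  have [r r0 hr] := oU _ Ut.
  have [r' r'0 hr'] := imm_uniq_loc r0 (fun u hu => conj (i1 u (hr u hu)) (i2 u (hr u hu))) (h t t0 (lexx _)).
  exists (r' / (nc (w - z) + 1)); first by rewrite divr_gt0 // ltr_wpDl ?nc_ge0.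
  move=> s ts sd _; apply: hr'; rewrite nc_segB gtr0_norm ?subr_gt0 //.
  have : s - t < r' / (nc (w - z) + 1) by lra.
  rewrite ltr_pdivlMr ?ltr_wpDl ?nc_ge0 // => hs.
  by rewrite (le_lt_trans _ hs) // ler_wpM2l ?subr_ge0 ?(ltW ts) // lerDl.
- move=> t t0 t1 h; have Ut := Us t (ltW t0) t1.
  apply: T_hausdorff => A B; rewrite !nbhsE => -[A' [oA Ax] sA] [B' [oB Bx] sB].
  have [d1 d10 h1] := imm_along i1 Ut oA Ax.
  have [d2 d20 h2] := imm_along i2 Ut oB Bx.
  have dm : 0 < Num.min d1 d2 by rewrite lt_min d10.
  have [s [s0 st]] := left_approx t0 dm; rewrite lt_min => /andP[sd1 sd2].
  exists (phi (seg z w s)); split; first by apply/sA/h1.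
  by rewrite h //; apply/sB/h2.
Qed.

(** The radius [eps] is the same for all points near [x]. This uniformity lets an immersion be
    continued across a boundary point at which it accumulates on a regular point. *)
Lemma reg_radius x : ~ sing x -> exists2 eps : R, 0 < eps & exists2 O : set T, open O /\ O x &
  forall y, O y -> exists2 psi, imm [set w | nc w < eps] psi & psi 0 = y.
Proof.
move=> ns; have [i dx] := atlas_cover x.
have [d [e [a [F [G fb]]]]] := flatbox_ex dx ns.
have e0 : 0 < e by case: fb => -[].
have e20 : 0 < e / 2 by rewrite divr_gt0.
have [ O oO hO] := fb_nbhs fb e20.
exists (e / 2) => //; exists O => // y /hO[dy yd yF].
exists (fun w => chi i (G (w + F (ch i y)))); last first.
  by rewrite add0r; apply: (fb_chi_F fb) => //; apply: (lt_trans yF); lra.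
move=> w /= hw; apply: (@imm_at_shift (fun w => chi i (G w))).
by apply: (fb_imm fb) => /=; rewrite (le_lt_trans (ncD _ _)) //; lra.
Qed.

End Immersion.

(** * Neighbourhoods of the zeros *)

Section RootCount.
Variable R : realType.
Local Notation C := R[i].

Lemma unity_factor (n : nat) : (0 < n)%N ->
  exists2 s : seq C, size s = n & forall w : C, w ^+ n - 1 = \prod_(u <- s) (w - u).
Proof.
move=> n0; have [s hs] := closed_field_poly_normal ('X^n - 1%:P : {poly C}).
rewrite lead_coefXnsubC // scale1r in hs.
exists s.
  have := size_XnsubC (1 : C) n0; rewrite hs size_prod_XsubC => -[].
  by [].
move=> w; have := congr1 (fun p : {poly C} => p.[w]) hs.
rewrite !hornerE => ->; rewrite horner_prod; apply: eq_bigr => u _.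
by rewrite hornerXsubC.
Qed.

(** Otherwise every factor of [w ^+ n - 1] has modulus at least [kap], and the product at least
    [kap ^+ n]. *)
Lemma near_root (n : nat) (kap : R) (s : seq C) (w : C) : 0 < kap ->
  (forall w : C, w ^+ n - 1 = \prod_(u <- s) (w - u)) -> size s = n ->
  nc (w ^+ n - 1) < kap ^+ n -> exists2 j : nat, (j < n)%N & nc (w - nth 0 s j) < kap.
Proof.
move=> k0 hs ss h; apply: contrapT => no.
have : kap ^+ size s <= nc (\prod_(u <- s) (w - u)).
  have : forall u, u \in s -> kap <= nc (w - u).
    move=> u us; rewrite leNgt; apply/negP => lt; apply: no.
    by exists (index u s); [rewrite -ss index_mem|rewrite nth_index].
  elim: (s) => [|u s' IH] hh; first by rewrite big_nil expr0 Normc.normc1.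
  rewrite big_cons ncM /= exprS; apply: ler_pM; [exact: ltW|by rewrite exprn_ge0 ?ltW|by rewrite hh // mem_head|].
  by apply: IH => v vs; apply: hh; rewrite inE vs orbT.
by rewrite ss -hs leNgt h.
Qed.

(** The derivative near 1 is close to [n.+1], so the power map multiplies distances by at least half
    of that; the weaker constant 1/2 does not depend on [n]. *)
Lemma power_near1 (n : nat) : exists2 kap : R, 0 < kap &
  forall v w : C, nc (v - 1) < kap -> nc (w - 1) < kap ->
  nc (v - w) / 2 <= nc (v ^+ n.+1 - w ^+ n.+1).
Proof.
have c1 : ccont (fun z : C => n.+1%:R * z ^+ n) 1.
  case: n => [|n]; last by apply: cder_cont; apply: cderZ; exact: cderX.
  by move=> e e0; exists 1 => // w _; rewrite !expr0 subrr nc0.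
have e0 : 0 < n.+1%:R / 2 :> R by rewrite divr_gt0.
have [k k0 hk] := c1 _ e0; exists k => // v w hv hw.
have nn : nc (n.+1%:R : C) = n.+1%:R.
  by rewrite -(rmorph_nat (real_complex R)) ncR ger0_norm.
have hyp z : nc (z - 1) < k -> cder (fun z : C => z ^+ n.+1) z (n.+1%:R * z ^+ n) /\
    nc (n.+1%:R * z ^+ n - n.+1%:R) <= n.+1%:R / 2.
  by move=> hz; split; [exact: cderX|have := hk z hz; rewrite expr1n mulr1 => /ltW].
have h := ball_mvt hyp hv hw.
have := ncB (v ^+ n.+1 - w ^+ n.+1 - n.+1%:R * (v - w)) (v ^+ n.+1 - w ^+ n.+1).
rewrite (_ : _ - _ - _ - _ = - (n.+1%:R * (v - w))); last by ring.
rewrite ncN ncM nn => h2.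
have h3 : n.+1%:R / 2 * nc (v - w) <= nc (v ^+ n.+1 - w ^+ n.+1) by lra.
apply: le_trans h3; rewrite mulrC ler_wpM2r ?nc_ge0 // mulrC ler_peMr ?invr_ge0 //.
by rewrite ler1n.
Qed.

(** The quotients of the preimages of [y] by one of them have powers close to 1, hence lie near
    roots of unity. Of [n.+2] quotients two lie near the same root, where the power map keeps them
    apart while the Lipschitz closeness of [G] to [c * z ^+ n.+1] forces them together. *)
Lemma root_count (n : nat) : exists2 eta : R, 0 < eta &
  forall (G : C -> C) (c : C) (d : R), c != 0 -> G 0 = 0 ->
  (forall (a b : C) (M : R), nc a <= M -> nc b <= M -> M < d ->
     nc (G a - G b - c * (a ^+ n.+1 - b ^+ n.+1)) <= eta * nc c * M ^+ n * nc (a - b)) ->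
  forall (y : C) (q : 'I_n.+2 -> C), y != 0 -> injective q ->
   (forall j, nc (q j) < d / 2 /\ G (q j) = y) -> False.
Proof.
have [kap k0 hk] := power_near1 n.
have [s ss hs] := @unity_factor n.+1 isT.
have kn : 0 < kap ^+ n.+1 by rewrite exprn_gt0.
have pn : 0 < (2 ^+ n)^-1 :> R by rewrite invr_gt0 exprn_gt0.
(* The bounds serve in turn: 1/3 gives [nc (w j) ^+ n.+1 <= 2], the second puts each quotient within
   [kap] of a root of unity, and the third leaves a factor 1/4 against the expansion constant 1/2
   when [hG] is used with [M = 2 * nc (q ord0)]. *)
pose eta := Num.min (1/3) (Num.min (kap ^+ n.+1 / 4) ((2 ^+ n)^-1 / 4)) : R.
have e0 : 0 < eta by rewrite !lt_min !divr_gt0.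
have e1 : eta <= 1/3 by rewrite ge_min lexx.
have e2 : eta <= kap ^+ n.+1 / 4 by rewrite !ge_min lexx !orbT.
have e3 : eta <= (2 ^+ n)^-1 / 4 by rewrite !ge_min lexx !orbT.
exists eta => // G c d c0 G0 hG y q y0 qi hq.
have nc0' : 0 < nc c by rewrite nc_gt0.
have q0 j : q j != 0 by apply/eqP => h; move: y0; rewrite -(proj2 (hq j)) h G0 eqxx.
have up j : nc (y - c * q j ^+ n.+1) <= eta * nc c * nc (q j) ^+ n.+1.
  have [h1 h2] := hq j.
  have := hG (q j) 0 (nc (q j)) (lexx _); rewrite nc0 nc_ge0 => /(_ isT).
  rewrite G0 expr0n /= !subr0 h2 -!mulrA -exprSr; apply.
  by apply: (lt_trans h1); have := nc_ge0 (q j); lra.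
have a0 : 0 < nc (q ord0) by rewrite nc_gt0.
have [w qw] : exists w, forall j, q j = w j * q ord0.
  by exists (fun j => q j / q ord0) => j; rewrite divfK.
have w1 j : nc (w j ^+ n.+1 - 1) <= eta * (nc (w j) ^+ n.+1 + 1).
  have h : nc (c * (q j ^+ n.+1 - q ord0 ^+ n.+1)) <= eta * nc c * (nc (q j) ^+ n.+1 + nc (q ord0) ^+ n.+1).
    have -> : c * (q j ^+ n.+1 - q ord0 ^+ n.+1) = (y - c * q ord0 ^+ n.+1) - (y - c * q j ^+ n.+1) by ring.
    by rewrite (le_trans (ncB _ _)) // [leRHS]mulrDr [leRHS]addrC lerD.
  move: h.
  have -> : q j ^+ n.+1 - q ord0 ^+ n.+1 = (w j ^+ n.+1 - 1) * q ord0 ^+ n.+1.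
    by rewrite (qw j) exprMn mulrBl mul1r.
  rewrite (qw j) !ncM ncX exprMn.
  rewrite (_ : eta * nc c * _ = nc c * (eta * (nc (w j) ^+ n.+1 + 1) * nc (q ord0) ^+ n.+1)); last by ring.
  by rewrite ler_pM2l // ler_pM2r // exprn_gt0.
have w2 j : nc (w j) ^+ n.+1 <= 2.
  have := ncD (w j ^+ n.+1 - 1) 1; rewrite subrK Normc.normc1 ncX => h.
  have := w1 j; set W := nc (w j) ^+ n.+1 in h *; move=> h'.
  have W0 : 0 <= W by rewrite exprn_ge0 ?nc_ge0.
  have : eta * (W + 1) <= 1/3 * (W + 1) by rewrite ler_wpM2r // addr_ge0.
  lra.
have w3 j : nc (w j) <= 2.
  rewrite leNgt; apply/negP => h; have := w2 j; rewrite leNgt => /negP; apply.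
  apply: (@lt_le_trans _ _ (nc (w j))) => //.
  by apply: ler_eXnr => //; lra.
have w4 j : nc (w j ^+ n.+1 - 1) < kap ^+ n.+1.
  apply: (le_lt_trans (w1 j)).
  have h : eta * (nc (w j) ^+ n.+1 + 1) <= eta * 3 by rewrite ler_pM2l //; have := w2 j; lra.
  apply: (le_lt_trans h); lra.
have ex j : exists t : 'I_n.+1, nc (w j - nth 0 s t) < kap.
  by have [t tn ht] := near_root k0 hs ss (w4 j); exists (Ordinal tn).
have [t ht] := choice ex.
have [j [j' [jj tt]]] : exists j j', j != j' /\ t j = t j'.
  apply: contrapT => no; have ti : injective t.
    move=> u v E; apply/eqP/negPn/negP => uv; apply: no; by exists u, v.
  by have := leq_card _ ti; rewrite !card_ord ltnn.
set om := nth 0 s (t j).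
have om1 : om ^+ n.+1 = 1.
  have oms : om \in s by rewrite mem_nth // ss ltn_ord.
  by apply/eqP; rewrite -subr_eq0 hs (big_rem om oms) /= subrr mul0r.
have nom : nc om = 1.
  apply/eqP; have := congr1 (@Normc.normc R) om1; rewrite ncX Normc.normc1 => /eqP.
  by rewrite pexprn_eq1 // nc_ge0.
have om0 : om != 0 by rewrite -nc_gt0 nom.
have vk u : nc (u - om) < kap -> nc (u / om - 1) < kap.
  move=> h; rewrite (_ : _ - 1 = (u - om) / om); last by field.
  by rewrite ncM ncV nom invr1 mulr1.
(* Division by [om], of modulus 1, moves both quotients near 1 without changing their powers or
   their distance. *)
have h1 := hk _ _ (vk _ (ht j)) (vk _ (_ : nc (w j' - om) < kap)).
have {}h1 := h1 ltac:(by rewrite /om tt; exact: ht).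
rewrite !exprMn !exprVn om1 invr1 !mulr1 -mulrBl ncM ncV nom invr1 mulr1 in h1.
have [hq1 hq2] := hq j; have [hq1' hq2'] := hq j'; have [hq0 _] := hq ord0.
have h2 := hG (q j) (q j') (2 * nc (q ord0)).
have {}h2 := h2 ltac:(by rewrite qw ncM ler_pM2r) ltac:(by rewrite qw ncM ler_pM2r) ltac:(lra).
rewrite hq2 hq2' subrr sub0r ncN in h2.
have E : q j ^+ n.+1 - q j' ^+ n.+1 = (w j ^+ n.+1 - w j' ^+ n.+1) * q ord0 ^+ n.+1.
  by rewrite (qw j) (qw j') !exprMn mulrBl.
have E2 : q j - q j' = (w j - w j') * q ord0 by rewrite (qw j) (qw j') mulrBl.
rewrite E E2 !ncM ncX exprMn [nc (q ord0) ^+ n.+1]exprS in h2.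
have h3 : nc (w j ^+ n.+1 - w j' ^+ n.+1) <= eta * 2 ^+ n * nc (w j - w j').
  have Z : 0 < nc c * (nc (q ord0) * nc (q ord0) ^+ n) by rewrite !mulr_gt0 // exprn_gt0.
  rewrite -(ler_pM2l Z); apply: le_trans (le_trans h2 _); first by rewrite le_eqVlt; apply/orP; left; apply/eqP; ring.
  by rewrite le_eqVlt; apply/orP; left; apply/eqP; ring.
have wjj : 0 < nc (w j - w j').
  rewrite nc_gt0 subr_eq0; apply: contra jj => /eqP h; apply/eqP/qi.
  by rewrite (qw j) (qw j') h.
have h4 : eta * 2 ^+ n <= 1 / 4.
  rewrite -ler_pdivlMr ?exprn_gt0 //; apply: (le_trans e3).
  by rewrite mul1r mulrC.
have : nc (w j - w j') / 2 <= 1 / 4 * nc (w j - w j').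
  by apply: (le_trans h1); apply: (le_trans h3); rewrite ler_pM2r.
lra.
Qed.

End RootCount.

Section Cone.
Variables (R : realType) (T : translationSurface R).
Local Notation C := R[i].
Local Notation f := (form_coef (omega T)).
Local Notation ch i := (chart_map (atlas i)).
Local Notation chi i := (chart_inv (atlas i)).
Local Notation dom i := (chart_dom (atlas i)).
Local Notation img i := (chart_img (atlas i)).
Local Notation sing := (singularities T).

(* A neighbourhood [U] of the zero [p] with the primitive [F] of [omega] vanishing
   at [p]; [F] looks like the branched cover [z ^ (k + 1)]. *)
Record conebox (p : T) (U : set T) (F : T -> C) (m : R) : Prop := ConeBox {
  cb_m : 0 < m;
  cb_open : open U;
  cb_p : U p;
  cb_Fp : F p = 0;
  cb_F0 : forall x, U x -> F x = 0 -> x = p;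
  cb_sing : forall x, U x -> sing x -> x = p;
  cb_lift : forall phi z, imm_at phi z -> U (phi z) -> cder (fun w => F (phi w)) z 1;
  cb_closed : closed [set x | U x /\ nc (F x) <= m];
  cb_cont : forall x, U x -> {for x, continuous F};
  cb_small : forall O, open O -> O p -> exists2 m' : R, 0 < m' & forall x, U x -> nc (F x) < m' -> O x }.

(** With [f = (z - z0) ^+ k * h] in the chart, a primitive of [f] differs from
    [c * (z - z0) ^+ k.+1] by a function with derivative [(z - z0) ^+ k * (h z - h z0)], which is
    relatively small. This closeness feeds [root_count] and bounds the modulus of the primitive from
    below, which isolates [p] and controls the sublevel sets. *)
Lemma conebox_ex (p : T) (k : nat) : sing p -> form_order p k ->
  exists U F m, conebox p U F m /\
    forall (y : C) (q : 'I_k.+2 -> T), y != 0 -> injective q ->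
      ~ (forall j, U (q j) /\ F (q j) = y).
Proof.
move=> sp [i [dp [V [h [oV Vz hV hz0 fV]]]]].
set z0 := ch i p in Vz hz0 fV.
have [eta eta0 count] := root_count R k.
have [r1 r10 hr1] := img_ball (ch_img dp).
have [r2 r20 hr2] := (proj1 (openCP V)) oV z0 Vz.
pose r := Num.min r1 r2; have r0 : 0 < r by rewrite lt_min r10.
have hr w : nc (w - z0) < r -> img i w /\ V w by rewrite lt_min => /andP[/hr1 ? /hr2 ?].
have [F0 F00 dF0] := primitive r0 (fun z hz => f_cder (proj1 (hr z hz))).
(* The first bound is the one of [root_count]; the second keeps the modulus of the primitive above
   [nc c / 2] times the power of the distance, and [h] away from zero. *)
pose eps := Num.min eta (1 / (2 * k.+1%:R)).
have k1 : 0 < k.+1%:R :> R by [].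
have ep : 0 < eps by rewrite lt_min eta0 divr_gt0 // mulr_gt0.
pose c := h z0 / k.+1%:R.
have c0 : c != 0 by rewrite mulf_neq0 // invr_eq0 pnatr_eq0.
have nc0' : 0 < nc c by rewrite nc_gt0.
have hcont : ccont h z0 by apply: cder_cont; apply: derivable_cder; exact: hV.
have [r3 r30 hr3] := hcont (eps * nc c) ltac:(by rewrite mulr_gt0).
pose d := Num.min (r / 4) r3; have d0 : 0 < d by rewrite lt_min divr_gt0.
have hd w : nc (w - z0) < d -> nc (w - z0) < r / 4 /\ nc (w - z0) < r3.
  by rewrite lt_min => /andP.
have r4r w : nc (w - z0) < r / 4 -> nc (w - z0) < r by lra.
have K1 (a b : C) (M : R) : nc a <= M -> nc b <= M -> M < d ->
   nc (F0 (z0 + a) - F0 (z0 + b) - c * (a ^+ k.+1 - b ^+ k.+1)) <= eps * nc c * M ^+ k * nc (a - b).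
  move=> ha hb Md.
  pose E (u : C) := F0 (z0 + u) - c * u ^+ k.+1.
  have -> : F0 (z0 + a) - F0 (z0 + b) - c * (a ^+ k.+1 - b ^+ k.+1) = E a - E b.
    by rewrite /E; ring.
  apply: (@seg_mvt R E (fun u => u ^+ k * (h (z0 + u) - h z0))) => t t0 t1.
  set u := seg b a t.
  have uM : nc u <= M.
    have -> : u = (1 - t)%:C * b + t%:C * a by rewrite /u /seg rmorphB rmorph1 /=; ring.
    rewrite (le_trans (ncD _ _)) // !nc_scale !ger0_norm ?subr_ge0 //.
    have -> : M = (1 - t) * M + t * M by ring.
    by rewrite lerD // ler_wpM2l // subr_ge0.
  have uz : z0 + u - z0 = u by ring.
  have [u1 u2] := hd (z0 + u) ltac:(by rewrite uz; exact: le_lt_trans Md).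
  have [_ Vu] := hr _ (r4r _ u1).
  split.
    have -> : u ^+ k * (h (z0 + u) - h z0) = 1 * f i (u + z0) - c * (k.+1%:R * u ^+ k).
      have ck : c * k.+1%:R = h z0 by rewrite /c divfK // pnatr_eq0.
      by rewrite mul1r [u + z0]addrC fV // uz -ck; ring.
    apply: cderB; last by apply: cderZ; exact: cderX.
    have dF : cder F0 (u + z0) (f i (u + z0)) by rewrite addrC; exact: dF0.
    have := cder_comp (cder_translate z0 u) dF; rewrite mulrC.
    by apply: (cder_ext ltr01) => w _; rewrite addrC.
  rewrite ncM ncX mulrC ler_pM ?nc_ge0 ?exprn_ge0 ?nc_ge0 //.
    by apply/ltW/hr3.
  by apply: lerXn2r; rewrite ?nnegrE ?nc_ge0 // (le_trans _ ha) // nc_ge0.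
have low (a : C) : nc a < d -> nc c / 2 * nc a ^+ k.+1 <= nc (F0 (z0 + a)).
  move=> ad; have := K1 a 0 (nc a) (lexx _); rewrite nc0 nc_ge0 => /(_ isT ad).
  rewrite addr0 F00 expr0n /= !subr0 -!mulrA -exprSr mulrA => h1.
  have h2 : eps * nc c * nc a ^+ k.+1 <= nc c / 2 * nc a ^+ k.+1.
    rewrite ler_wpM2r ?exprn_ge0 ?nc_ge0 // mulrC ler_pM2l //.
    apply: (@le_trans _ _ (1 / (2 * k.+1%:R))); first by rewrite ge_min lexx orbT.
    by rewrite mul1r lef_pV2 ?posrE ?mulr_gt0 // ler_peMr // ler1n.
  have := ncB (F0 (z0 + a) - c * a ^+ k.+1) (F0 (z0 + a)).
  rewrite (_ : _ - _ - _ = - (c * a ^+ k.+1)); last by ring.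
  rewrite ncN ncM ncX; lra.
pose U : set T := dom i `&` [set x | nc (ch i x - z0) < d / 2].
pose F (x : T) := F0 (ch i x).
have Ud x : U x -> nc (ch i x - z0) < d by case=> _ /= ?; lra.
have chz x : z0 + (ch i x - z0) = ch i x by ring.
(* By [lowU] the condition [nc (F x) <= m] forces a distance at most [d / 4] from [z0], well inside
   the radius [d / 2] of [U]: the sublevel set is therefore compact, hence closed in the whole
   surface although [U] is only open. *)
pose m := nc c / 2 * (d / 4) ^+ k.+1.
have m0 : 0 < m by rewrite mulr_gt0 ?divr_gt0 ?exprn_gt0 ?divr_gt0.
have lowU x : U x -> nc c / 2 * nc (ch i x - z0) ^+ k.+1 <= nc (F x).
  by move=> /Ud xd; have := low _ xd; rewrite chz.
have sm (x : T) (s : R) : U x -> 0 <= s -> nc (F x) <= nc c / 2 * s ^+ k.+1 -> nc (ch i x - z0) <= s.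
  move=> Ux s0 hx; have := le_trans (lowU x Ux) hx.
  by rewrite ler_pM2l ?divr_gt0 // ler_pXn2r // nnegrE // nc_ge0.
have U0 x : U x -> F x = 0 -> x = p.
  move=> Ux Fx; have := sm x 0 Ux (lexx _); rewrite expr0n /= mulr0 Fx nc0 => /(_ (lexx _)) h0.
  have : ch i x - z0 == 0 by rewrite -nc_eq0 eq_le h0 nc_ge0.
  by rewrite subr_eq0 => /eqP E; rewrite -(chK (proj1 Ux)) E chK.
have contF x : U x -> {for x, continuous F}.
  move=> Ux; have [u1 u2] := hd _ (Ud x Ux).
  apply: continuous_comp; first exact: (ch_cont (proj1 Ux)).
  by apply/ccontP; apply: cder_cont; exact: dF0.
exists U, F, m; split; last first.
  move=> y q y0 qi hq.
  apply: (count (fun u => F0 (z0 + u)) c d c0 _ _ y (fun j => ch i (q j) - z0)) => //.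
  - by rewrite addr0.
  - move=> a b M ha hb Md; apply: (le_trans (K1 a b M ha hb Md)).
    have M0 : 0 <= M by rewrite (le_trans _ ha) // nc_ge0.
    rewrite -!mulrA ler_wpM2r ?mulr_ge0 ?exprn_ge0 ?nc_ge0 // ge_min lexx.
    by [].
  - move=> j j' /addIr E; apply: qi.
    by have [[d1 _] _] := hq j; have [[d2 _] _] := hq j'; rewrite -(chK d1) E chK.
  - by move=> j; have [[d1 d2] d3] := hq j; rewrite chz.
split => //.
- rewrite openE => x [dx hx]; apply: filterI; first exact: dom_open.
  have nV : nbhs (ch i x) [set w | nc (w - z0) < d / 2].
    apply/nbhs_ncP; exists (d / 2 - nc (ch i x - z0)); first by rewrite subr_gt0.
    by move=> w hw /=; have := nc_tri (ch i x) w z0; lra.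
  exact: (ch_cont dx nV).
- by split => //=; rewrite subrr nc0 divr_gt0.
- move=> x Ux; have [dx _] := Ux; move=> /(sing_chart dx).
  have [u1 u2] := hd _ (Ud x Ux); have [_ Vx] := hr _ (r4r _ u1).
  rewrite fV // => /eqP; rewrite mulf_eq0 => /orP[|hx].
    rewrite expf_eq0 => /andP[_]; rewrite subr_eq0 => /eqP E.
    by rewrite -(chK dx) E chK.
  exfalso; have := hr3 _ u2; rewrite (eqP hx) sub0r ncN.
  have : nc (h z0) = k.+1%:R * nc c.
    rewrite /c ncM ncV -(rmorph_nat (real_complex R)) ncR ger0_norm //.
    by rewrite mulrCA mulfV ?mulr1 // pnatr_eq0.
  move=> ->; rewrite ltr_pM2r // ltNge => /negP; apply.
  apply: (@le_trans _ _ (1 / (2 * k.+1%:R))); first by rewrite ge_min lexx orbT.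
  rewrite ler_pdivrMr ?mulr_gt0 //.
  have : 1 <= k.+1%:R :> R by rewrite ler1n.
  by nra.
- move=> phi z im Uz; have [u1 u2] := hd _ (Ud _ Uz).
  have [_ ns h3] := im; have [dz _] := Uz.
  have ns' : ~ sing (phi z) by case: im.
  have fn0 : f i (ch i (phi z)) != 0 by apply/eqP => /(sing_chart dz).
  by have := cder_comp (h3 i dz) (dF0 _ u1); rewrite mulfV.
- pose K := [set w : C | nc (w - z0) <= d / 4] `&` [set w | nc (F0 w) <= m].
  have dd4 (w : C) : nc (w - z0) <= d / 4 -> nc (w - z0) < d by lra.
  have cK : compact K.
    have : compact [set w : C | nc (w - z0) <= d / 4] by exact: compact_disc.
    have K' : closed (~` ([set w : C | nc (w - z0) < d] `&` [set w | m < nc (F0 w)])).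
      rewrite closedC; apply/openCP => w [wd wm].
      have [u1 u2] := hd _ wd.
      have wm' : 0 < nc (F0 w) - m by rewrite subr_gt0.
      have [t t0 ht] := cder_cont (dF0 _ u1) wm'.
      exists (Num.min t (d - nc (w - z0))) => [|v]; first by rewrite lt_min t0 subr_gt0.
      rewrite lt_min => /andP[/ht vt vd]; split => /=.
        by have := nc_tri w v z0; lra.
      have := nc_dist (F0 v) (F0 w); move: vt.
      by rewrite ler_distl => ? /andP[]; lra.
    move=> /compact_closedI /(_ K'); congr compact.
    apply/seteqP; split => [w [w1 w2]|w [w1 w2]]; split => //.
      by rewrite /= leNgt; apply/negP => ?; apply: w2; split => //=; exact: dd4.
    by move=> [_ /=]; rewrite ltNge; move/negP; apply.
  have -> : [set x | U x /\ nc (F x) <= m] = chi i @` K.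
    apply/seteqP; split => [x [Ux Fx]|_ [w [w1 w2] <-]].
      exists (ch i x); last by rewrite chK //; case: Ux.
      split => //=; apply: sm => //; by rewrite divr_ge0 // ltW.
    have [u1 u2] := hd _ (dd4 _ w1); have [iw _] := hr _ (r4r _ u1).
    split; last by rewrite /F chiK.
    by split; [exact: chi_dom|rewrite /= chiK //; move: w1 => /=; lra].
  apply: compact_closed; first exact: T_hausdorff.
  apply: continuous_compact => //.
  apply: continuous_in_subspaceT => w; rewrite inE => -[w1 w2].
  by have [u1 u2] := hd _ (dd4 _ w1); have [iw _] := hr _ (r4r _ u1); exact: chi_cont.
- move=> O oO Op.
  have nO : nbhs (chi i z0) O by rewrite /z0 chK //; apply: open_nbhs_nbhs.
  have := chi_cont (ch_img dp) nO => /nbhs_ncP[s s0 hs].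
  exists (nc c / 2 * (s / 2) ^+ k.+1); first by rewrite mulr_gt0 ?divr_gt0 ?exprn_gt0 ?divr_gt0.
  move=> x Ux Fx; have [dx _] := Ux; rewrite -(chK dx); apply: hs.
  apply: (@le_lt_trans _ _ (s / 2)); last by lra.
  by apply: sm => //; [rewrite divr_ge0 // ltW|exact: ltW].
Qed.

End Cone.

(** * Developing the surface around a regular point *)

Section Exponential.
Variables (R : realType) (T : translationSurface R).
Local Notation C := R[i].
Local Notation sing := (singularities T).
Implicit Types (x y p : T) (phi psi : C -> T) (z w a h v : C).

Definition cball z (r : R) : set C := [set w | nc (w - z) < r].

Lemma cball_oset z r : oset (cball z r). Proof. exact: oset_ball. Qed.
Lemma cball_cvx z r : cvx (cball z r). Proof. exact: cvx_ball. Qed.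

(** The domain of the exponential map at [x]. Developments over convex sets that agree at 0 agree on
    the intersection of their domains, again convex; so [expmap] is well defined without choosing
    paths or passing to a covering. *)
Definition expdom x : set C := [set v | exists U phi,
  [/\ oset U, cvx U, U 0, U v & imm U phi /\ phi 0 = x]].

Definition expmap x v : T := xget x [set y | exists U phi,
  [/\ oset U, cvx U, U 0, U v & [/\ imm U phi, phi 0 = x & phi v = y]]].

Lemma expmapE x (U : set C) phi v : oset U -> cvx U -> U 0 -> imm U phi -> phi 0 = x ->
  U v -> expmap x v = phi v.
Proof.
move=> oU cU U0 iU p0 Uv; rewrite /expmap.
case: xgetP => [y _ [V [psi [oV cV V0 Vv [iV q0 <-]]]]|/(_ (phi v))]; last first.
  by case; exists U, phi.
apply: (imm_uniq (osetI oV oU) (cvxI cV cU) (z := 0)) => //; last by rewrite p0.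
- by move=> z [Vz _]; exact: iV.
- by move=> z [_ Uz]; exact: iU.
Qed.

Lemma exp_oset x : oset (expdom x).
Proof.
move=> v [U [phi [oU cU U0 Uv h]]]; have [r r0 hr] := oU v Uv.
by exists r => // w hw; exists U, phi; split => //; exact: hr.
Qed.

Lemma exp_imm x : imm (expdom x) (expmap x).
Proof.
move=> v [U [phi [oU cU U0 Uv [iU p0]]]]; have [r r0 hr] := oU v Uv.
apply: (imm_at_ext r0 _ (iU v Uv)) => w hw.
by rewrite (expmapE oU cU U0 iU p0) //; exact: hr.
Qed.

Lemma exp0 x : ~ sing x -> expdom x 0 /\ expmap x 0 = x.
Proof.
move=> ns; have [eps e0 [ O [oO Ox] hO]] := reg_radius ns.
have [psi ipsi psi0] := hO x Ox.
have i' : imm (cball 0 eps) psi by move=> z hz; apply: ipsi; move: hz; rewrite /cball /= subr0.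
have c0 : cball 0 eps 0 by rewrite /cball /= subrr nc0.
split; first by exists (cball 0 eps), psi; split => //; [exact: cball_oset|exact: cball_cvx].
by rewrite (expmapE (@cball_oset 0 eps) (@cball_cvx 0 eps) c0 i' psi0).
Qed.

Lemma exp_recenter x y v (r : R) : y = expmap x v -> 0 < r -> (forall z, cball v r z -> expdom x z) ->
  forall w, cball 0 r w -> expdom y w /\ expmap y w = expmap x (w + v).
Proof.
move=> -> r0 sub w hw.
have i' : imm (cball 0 r) (fun w => expmap x (w + v)).
  move=> z hz; apply: imm_at_shift; apply: exp_imm; apply: sub.
  by move: hz; rewrite /cball /= subr0 addrK.
have c0 : cball 0 r 0 by rewrite /cball /= subrr nc0.
have e0 : expmap x (0 + v) = expmap x v by rewrite add0r.
split; last by rewrite (expmapE (@cball_oset 0 r) (@cball_cvx 0 r) c0 i' e0 hw).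
by exists (cball 0 r), (fun w => expmap x (w + v)); split => //; [exact: cball_oset|exact: cball_cvx].
Qed.

(** Compactness of the surface, applied to the filter of images of the points of the disc that tend
    to [h]. *)
Lemma boundary_cluster phi v (r : R) h : nc (h - v) = r -> 0 < r ->
  exists y, forall O, open O -> O y -> forall eta : R, 0 < eta ->
   exists z, [/\ cball v r z, nc (z - h) < eta & O (phi z)].
Proof.
move=> hv r0.
have near eta : 0 < eta -> exists2 z, cball v r z & nc (z - h) < eta.
  move=> e0; have [t [t0 t1 td]] := left_approx (@ltr01 R) (ltac:(by rewrite divr_gt0 // ltr_wpDl // ltW) : 0 < eta / (r + 1)).
  exists (seg v h t).
    rewrite /cball /= -{2}(seg0 v h) nc_segB subr0 hv ger0_norm // -[X in _ < X]mul1r ltr_pM2r //.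
  rewrite -{2}(seg1 v h) nc_segB hv.
  rewrite ltr_pdivlMr ?ltr_wpDl ?ltW // in td; move: td => k.
  by rewrite (le_lt_trans _ k) // ler_wpM2l //; lra.
pose Fil : set_system T := fun A => exists2 eta : R, 0 < eta & forall z, cball v r z -> nc (z - h) < eta -> A (phi z).
have PF : ProperFilter Fil.
  split.
    by move=> [eta e0 he]; have [z z1 z2] := near eta e0; exact: he z z1 z2.
  split.
  - by exists 1.
  - move=> A B [e1 e10 h1] [e2 e20 h2]; exists (Num.min e1 e2) => [|z z1]; first by rewrite lt_min e10.
    by rewrite lt_min => /andP[? ?]; split; [exact: h1|exact: h2].
  - by move=> A B AB [e e0 he]; exists e => // z z1 z2; apply/AB/he.
have [y [_ hy]] := @surface_compact R T Fil PF (ex_intro2 _ _ 1 ltr01 (fun _ _ _ => I)).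
exists y => O oO Oy eta e0.
have FO : Fil [set u | exists z, [/\ cball v r z, nc (z - h) < eta & u = phi z]].
  by exists eta => // z z1 z2; exists z.
by have [u [[z [z1 z2 ->]] Oz]] := hy _ _ FO (open_nbhs_nbhs (conj oO Oy)); exists z.
Qed.

(** A convex open neighbourhood of the segment from 0 to [h], of the kind needed to witness that [h]
    is in [expdom]. *)
Definition stadium h (d : R) : set C := [set w | exists t : R, [/\ 0 <= t, t <= 1 & nc (w - t%:C * h) < d]].

Lemma stadium_oset h d : oset (stadium h d).
Proof.
move=> w [t [t0 t1 ht]]; exists (d - nc (w - t%:C * h)) => [|u hu]; first by rewrite subr_gt0.
by exists t; split => //; have := nc_tri w u (t%:C * h); lra.
Qed.

Lemma stadium_cvx h d : cvx (stadium h d).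
Proof.
move=> w z s [t [t0 t1 ht]] [t' [t'0 t'1 ht']] s0 s1.
exists ((1 - s) * t + s * t'); split.
- by rewrite addr_ge0 // mulr_ge0 // subr_ge0.
- have h1 : (1 - s) * t <= (1 - s) * 1 by rewrite ler_wpM2l // subr_ge0.
  have h2 : s * t' <= s * 1 by rewrite ler_wpM2l.
  lra.
- have := @seg_ball R 0 (w - t%:C * h) (z - t'%:C * h) d s s0 s1; rewrite !subr0 => /(_ ht ht').
  rewrite (_ : seg _ _ _ = seg w z s - ((1 - s) * t + s * t')%:C * h) //.
  by rewrite /seg rmorphD !rmorphM rmorphB rmorph1 /=; ring.
Qed.

(** The point [t h] is at distance at least [(1 - t) * (r - nc v)] from the circle, so a thin
    stadium leaves the disc only near its end [h]. *)
Lemma stadium_sub v h (r eps : R) : nc v < r -> nc (h - v) = r -> 0 < eps ->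
  exists2 d : R, 0 < d & forall w, stadium h d w -> cball v r w \/ nc (w - h) < eps.
Proof.
move=> vr hr e0.
pose g := r - nc v; have g0 : 0 < g by rewrite subr_gt0.
pose K := nc h / g + 1; have K0 : 0 < K by rewrite ltr_wpDl // divr_ge0 ?nc_ge0 ?ltW.
exists (eps / K); first by rewrite divr_gt0.
move=> w [t [t0 t1 ht]].
have [hc|hc] := leP (eps / K) ((1 - t) * g).
  left; rewrite /cball /=.
  have -> : w - v = (w - t%:C * h) + (t%:C * (h - v) + (1 - t)%:C * (- v)).
    by rewrite rmorphB rmorph1 /=; ring.
  have k1 := ncD (w - t%:C * h) (t%:C * (h - v) + (1 - t)%:C * (- v)).
  have k2 := ncD (t%:C * (h - v)) ((1 - t)%:C * (- v)).
  rewrite !nc_scale ncN hr !ger0_norm ?subr_ge0 // in k2.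
  have E : t * r + (1 - t) * nc v = r - (1 - t) * g by rewrite /g; ring.
  lra.
right.
have -> : w - h = (w - t%:C * h) - (1 - t)%:C * h by rewrite rmorphB rmorph1 /=; ring.
apply: (le_lt_trans (ncB _ _)); rewrite nc_scale ger0_norm ?subr_ge0 //.
have k : (1 - t) * nc h <= eps / K * (nc h / g).
  rewrite [leRHS]mulrA ler_pdivlMr // mulrAC ler_wpM2r ?nc_ge0 //; exact: ltW.
have : eps / K * K = eps by rewrite divfK // gt_eqF.
rewrite {2}/K; lra.
Qed.

(** Were [y] regular, a disc of uniform radius would be immersed around the image of a point [z]
    close to [h]; glued to the given disc, it would extend the development over a stadium reaching
    [h]. *)
Lemma cluster_sing x v (r : R) h y : (forall z, cball v r z -> expdom x z) ->
  ~ sing x -> nc v < r -> nc (h - v) = r -> ~ expdom x h ->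
  (forall O, open O -> O y -> forall eta : R, 0 < eta ->
     exists z, [/\ cball v r z, nc (z - h) < eta & O (expmap x z)]) -> sing y.
Proof.
move=> sub nsx vr hr nh hy; apply: contrapT => ns; apply: nh.
have [eps e0 [ O [oO Oy] hO]] := reg_radius ns.
have [z [Dz zh Oz]] := hy O oO Oy (eps / 2) ltac:(by rewrite divr_gt0).
have [psi ipsi psi0] := hO _ Oz.
pose psi' w := psi (w - z).
have ipsi' : imm (cball z eps) psi'.
  by move=> w hw; apply: (@imm_at_shift R T psi (- z)); apply: ipsi.
have iphi : imm (cball v r) (expmap x) by move=> w hw; apply/exp_imm/sub.
have agree w : cball v r w -> cball z eps w -> expmap x w = psi' w.
  move=> h1 h2.
  apply: (imm_uniq (osetI (@cball_oset v r) (@cball_oset z eps)) (cvxI (@cball_cvx v r) (@cball_cvx z eps)) (z := z)) => //.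
  - by move=> u [hu _]; exact: iphi.
  - by move=> u [_ hu]; exact: ipsi'.
  - by split => //; rewrite /cball /= subrr nc0.
  - by rewrite /psi' subrr psi0.
pose chi w := if pselect (cball v r w) then expmap x w else psi' w.
have c1 w : cball v r w -> chi w = expmap x w by move=> hw; rewrite /chi; case: pselect.
have c2 w : cball z eps w -> chi w = psi' w.
  by move=> hw; rewrite /chi; case: pselect => // hw'; exact: agree.
have [d d0 hd] := stadium_sub vr hr (ltac:(by rewrite divr_gt0) : 0 < eps / 2).
exists (stadium h d), chi; split; [exact: stadium_oset|exact: stadium_cvx| | |].
- by exists 0; rewrite mul0r subrr nc0; split.
- by exists 1; rewrite mul1r subrr nc0; split.
have D0 : cball v r 0 by rewrite /cball /= sub0r ncN.
split; last by rewrite c1 //; case: (exp0 nsx).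
move=> w /hd[hw|hw].
  have [s s0 hs] := @cball_oset v r w hw.
  by apply: (imm_at_ext s0 _ (iphi w hw)) => u /hs /c1.
have hw' : cball z eps w by rewrite /cball /=; have := nc_tri h w z; rewrite (ncC h); lra.
have [s s0 hs] := @cball_oset z eps w hw'.
by apply: (imm_at_ext s0 _ (ipsi' w hw')) => u /hs /c2.
Qed.

(** * Zeros reached on the boundary of an immersed disc *)

Section Hits.
Variables (cU : T -> set T) (cF : T -> T -> C) (cm : T -> R).
Hypothesis cones : forall p, sing p -> conebox p (cU p) (cF p) (cm p).

Lemma lift_const (p : T) (W : set C) phi w : sing p -> oset W -> imm W phi -> W w -> cU p (phi w) ->
  exists2 r : R, 0 < r & forall u, nc (u - w) < r -> [/\ W u, cU p (phi u) &
     cF p (phi u) - u = cF p (phi w) - w].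
Proof.
move=> sp oW iW Ww Uw; have cb := cones sp.
have [r r0 hr] := oW w Ww.
have [_ c _] := iW w Ww.
have [s s0 hs] := (proj1 (ccontX phi w)) c _ (cb_open cb) Uw.
exists (Num.min r s) => [|u]; first by rewrite lt_min r0.
move=> hu; have H u' : nc (u' - w) < Num.min r s -> W u' /\ cU p (phi u').
  by rewrite lt_min => /andP[/hr ? /hs ?].
have [Wu Uu] := H u hu; split => //.
have ww : nc (w - w) < Num.min r s by rewrite subrr nc0 lt_min r0.
apply: (@ball_const R (fun u => cF p (phi u) - u) w (Num.min r s)) => // u' /H[Wu' Uu'].
by rewrite -(subrr 1); apply: cderB; [exact: (cb_lift cb (iW _ Wu') Uu')|exact: cder_id].
Qed.

(** The difference between [cF p] and the plane coordinate is constant along the segment, so within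
    distance [cm p] of [a] the image stays in the sublevel set of the cone; that set being closed in
    the surface, the segment cannot leave [cU p]. *)
Lemma confine (p : T) (W : set C) phi z z' a : sing p -> oset W -> cvx W -> imm W phi ->
  W z -> W z' -> cU p (phi z) -> cF p (phi z) = z - a -> nc (z - a) < cm p -> nc (z' - a) < cm p ->
  cU p (phi z') /\ cF p (phi z') = z' - a.
Proof.
move=> sp oW cW iW Wz Wz' Uz Fz za z'a; have cb := cones sp.
pose P t := cU p (phi (seg z z' t)) /\ cF p (phi (seg z z' t)) = seg z z' t - a.
suff H : forall t : R, 0 <= t -> t <= 1 -> P t by have := H 1 ler01 (lexx _); rewrite /P seg1.
have Ws t : 0 <= t -> t <= 1 -> W (seg z z' t) by move=> *; exact: cW.
apply: real_ind => //; first by rewrite /P seg0.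
- move=> t t0 t1 h; have [Ut Ft] := h t t0 (lexx _).
  have [r r0 hr] := lift_const sp oW iW (Ws t t0 (ltW t1)) Ut.
  exists (r / (nc (z' - z) + 1)); first by rewrite divr_gt0 // ltr_wpDl ?nc_ge0.
  move=> s ts sd _.
  have [] := hr (seg z z' s).
    rewrite nc_segB gtr0_norm ?subr_gt0 //.
    have : s - t < r / (nc (z' - z) + 1) by lra.
    rewrite ltr_pdivlMr ?ltr_wpDl ?nc_ge0 // => hs.
    by rewrite (le_lt_trans _ hs) // ler_wpM2l ?subr_ge0 ?(ltW ts) // lerDl.
  move=> _ Us Fs; split => //; move: Fs; rewrite Ft => /eqP; rewrite subr_eq => /eqP ->.
  by ring.
- move=> t t0 t1 h; have Wt := Ws t (ltW t0) t1.
  have Ut : cU p (phi (seg z z' t)).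
    apply: contrapT => nU.
    have oK : open (~` [set x | cU p x /\ nc (cF p x) <= cm p]).
      by rewrite openC; exact: cb_closed cb.
    have nK : (~` [set x | cU p x /\ nc (cF p x) <= cm p]) (phi (seg z z' t)) by move=> [].
    have [d d0 hd] := imm_along iW Wt oK nK.
    have [s [s0 st sd]] := left_approx t0 d0.
    have [Us Fs] := h s s0 st; apply: (hd s sd); split => //; rewrite Fs ltW //.
    by apply: seg_ball => //; rewrite (ltW (lt_le_trans st t1)).
  split => //.
  have [r r0 hr] := lift_const sp oW iW Wt Ut.
  have [s [s0 st sd]] := left_approx t0 (ltac:(by rewrite divr_gt0 // ltr_wpDl ?nc_ge0) : 0 < r / (nc (z' - z) + 1)).
  have [] := hr (seg z z' s).
    rewrite nc_segB; rewrite ltr_pdivlMr ?ltr_wpDl ?nc_ge0 // in sd.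
    by rewrite (le_lt_trans _ sd) // ler_wpM2l // lerDl.
  move=> _ Us; have [_ ->] := h s s0 st => E.
  have {E} : - a = cF p (phi (seg z z' t)) - seg z z' t by rewrite -E; ring.
  by move/eqP; rewrite eq_sym subr_eq => /eqP ->; ring.
Qed.

(* The point [h], on the boundary of [D], is where the immersion [phi] of [D]
   reaches the zero [p]. *)
Definition hit phi (D : set C) h p := sing p /\ exists2 eta : R, 0 < eta &
  forall z, D z -> nc (z - h) < eta -> cU p (phi z) /\ cF p (phi z) = z - h.

Lemma hit_lim phi D h p : hit phi D h p -> forall O, open O -> O p ->
  exists2 eta : R, 0 < eta & forall z, D z -> nc (z - h) < eta -> O (phi z).
Proof.
move=> [sp [eta e0 he]] O oO Op; have [m' m'0 hm] := cb_small (cones sp) oO Op.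
exists (Num.min eta m') => [|z Dz]; first by rewrite lt_min e0.
rewrite lt_min => /andP[z1 z2]; have [Uz Fz] := he z Dz z1.
by apply: hm => //; rewrite Fz.
Qed.

(** The cluster point at [h] is a zero [p]. Its developed position, read off as [z - cF p], is the
    same from all points of the disc near [h] by [confine], and points tending to [h] identify it
    with [h]. *)
Lemma hit_ex x v (r : R) h : (forall z, cball v r z -> expdom x z) ->
  ~ sing x -> nc v < r -> nc (h - v) = r -> ~ expdom x h ->
  exists p, hit (expmap x) (cball v r) h p.
Proof.
move=> sub nsx vr hr nh.
have r0 : 0 < r by rewrite (le_lt_trans (nc_ge0 v)).
have [p hp] := boundary_cluster (expmap x) hr r0.
have sp := cluster_sing sub nsx vr hr nh hp; have cb := cones sp.
exists p; split => //.
have iphi : imm (cball v r) (expmap x) by move=> w hw; apply/exp_imm/sub.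
have m0 := cb_m cb.
have close (e : R) : 0 < e -> exists O, [/\ open O, O p & forall y, O y -> cU p y /\ nc (cF p y) < e].
  move=> e0.
  have n1 : nbhs p (cU p `&` [set y | nc (cF p y) < e]).
    apply: filterI; first by apply: open_nbhs_nbhs; split; [exact: cb_open cb|exact: cb_p cb].
    have nV : nbhs (cF p p) [set u | nc u < e].
      by apply/nbhs_ncP; exists e => // w; rewrite (cb_Fp cb) subr0.
    exact: (cb_cont cb (cb_p cb) nV).
  by move: n1; rewrite nbhsE; case=> O [oO Op] sO; exists O; split.
have m4 : 0 < cm p / 4 by rewrite divr_gt0.
have [ O [oO Op hO]] := close _ m4.
have [z [Dz zh Oz]] := hp O oO Op _ m4; have [Uz Fz] := hO _ Oz.
pose a := z - cF p (expmap x z).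
have za : cF p (expmap x z) = z - a by rewrite /a; ring.
have ah : nc (a - h) < cm p / 2.
  rewrite (_ : a - h = (z - h) - cF p (expmap x z)); last by rewrite /a; ring.
  by have := ncB (z - h) (cF p (expmap x z)); lra.
have key z' : cball v r z' -> nc (z' - h) < cm p / 2 -> cU p (expmap x z') /\ cF p (expmap x z') = z' - a.
  move=> Dz' z'h; apply: (confine sp (@cball_oset v r) (@cball_cvx v r) iphi Dz Dz' Uz za).
    by rewrite -za; lra.
  by have := nc_tri h z' a; rewrite (ncC h); lra.
have aE : a = h.
  apply/eqP; rewrite -subr_eq0 -nc_eq0 eq_le nc_ge0 andbT; apply/ler_addgt0Pl => e e0; rewrite addr0.
  pose e' := Num.min (e / 2) (cm p / 2).
  have e'0 : 0 < e' by rewrite lt_min !divr_gt0.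
  have [ O' [oO' Op' hO']] := close _ e'0.
  have [z' [Dz' z'h Oz']] := hp O' oO' Op' _ e'0; have [_ Fz'] := hO' _ Oz'.
  move: z'h Fz'; rewrite !lt_min => /andP[k1 k2] /andP[k3 k4].
  have [_ E] := key z' Dz' k2; rewrite E in k3.
  by have := nc_tri z' a h; rewrite (ncC a z'); lra.
exists (cm p / 2); first by rewrite divr_gt0.
by move=> z' Dz' z'h; rewrite -aE; exact: key.
Qed.

Definition adherent (D : set C) h := forall e : R, 0 < e -> exists2 z, D z & nc (z - h) < e.

(** By [confine], a domain sharing with [D] a point near [h] sees the cone at [p] with its apex at
    [h]; the only zero in the cone is [p], where [cF p] vanishes, so a hit of that domain near [h]
    is [h] itself. *)
Lemma hit_discrete phi D h p : hit phi D h p -> exists2 rho : R, 0 < rho &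
  forall (D' : set C) h' p', oset D' -> cvx D' -> imm D' phi -> adherent D' h' ->
   hit phi D' h' p' -> (exists z, [/\ D z, D' z & nc (z - h) < rho]) -> nc (h' - h) < rho -> h' = h.
Proof.
move=> [sp [eta e0 he]]; have cb := cones sp; have m0 := cb_m cb.
exists (Num.min eta (cm p)); first by rewrite lt_min e0.
move=> D' h' p' oD cD iD ad hh' [z [Dz D'z]].
rewrite !lt_min => /andP[z1 z2] /andP[h1 h2].
have [Uz Fz] := he z Dz z1.
have key z' : D' z' -> nc (z' - h) < cm p -> cU p (phi z') /\ cF p (phi z') = z' - h.
  by move=> D'z' z'h; apply: (confine sp oD cD iD D'z D'z' Uz Fz).
have near (e : R) : 0 < e -> exists2 z', D' z' & nc (z' - h') < e /\ nc (z' - h) < cm p.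
  move=> e0'; have [z' D'z'] := ad (Num.min e (cm p - nc (h' - h))) ltac:(by rewrite lt_min e0' subr_gt0).
  rewrite lt_min => /andP[k1 k2]; exists z' => //; split => //.
  by have := nc_tri h' z' h; lra.
have Up' : cU p p'.
  apply: contrapT => nU.
  have oK : open (~` [set x | cU p x /\ nc (cF p x) <= cm p]).
    by rewrite openC; exact: cb_closed cb.
  have nK : (~` [set x | cU p x /\ nc (cF p x) <= cm p]) p' by move=> [].
  have [e' e'0 he'] := hit_lim hh' oK nK.
  have [z' D'z' [k1 k2]] := near _ e'0; have [U' F'] := key z' D'z' k2.
  by apply: (he' z' D'z' k1); split => //; rewrite F' ltW.
have pp : p' = p by apply: (cb_sing cb) => //; case: hh'.
rewrite pp in hh'.
apply/eqP/negPn/negP; rewrite -subr_eq0 -nc_gt0 => hn.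
have n20 : 0 < nc (h' - h) / 2 by rewrite divr_gt0.
have n1 : nbhs p [set y | nc (cF p y) < nc (h' - h) / 2].
  have nV : nbhs (cF p p) [set u | nc u < nc (h' - h) / 2].
    by apply/nbhs_ncP; exists (nc (h' - h) / 2) => // w; rewrite (cb_Fp cb) subr0.
  exact: (cb_cont cb (cb_p cb) nV).
move: n1; rewrite nbhsE; case=> O [oO Op] sO.
have [e' e'0 he'] := hit_lim hh' oO Op.
have [z' D'z'] := near (Num.min e' (nc (h' - h) / 2)) ltac:(by rewrite lt_min e'0).
rewrite lt_min => -[/andP[k1 k2] k3]; have [U' F'] := key z' D'z' k3.
have := sO _ (he' z' D'z' k1); rewrite /= F'.
by have := nc_tri z' h' h; rewrite (ncC h' z'); lra.
Qed.

(** By continuity [psi h] would be the limit [p], a zero, whereas immersions avoid the zeros. *)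
Lemma hit_notin phi psi D D' h p : hit phi D h p -> imm D' psi -> D' h ->
  (forall e : R, 0 < e -> exists z, [/\ D z, nc (z - h) < e & phi z = psi z]) -> False.
Proof.
move=> hh iD D'h H; have [ns c _] := iD _ D'h; have [sp _] := hh.
apply: ns; rewrite (_ : psi h = p) //.
apply: T_hausdorff => A B; rewrite !nbhsE => -[A' [oA Ax] sA] [B' [oB Bx] sB].
have [e1 e10 h1] := (proj1 (ccontX psi h)) c _ oA Ax.
have [e2 e20 h2] := hit_lim hh oB Bx.
have [z [Dz]] := H (Num.min e1 e2) ltac:(by rewrite lt_min e10).
rewrite lt_min => /andP[k1 k2] E; exists (psi z); split; first by apply/sA/h1.
by rewrite -E; apply/sB/h2.
Qed.

End Hits.
End Exponential.

(** * Immersed discs are at most as large as the covering radius *)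

Section RealPath.
Variable R : realType.
Local Notation C := R[i].
Local Notation mu := (@lebesgue_measure R).
Implicit Types (u : R -> C) (a b g : R -> R).

Definition rder u (t : R) (d : C) := forall e : R, 0 < e -> exists2 r : R, 0 < r &
  forall s, `|s - t| < r -> nc (u s - u t - (s - t)%:C * d) <= e * `|s - t|.

Lemma derivable_eps a t : derivable a t 1 -> forall e : R, 0 < e -> exists2 r : R, 0 < r &
  forall s, `|s - t| < r -> `|a s - a t - (s - t) * derive1 a t| <= e * `|s - t|.
Proof.
move=> da e e0; rewrite derive1E /derive.
move: da; rewrite /derivable; set q := (fun h : R => _) => /cvg_ex[d qd].
rewrite (cvg_lim (@norm_hausdorff _ _) qd).
have /qd : nbhs d [set u | `|u - d| < e].
  by apply/nbhs_ballP; exists e => // w; rewrite /ball /= distrC.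
rewrite /fmap /= /dnbhs /within /=; move/nbhs_ballP => [r r0 hr].
exists r => // s st.
have [->|sn] := eqVneq s t; first by rewrite !subrr mul0r subr0 normr0 mulr0.
have s0 : s - t != 0 by rewrite subr_eq0.
have := hr (s - t); rewrite /ball /= sub0r normrN => /(_ st s0).
rewrite /q /= -[X in a X]/((s - t) * 1 + t) mulr1 subrK => /ltW h.
have -> : a s - a t - (s - t) * d = ((s - t)^-1 * (a s - a t) - d) * (s - t).
  by rewrite [RHS]mulrBl [_^-1 * _ * _]mulrAC mulVf // mul1r [d * _]mulrC.
by rewrite normrM; apply: ler_wpM2r.
Qed.

Lemma path_rder a b t : derivable a t 1 -> derivable b t 1 ->
  rder (fun s => a s +i* b s) t (derive1 a t +i* derive1 b t).
Proof.
move=> da db e e0; have e2 : 0 < e / 2 by rewrite divr_gt0.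
have [r1 r10 h1] := derivable_eps da e2; have [r2 r20 h2] := derivable_eps db e2.
exists (Num.min r1 r2) => [|s]; first by rewrite lt_min r10.
rewrite lt_min => /andP[/h1 k1 /h2 k2].
apply: (le_trans (nc_ReIm _)).
have E1 : Re ((a s +i* b s) - (a t +i* b t) - (s - t)%:C * (derive1 a t +i* derive1 b t))
  = a s - a t - (s - t) * derive1 a t by rewrite !ReImE /= mul0r subr0.
have E2 : Im ((a s +i* b s) - (a t +i* b t) - (s - t)%:C * (derive1 a t +i* derive1 b t))
  = b s - b t - (s - t) * derive1 b t by rewrite !ReImE /= mul0r addr0.
by rewrite E1 E2 (le_trans (lerD k1 k2)) // -mulrDl -splitr.
Qed.

Lemma rder_cont u t d : rder u t d -> forall e : R, 0 < e -> exists2 r : R, 0 < r &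
  forall s, `|s - t| < r -> nc (u s - u t) < e.
Proof.
move=> hu e e0; have [r r0 hr] := hu 1 ltr01.
pose K := nc d + 1; have K0 : 0 < K by rewrite ltr_wpDl ?nc_ge0.
exists (Num.min r (e / K)) => [|s]; first by rewrite lt_min r0 divr_gt0.
rewrite lt_min => /andP[/hr k1]; rewrite ltr_pdivlMr // => k2.
have -> : u s - u t = (u s - u t - (s - t)%:C * d) + (s - t)%:C * d by ring.
apply: (le_lt_trans (ncD _ _)); rewrite nc_scale mul1r in k1 *.
apply: (le_lt_trans (lerD k1 (lexx _))); apply: (le_lt_trans _ k2).
by rewrite /K mulrDr mulr1 addrC.
Qed.

Lemma rder_comp (F : C -> C) u t d d' : rder u t d -> cder F (u t) d' ->
  rder (fun s => F (u s)) t (d' * d).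
Proof.
move=> hu hF e e0.
pose K := nc d + 1; have K0 : 0 < K by rewrite ltr_wpDl ?nc_ge0.
pose K' := nc d' + 1; have K'0 : 0 < K' by rewrite ltr_wpDl ?nc_ge0.
have [s1 s10 hs1] := hF (e / 2 / K) ltac:(by rewrite !divr_gt0).
have [u1 u10 hu1] := rder_cont hu s10.
have [v1 v10 hv1] := hu (Num.min 1 (e / 2 / K')) ltac:(by rewrite lt_min ltr01 !divr_gt0).
exists (Num.min u1 v1) => [|s]; first by rewrite lt_min u10.
rewrite lt_min => /andP[/hu1 /hs1 h2 /hv1 h1].
set A := u s - u t in h1 h2; set B := F _ - _ in h2; set n := `|s - t| in h1 *.
have n0 : 0 <= n by exact: normr_ge0.
have -> : F (u s) - F (u t) - (s - t)%:C * (d' * d) = (B - d' * A) + d' * (A - (s - t)%:C * d).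
  by rewrite /A /B; ring.
apply: (le_trans (ncD _ _)); rewrite ncM.
have hA : nc A <= K * n.
  have -> : A = (A - (s - t)%:C * d) + (s - t)%:C * d by ring.
  apply: (le_trans (ncD _ _)); rewrite nc_scale -/n /K mulrDl mul1r addrC [n * _]mulrC lerD2l.
  by rewrite (le_trans h1) // ler_piMl // ge_min lexx.
have h3 : nc (B - d' * A) <= e / 2 * n.
  apply: (le_trans h2); apply: (@le_trans _ _ (e / 2 / K * (K * n))).
    by rewrite ler_wpM2l // !divr_ge0 // ltW.
  by rewrite mulrA divfK ?lexx // gt_eqF.
have h4 : nc d' * nc (A - (s - t)%:C * d) <= e / 2 * n.
  have h5 : nc (A - (s - t)%:C * d) <= e / 2 / K' * n.
    by rewrite (le_trans h1) // ler_wpM2r // ge_min lexx orbT.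
  rewrite (le_trans (ler_wpM2l (nc_ge0 _) h5)) // mulrA ler_wpM2r //.
  rewrite mulrCA ler_piMr ?divr_ge0 ?(ltW e0) // ler_pdivrMr // mul1r /K'; lra.
by rewrite (le_trans (lerD h3 h4)) // -mulrDl -splitr.
Qed.

Lemma rint_ge_cst g (k : R) s t : s <= t -> ccs g s t -> (forall r, s <= r -> r <= t -> k <= g r) ->
  k * (t - s) <= rint g s t.
Proof.
move=> st cg h; have := @rint_ge R g k 0 s t st cg.
by rewrite !mul0r addr0; apply => r r1 r2; rewrite mul0r addr0; exact: h.
Qed.

(** Unlike in [seg_mvt], the bound on the speed varies with time and is integrated: this compares a
    Euclidean displacement with the length of an arc. *)
Lemma path_mvt u (u' : R -> C) g s0 t0 : s0 <= t0 -> ccs g s0 t0 ->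
  (forall t, s0 <= t -> t <= t0 -> rder u t (u' t) /\ nc (u' t) <= g t) ->
  nc (u t0 - u s0) <= rint g s0 t0.
Proof.
move=> st cg hu.
apply/ler_addgt0Pl => e0 e00.
pose e := e0 / (t0 - s0 + 1); have ep : 0 < e by rewrite divr_gt0 // ltr_wpDl // subr_ge0.
have ele : e * (t0 - s0) <= e0.
  by rewrite /e mulrAC ler_pdivrMr ?ltr_wpDl ?subr_ge0 // ler_pM2l //; lra.
suff H : forall t, s0 <= t -> t <= t0 -> nc (u t - u s0) <= rint g s0 t + e * (t - s0).
  by have := H t0 st (lexx _); lra.
have e2 : 0 < e / 2 by rewrite divr_gt0.
have key t : s0 <= t -> t <= t0 -> exists2 r : R, 0 < r & forall p q, s0 <= p -> q <= t0 -> p <= q ->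
    `|p - t| < r -> `|q - t| < r -> (p = t \/ q = t) -> nc (u q - u p) <= rint g p q + e * (q - p).
  move=> h1 h2; have [du gu] := hu t h1 h2.
  have [r1 r10 hr1] := du _ e2; have [r2 r20 hr2] := cg t h1 h2 _ e2.
  exists (Num.min r1 r2); first by rewrite lt_min r10.
  move=> p q sp qt pq; rewrite !lt_min => /andP[p1 p2] /andP[q1 q2] hpq.
  have h3 : (g t - e / 2) * (q - p) <= rint g p q.
    apply: rint_ge_cst => //; first by apply: ccsS cg.
    move=> r pr rq; have : `|g r - g t| < e / 2.
      apply: hr2; move: p2 q2; rewrite !ltr_distl => /andP[? ?] /andP[? ?]; apply/andP; split; lra.
    by rewrite ltr_distl => /andP[? _]; exact: ltW.
  suff : nc (u q - u p) <= (g t + e / 2) * (q - p).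
    have : (g t + e / 2) * (q - p) = (g t - e / 2) * (q - p) + e * (q - p) by field.
    lra.
  have h4 s : `|s - t| < r1 -> nc (u s - u t) <= (g t + e / 2) * `|s - t|.
    move=> /hr1 k; have -> : u s - u t = (u s - u t - (s - t)%:C * u' t) + (s - t)%:C * u' t by ring.
    apply: (le_trans (ncD _ _)); rewrite nc_scale [X in _ <= X]mulrDl addrC lerD //.
    by rewrite mulrC ler_wpM2r.
  case: hpq => E.
    by have := h4 q q1; rewrite E ger0_norm // subr_ge0 -E.
  have := h4 p p1; rewrite ncC -E ler0_norm ?subr_le0 //.
  by rewrite opprB.
apply: real_ind => //.
- by rewrite !subrr nc0 mulr0 addr0 /rint set_itv1 Rintegral_set1.
- move=> t h1 h2 hp; have [r r0 hr] := key t h1 (ltW h2).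
  exists r => // s ts sr st0.
  have k := hr t s h1 st0 (ltW ts) ltac:(by rewrite subrr normr0) ltac:(by rewrite gtr0_norm ?subr_gt0 //; lra) (or_introl erefl).
  have k2 := hp t h1 (lexx _).
  rewrite (rint_split h1 (ltW ts)); last by apply: ccsS cg.
  have := nc_tri (u t) (u s) (u s0); lra.
- move=> t h1 h2 hp; have [r r0 hr] := key t (ltW h1) h2.
  pose s := Num.max s0 (t - r / 2).
  have ss : s0 <= s by rewrite le_max lexx.
  have st' : s < t by rewrite gt_max h1 /=; lra.
  have sr : t - r / 2 <= s by rewrite le_max lexx orbT.
  have k := hr s t ss h2 (ltW st') ltac:(by rewrite ltr0_norm ?subr_lt0 //; lra) ltac:(by rewrite subrr normr0) (or_intror erefl).
  have k2 := hp s ss st'.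
  rewrite (rint_split ss (ltW st')); last by apply: ccsS cg.
  have := nc_tri (u s) (u t) (u s0); lra.
Qed.

End RealPath.

(** * Lengths of paths and immersed discs *)

Section Metric.
Variables (R : realType) (T : translationSurface R).
Local Notation C := R[i].
Local Notation mu := (@lebesgue_measure R).
Local Notation f := (form_coef (omega T)).
Local Notation ch i := (chart_map (atlas i)).
Local Notation chi i := (chart_inv (atlas i)).
Local Notation dom i := (chart_dom (atlas i)).
Local Notation img i := (chart_img (atlas i)).
Local Notation sing := (singularities T).

Section Arc.
Variables (i : chart_index T) (a b : R -> R).
Hypothesis C1 : C1_arc a b.
Hypothesis arc_in : forall t, 0 <= t <= 1 -> img i (a t +i* b t).
Let gam (t : R) : C := a t +i* b t.
Let dgam (t : R) : C := derive1 a t +i* derive1 b t.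
Let g (t : R) : R := nc (f i (gam t)) * nc (dgam t).

Lemma arc_rder t : rder gam t (dgam t).
Proof. by case: C1 => da db _ _; exact: path_rder. Qed.

Lemma speed_ge0 t : 0 <= g t. Proof. by rewrite mulr_ge0 ?nc_ge0. Qed.

Lemma velocity_cont t (e : R) : 0 < e -> exists2 r : R, 0 < r & forall s, `|s - t| < r -> nc (dgam s - dgam t) < e.
Proof.
move=> e0; case: C1 => _ _ ca cb.
have rc (h : R -> R) : continuous h -> exists2 r : R, 0 < r & forall s, `|s - t| < r -> `|h s - h t| < e / 2.
  move=> ch'; have nV : nbhs (h t) [set u | `|u - h t| < e / 2].
    by apply/nbhs_ballP; exists (e / 2); rewrite /= ?divr_gt0 // => w; rewrite /ball /= distrC.
  have := ch' t _ nV => /nbhs_ballP[r r0 hr]; exists r => // s st.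
  by apply: hr; rewrite /ball /= distrC.
have [r1 r10 h1] := rc _ ca; have [r2 r20 h2] := rc _ cb.
exists (Num.min r1 r2) => [|s]; first by rewrite lt_min r10.
rewrite lt_min => /andP[/h1 k1 /h2 k2].
apply: (le_lt_trans (nc_ReIm _)); rewrite /dgam.
have -> : Re (derive1 a s +i* derive1 b s - (derive1 a t +i* derive1 b t)) = derive1 a s - derive1 a t by rewrite !ReImE.
have -> : Im (derive1 a s +i* derive1 b s - (derive1 a t +i* derive1 b t)) = derive1 b s - derive1 b t by rewrite !ReImE.
by rewrite [e]splitr ltrD.
Qed.

Lemma speed_ccs : ccs g 0 1.
Proof.
move=> t t0 t1 e e0.
have it : img i (gam t) by apply: arc_in; rewrite t0.
pose A := nc (f i (gam t)) + 1; have A0 : 0 < A by rewrite ltr_wpDl ?nc_ge0.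
pose B := nc (dgam t) + 1; have B0 : 0 < B by rewrite ltr_wpDl ?nc_ge0.
pose e1 := Num.min 1 (e / 2 / B); pose e2 := e / 2 / A.
have e10 : 0 < e1 by rewrite lt_min ltr01 !divr_gt0.
have e20 : 0 < e2 by rewrite !divr_gt0.
have [s1 s10 hs1] := f_cont it e10.
have [r1 r10 hr1] := rder_cont (arc_rder t) s10.
have [r2 r20 hr2] := velocity_cont t e20.
exists (Num.min r1 r2) => [|s]; first by rewrite lt_min r10.
rewrite lt_min => /andP[/hr1 /hs1 k1 /hr2 k2]; rewrite /g.
set p := nc (f i (gam s)); set p' := nc (f i (gam t)); set q := nc (dgam s); set q' := nc (dgam t).
have d1 : `|p - p'| < e1 by exact: le_lt_trans (nc_dist _ _) k1.
have d2 : `|q - q'| < e2 by exact: le_lt_trans (nc_dist _ _) k2.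
have -> : p * q - p' * q' = p * (q - q') + (p - p') * q' by ring.
apply: (le_lt_trans (ler_normD _ _)); rewrite !normrM.
have pA : `|p| <= A.
  rewrite ger0_norm ?nc_ge0 // /A -/p'; move: d1; rewrite lt_min ltr_distl => /andP[/andP[_ ?] _]; lra.
have h1 : `|p| * `|q - q'| < e / 2.
  apply: (@le_lt_trans _ _ (A * `|q - q'|)); first by rewrite ler_wpM2r.
  by rewrite mulrC -ltr_pdivlMr.
have h2 : `|p - p'| * `|q'| <= e / 2.
  apply: (@le_trans _ _ (e / 2 / B * B)); last by rewrite divfK // gt_eqF.
  apply: ler_pM => //.
    by move: d1; rewrite lt_min => /andP[_ /ltW].
  by rewrite ger0_norm ?nc_ge0 // /B -/q'; lra.
lra.
Qed.

Lemma arc_lengthE : arc_length i a b = (rint g 0 1)%:E.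
Proof.
rewrite /rint /Rintegral fineK //.
by apply: integrable_fin_num => //; exact: ccs_int speed_ccs.
Qed.

Lemma rint_speed_mono s t : 0 <= s -> s <= t -> t <= 1 -> rint g 0 s <= rint g 0 t.
Proof.
move=> s0 st t1; rewrite (rint_split s0 st); last by apply: ccsS speed_ccs.
rewrite lerDl; have := @rint_ge_cst R g 0 s t st; rewrite mul0r; apply.
  by apply: ccsS speed_ccs.
by move=> *; exact: speed_ge0.
Qed.

Variables (r : R) (phi : C -> T) (z : C).
Hypothesis iphi : imm (cball 0 r) phi.
Hypothesis start : chi i (gam 0) = phi z.
Hypothesis short : nc z + rint g 0 1 < r.

(* An arc starting inside an immersed disc and shorter than the distance to its
   boundary lifts to the disc, where its length is Euclidean. *)
Lemma arc_lift : exists2 z', nc (z' - z) <= rint g 0 1 & phi z' = chi i (gam 1).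
Proof.
pose P t := exists2 z', nc (z' - z) <= rint g 0 t & phi z' = chi i (gam t).
suff H : forall t : R, 0 <= t -> t <= 1 -> P t by exact: H 1 ler01 (lexx _).
have inr t z' : 0 <= t -> t <= 1 -> nc (z' - z) <= rint g 0 t -> nc z' < r.
  move=> t0 t1 h; have := rint_speed_mono t0 t1 (lexx _).
  by have := ncD (z' - z) z; rewrite subrK; move: short; lra.
have inD t z' : 0 <= t -> t <= 1 -> nc (z' - z) <= rint g 0 t -> cball 0 r z'.
  by move=> t0 t1 h; rewrite /cball /= subr0; exact: inr h.
have gin t : 0 <= t -> t <= 1 -> img i (gam t) by move=> t0 t1; apply: arc_in; rewrite t0.
apply: real_ind => //.
- by exists z => //; rewrite subrr nc0 /rint set_itv1 Rintegral_set1.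
- move=> t t0 t1 hp; have [z' hz' E] := hp t t0 (lexx _).
  have Dz' := inD t z' t0 (ltW t1) hz'.
  have [ns _ _] := iphi Dz'.
  have it := gin t t0 (ltW t1).
  have dt' : dom i (phi z') by rewrite E; exact: chi_dom.
  have [d [e [al [F [G fb]]]]] := flatbox_ex dt' ns.
  have chE : ch i (phi z') = gam t by rewrite E chiK.
  have [[_ d0 e0 _ F0] hF _ _] := fb; rewrite chE in F0 hF.
  have [r1 r10 hr1] := cball_oset Dz'.
  pose psi w := chi i (G (w - z')).
  have ipsi w : nc (w - z') < e -> imm_at psi w.
    by move=> hw; apply: (@imm_at_shift R T (fun y => chi i (G y)) (- z')); apply: (fb_imm fb).
  have [r2 r20 hr2] : exists2 r2 : R, 0 < r2 & forall w, nc (w - z') < r2 -> phi w = psi w.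
    apply: (@imm_uniq_loc R T phi psi z' (Num.min r1 e)); first by rewrite lt_min r10.
      by move=> w; rewrite lt_min => /andP[/hr1 k1 k2]; split; [exact: iphi|exact: ipsi].
    by rewrite /psi subrr (fb0 fb).
  have m0 : 0 < Num.min e r2 by rewrite lt_min e0.
  have gd0 : nc (gam t - gam t) < d by rewrite subrr nc0.
  have [s1 s10 hs1] := cder_cont (let: And3 _ _ h := hF _ gd0 in h) m0.
  have [r3 r30 hr3] := rder_cont (arc_rder t) (ltac:(by rewrite lt_min d0) : 0 < Num.min d s1).
  exists r3 => // s ts sr s1'.
  have near q : t <= q -> q <= s -> nc (gam q - gam t) < Num.min d s1.
    by move=> tq qs; apply: hr3; rewrite ger0_norm ?subr_ge0 //; lra.
  have s0 : 0 <= s by rewrite (le_trans t0) ?ltW.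
  (* In the flat coordinate [F] the arc has speed [g], so its displacement is at most the length of
     the piece travelled. *)
  have Fs : nc (F (gam s)) <= rint g t s.
    have := @path_mvt R (fun q => F (gam q)) (fun q => f i (gam q) * dgam q) g t s (ltW ts).
    rewrite F0 subr0; apply; first by apply: ccsS speed_ccs.
    move=> q tq qs; have := near q tq qs; rewrite lt_min => /andP[qd _].
    split; last by rewrite ncM.
    by apply: rder_comp; [exact: arc_rder|case: (hF _ qd)].
  have := near s (ltW ts) (lexx _); rewrite lt_min => /andP[sd /hs1].
  rewrite F0 subr0 lt_min => /andP[Fe Fr2].
  exists (z' + F (gam s)).
    rewrite (rint_split t0 (ltW ts)); last by apply: ccsS speed_ccs.
    have -> : z' + F (gam s) - z = (z' - z) + F (gam s) by ring.
    by rewrite (le_trans (ncD _ _)) // lerD.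
  have sE : z' + F (gam s) - z' = F (gam s) by ring.
  rewrite hr2 /psi sE //.
  have his := gin s s0 s1'.
  have := @fb_chi_F R T (phi z') i d e al F G fb (chi i (gam s)) (chi_dom his).
  by rewrite chiK // chE; apply.
- move=> t t0 t1 hp.
  have ex (s : R) : exists w : C, 0 <= s -> s < t -> nc (w - z) <= rint g 0 s /\ phi w = chi i (gam s).
    have [h1|h1] := pselect (0 <= s /\ s < t); last by exists 0 => h2 h3; case: h1.
    by have [z' k1 k2] := hp s (proj1 h1) (proj2 h1); exists z'.
  have [zeta hz] := choice ex.
  pose K := [set w : C | nc (w - z) <= rint g 0 t].
  (* The lifts at times [s < t] stay in a compact disc; a cluster point as [s] tends to [t] is a
     lift at time [t], because the surface is Hausdorff. *)
  pose Fil : set_system C := fun A => exists2 dl : R, 0 < dl & forall s, 0 <= s -> s < t -> `|s - t| < dl -> A (zeta s).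
  have PF : ProperFilter Fil.
    split.
      by move=> [dl dl0 hd]; have [s [s0 st sd]] := left_approx t0 dl0; exact: hd s s0 st sd.
    split.
    - by exists 1.
    - move=> A B [e1 e10 h1] [e2 e20 h2]; exists (Num.min e1 e2) => [|s s0 st]; first by rewrite lt_min e10.
      by rewrite lt_min => /andP[? ?]; split; [exact: h1|exact: h2].
    - by move=> A B AB [e e0 he]; exists e => // s s0 st sd; apply/AB/he.
  have FK : Fil K.
    exists 1 => // s s0 st _; have [k1 _] := hz s s0 st.
    by apply: (le_trans k1); apply: rint_speed_mono => //; exact: ltW.
  have [zs [Kzs cl]] := @compact_disc R z (rint g 0 t) Fil PF FK.
  exists zs => //.
  have Dzs := inD t zs (ltW t0) t1 Kzs.
  have [_ cphi _] := iphi Dzs.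
  apply: T_hausdorff => A B; rewrite !nbhsE => -[A' [oA Ax] sA] [B' [oB Bx] sB].
  have [e1 e10 h1] := (proj1 (ccontX phi zs)) cphi _ oA Ax.
  have it := gin t (ltW t0) t1.
  have [e2 e20 h2] : exists2 e2 : R, 0 < e2 & forall w, nc (w - gam t) < e2 -> B' (chi i w).
    by apply/nbhs_ncP; apply: (chi_cont it); apply: open_nbhs_nbhs.
  have [e3 e30 h3] := rder_cont (arc_rder t) e20.
  have FB : Fil [set w | exists s, [/\ 0 <= s, s < t, `|s - t| < e3 & w = zeta s]].
    by exists e3 => // s s0 st sd; exists s.
  have nA : nbhs zs [set w | nc (w - zs) < e1] by apply/nbhs_ncP; exists e1.
  have [w [[s [s0 st sd ->]] hw]] := cl _ _ FB nA.
  exists (phi (zeta s)); split; first by apply/sA/h1.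
  have [_ ->] := hz s s0 st; apply/sB/h2/h3; exact: sd.
Qed.

End Arc.

Lemma path_lift (r : R) (phi : C -> T) y L : imm (cball 0 r) phi -> 0 < r ->
  path_length (phi 0) y L -> (L < r%:E)%E -> exists2 z, ((nc z)%:E <= L)%E & phi z = y.
Proof.
move=> iphi r0; elim => [_|y' L' i a b _ IH C1 arc_in st].
  by exists 0 => //; rewrite nc0.
rewrite (arc_lengthE C1 arc_in) => LL.
have g0 : 0 <= rint (fun t => nc (f i (a t +i* b t)) * nc (derive1 a t +i* derive1 b t)) 0 1.
  have := rint_speed_mono C1 arc_in (lexx 0) ler01 (lexx _).
  by rewrite {1}/rint set_itv1 Rintegral_set1.
have [|z zL E] := IH.
  by apply: (le_lt_trans _ LL); rewrite leeDl // lee_fin.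
have short : nc z + rint (fun t => nc (f i (a t +i* b t)) * nc (derive1 a t +i* derive1 b t)) 0 1 < r.
  by rewrite -lte_fin EFinD; apply: (le_lt_trans _ LL); rewrite leeD2r.
have start : chi i (a 0 +i* b 0) = phi z by rewrite st E.
have [z' h1 h2] := arc_lift C1 arc_in iphi start short.
exists z' => //; apply: (@le_trans _ _ ((nc z)%:E + (nc (z' - z))%:E)%E).
  by rewrite -EFinD lee_fin addrC; have := ncD (z' - z) z; rewrite subrK.
by apply: leeD => //; rewrite lee_fin.
Qed.

(** A path from the centre to a zero that is shorter than [r] would lift to the disc, whose image
    avoids the zeros. *)
Lemma disc_bound (r : R) (phi : C -> T) : imm (cball 0 r) phi -> 0 < r -> (r%:E <= c_rad T)%E.
Proof.
move=> iphi r0.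
apply: (@le_trans _ _ (dist_to_singularities (phi 0))); last by apply: ereal_sup_ubound; exists (phi 0).
apply: le_ereal_inf_tmp => _ [s ss <-]; apply: le_ereal_inf_tmp => L pL.
rewrite leNgt; apply/negP => Lr; have [z zL E] := path_lift iphi r0 pL Lr.
have Dz : cball 0 r z by rewrite /cball /= subr0 -lte_fin; exact: le_lt_trans zL Lr.
by have [ns _ _] := iphi z Dz; rewrite E in ns.
Qed.

End Metric.

(** * Largest empty discs *)

Section Delaunay.
Variable R : realType.
Local Notation C := R[i].
Variables (E : set C) (b : R).
Implicit Types (v w z h n dl : C).
Hypothesis oE : oset E.
Hypothesis E0 : E 0.
Hypothesis bounded : forall v (r : R), nc v < r -> cball v r `<=` E -> r <= b.
Hypothesis isolated : forall v (r : R) h, cball v r `<=` E -> nc v < r -> ~ E h -> nc (h - v) = r ->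
  exists2 rho : R, 0 < rho & forall v' (r' : R) h', cball v' r' `<=` E -> nc v' < r' -> ~ E h' ->
    nc (h' - v') = r' -> (exists z, [/\ cball v r z, cball v' r' z & nc (z - h) < rho]) ->
    nc (h' - h) < rho -> h' = h.

Lemma compl_closed : closed (~` E).
Proof. by rewrite closedC; apply/openCP. Qed.

Lemma compl_neq0 : exists n, ~ E n.
Proof.
apply: contrapT => no.
have H (r : R) : 0 < r -> r <= b.
  move=> r0; apply: (@bounded 0); first by rewrite nc0.
  by move=> z _; apply: contrapT => nz; apply: no; exists z.
have := H (Num.max 0 b + 1) ltac:(by rewrite ltr_wpDl // le_max lexx).
have : b <= Num.max 0 b by rewrite le_max lexx orbT.
lra.
Qed.

Lemma nearest v : exists n, ~ E n /\ forall n', ~ E n' -> nc (n - v) <= nc (n' - v).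
Proof.
have [n0 hn0] := compl_neq0.
pose K := [set n | nc (n - v) <= nc (n0 - v)] `&` ~` E.
have cK : compact K.
  apply: compact_closedI; last exact: compl_closed.
  exact: compact_disc.
have K0 : K !=set0 by exists n0; split => /=.
have cc : {within K, continuous (fun n => nc (n - v))}.
  apply: within_cont => z _ e e0; exists e => // w hw.
  apply: (le_lt_trans (nc_dist _ _)).
  by have -> : w - v - (z - v) = w - z by ring.
have [n] := compact_EVT_min K0 cK cc; rewrite inE => -[k1 k2] hmin.
exists n; split => // n' hn'.
have [h|/ltW h] := leP (nc (n' - v)) (nc (n0 - v)); last exact: le_trans k1 h.
by apply: hmin; rewrite inE.
Qed.

Let near := projT1 (choice nearest).
Let nearP v : ~ E (near v) /\ forall n', ~ E n' -> nc (near v - v) <= nc (n' - v).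
Proof. exact: projT2 (choice nearest) v. Qed.
Let d v := nc (near v - v).
(* The negated power of 0 with respect to the largest empty disc centred at [v]:
   at a maximum, the convex hull of the boundary points contains 0. *)
Let g v := d v ^+ 2 - nc v ^+ 2.

Lemma gap_ge0 v : 0 <= d v. Proof. exact: nc_ge0. Qed.

Lemma gap_lip v v' : d v <= d v' + nc (v - v').
Proof.
have [h1 _] := nearP v'; have [_ h2] := nearP v.
apply: (le_trans (h2 _ h1)); apply: (le_trans (nc_tri v' _ _)).
by rewrite (ncC v').
Qed.

Lemma gap_disc v : cball v (d v) `<=` E.
Proof.
move=> z zv; apply: contrapT => nz; have [_ h] := nearP v.
by have := h z nz; rewrite leNgt -/(d v); move/negP; apply.
Qed.

(** For fixed [n] the right-hand side is affine in [v]. With [power_near], which gives equality at a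
    nearest point, this makes [g] a lower envelope of affine functions, hence concave. *)
Lemma power_le v n : ~ E n -> g v <= nc n ^+ 2 - 2 * dt n v.
Proof.
move=> hn; have [_ h] := nearP v; have := h n hn; rewrite -/(d v) => k.
have : d v ^+ 2 <= nc (n - v) ^+ 2 by rewrite lerXn2r ?nnegrE ?nc_ge0.
rewrite nc_subsq /g; lra.
Qed.

Lemma power_near v : g v = nc (near v) ^+ 2 - 2 * dt (near v) v.
Proof. by rewrite /g /d nc_subsq; ring. Qed.

Lemma power0_gt0 : 0 < g 0.
Proof.
rewrite /g nc0 expr0n /= subr0 exprn_gt0 // /d subr0 nc_gt0; apply/eqP => h.
by have [] := nearP 0; rewrite h.
Qed.

Lemma power_pos v : 0 < g v -> nc v < d v /\ d v <= b.
Proof.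
rewrite /g subr_gt0 => h.
have k : nc v < d v by rewrite -(ltr_pXn2r (_ : (0 < 2)%N)) ?nnegrE ?nc_ge0 ?gap_ge0.
by split => //; exact: bounded (@gap_disc v).
Qed.

Lemma power_cont v (e : R) : 0 < e -> exists2 t : R, 0 < t & forall w, nc (w - v) < t -> `|g w - g v| < e.
Proof.
move=> e0; pose K := 2 * d v + 2 * nc v + 2.
have d0 := gap_ge0 v; have v0 := nc_ge0 v.
have K0 : 0 < K by rewrite /K; lra.
exists (Num.min 1 (e / K)) => [|w]; first by rewrite lt_min ltr01 divr_gt0.
rewrite lt_min ltr_pdivlMr // => /andP[w1 w2].
have a1 := gap_lip w v; have a2 := gap_lip v w; rewrite (ncC v) in a2.
have b1 := nc_dist w v; rewrite ler_distl in b1; move/andP: b1 => [b1 b2].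
have s0 := nc_ge0 (w - v); set s := nc (w - v) in s0 w1 w2 a1 a2 b1 b2.
have -> : g w - g v = (d w - d v) * (d w + d v) - (nc w - nc v) * (nc w + nc v) by rewrite /g; ring.
have dw0 := gap_ge0 w; have w0 := nc_ge0 w.
have k1 : `|(d w - d v) * (d w + d v)| <= s * (2 * d v + 1).
  rewrite normrM; apply: ler_pM => //.
    by rewrite ler_distl; apply/andP; split; lra.
  by rewrite ger0_norm; lra.
have k2 : `|(nc w - nc v) * (nc w + nc v)| <= s * (2 * nc v + 1).
  rewrite normrM; apply: ler_pM => //.
    by rewrite ler_distl; apply/andP; split; lra.
  by rewrite ger0_norm; lra.
apply: (le_lt_trans (ler_normB _ _)); apply: (le_lt_trans (lerD k1 k2)).
by rewrite -mulrDr; apply: le_lt_trans w2; rewrite ler_wpM2l // /K; lra.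
Qed.

(** Where [g] is positive the centre has norm less than [d v <= b], so the maximisation takes place
    in a compact disc. Among the maximisers one farthest from 0 is kept; this tie-break later
    excludes discs with only two boundary points. *)
Lemma power_max : exists v, [/\ 0 < g v, forall w, g w <= g v & forall w, g w = g v -> nc w <= nc v].
Proof.
have b0 : 0 <= b by have [h1 h2] := power_pos power0_gt0; have := gap_ge0 0; lra.
pose K := [set v : C | nc (v - 0) <= b].
have cK : compact K by exact: compact_disc.
have K0 : K !=set0 by exists 0; rewrite /K /= subrr nc0.
have cg : {within K, continuous g} by apply: within_cont => z _ e; exact: power_cont.
have [v1] := compact_EVT_max K0 cK cg; rewrite inE => Kv1 hmax.
have g1 : 0 < g v1.
  by apply: (lt_le_trans power0_gt0); apply: hmax; rewrite inE /K /= subrr nc0.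
have glob w : g w <= g v1.
  have [h|h] := leP (g w) 0; first by apply: (le_trans h); exact: ltW.
  apply: hmax; rewrite inE /K /= subr0; have [k1 k2] := power_pos h.
  by apply: (le_trans (ltW k1)).
pose S := K `&` [set v | g v1 <= g v].
have cS : compact S.
  apply: compact_closedI => //; rewrite -openC; apply/openCP => z /= /negP; rewrite -ltNge => h.
  have [t t0 ht] := power_cont z (ltac:(by rewrite subr_gt0) : 0 < g v1 - g z).
  exists t => // w /ht; rewrite ltr_distl => /andP[_ k] /=.
  by apply/negP; rewrite -ltNge; lra.
have S0 : S !=set0 by exists v1; split => /=.
have cn : {within S, continuous (fun v => nc v)}.
  apply: within_cont => z _ e e0; exists e => // w hw.
  exact: le_lt_trans (nc_dist _ _) hw.
have [v] := compact_EVT_max S0 cS cn; rewrite inE => -[Kv gv] vmax.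
exists v; split; first exact: lt_le_trans gv.
  by move=> w; exact: le_trans (glob w) gv.
move=> w wE; apply: vmax; rewrite inE; split; last by rewrite /= wE.
have gw0 : 0 < g w by rewrite wE (lt_le_trans g1).
by have [k1 k2] := power_pos gw0; rewrite /K /= subr0; exact: le_trans (ltW k1) k2.
Qed.

Section AtMax.
Variable v : C.
Hypothesis gv : 0 < g v.
Hypothesis vmax : forall w, g w <= g v.

(** The nearest points to [v + t * dl] stay bounded as [t] tends to 0 from above, and a cluster
    point of them is nearest to [v]: it is a boundary point that becomes active in the direction
    [dl]. *)
Lemma near_cluster dl : exists h, [/\ ~ E h, nc (h - v) = d v &
  forall eta tau : R, 0 < eta -> 0 < tau -> exists t : R, [/\ 0 < t, t < tau & nc (near (v + t%:C * dl) - h) < eta]].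
Proof.
pose nt (t : R) := near (v + t%:C * dl).
have vt (t : R) : 0 <= t -> nc (v + t%:C * dl - v) = t * nc dl.
  by move=> t0; rewrite (_ : v + t%:C * dl - v = t%:C * dl) ?nc_scale ?ger0_norm //; ring.
pose Fil : set_system C := fun A => exists2 tau : R, 0 < tau & forall t, 0 < t -> t < tau -> A (nt t).
have PF : ProperFilter Fil.
  split.
    by move=> [tau t0 ht]; apply: (ht (tau / 2)); rewrite ?divr_gt0 // ltr_pdivrMr // ltr_pMr //; lra.
  split.
  - by exists 1.
  - move=> A B [e1 e10 h1] [e2 e20 h2]; exists (Num.min e1 e2) => [|s s0]; first by rewrite lt_min e10.
    by rewrite lt_min => /andP[? ?]; split; [exact: h1|exact: h2].
  - by move=> A B AB [e e0 he]; exists e => // s s0 st; apply/AB/he.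
have dn (t : R) : 0 <= t -> nc (nt t - v) <= d v + 2 * t * nc dl.
  move=> t0; have := nc_tri (v + t%:C * dl) (nt t) v; rewrite vt // -/(d _).
  by have := gap_lip (v + t%:C * dl) v; rewrite vt // /nt -/(d _); lra.
have FK : Fil [set w | nc (w - v) <= d v + 2 * nc dl].
  exists 1 => // t t0 t1 /=; apply: (le_trans (dn t (ltW t0))).
  have : t * nc dl <= 1 * nc dl by rewrite ler_wpM2r ?nc_ge0 // ltW.
  lra.
have [h [_ cl]] := @compact_disc R v (d v + 2 * nc dl) Fil PF FK.
have app (eta tau : R) : 0 < eta -> 0 < tau -> exists t : R, [/\ 0 < t, t < tau & nc (nt t - h) < eta].
  move=> e0 t0.
  have F1 : Fil [set w | exists t, [/\ 0 < t, t < tau & w = nt t]] by exists tau => // t ? ?; exists t.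
  have nh : nbhs h [set w | nc (w - h) < eta] by apply/nbhs_ncP; exists eta.
  by have [w [[t [k1 k2 ->]] k3]] := cl _ _ F1 nh; exists t.
have nE : ~ E h.
  move=> Eh; have [r r0 hr] := oE Eh; have [t [_ _ k]] := app r 1 r0 ltr01.
  by have [k' _] := nearP (v + t%:C * dl); apply/k'/hr.
exists h; split => //.
apply/eqP; rewrite eq_le; apply/andP; split; last by have [_ k] := nearP v; exact: k.
apply/ler_addgt0Pl => e e0.
have tau0 : 0 < e / (4 * (nc dl + 1)) by rewrite divr_gt0 // mulr_gt0 // ltr_wpDl ?nc_ge0.
have e20 : 0 < e / 2 by rewrite divr_gt0.
have [t [k1 k2 k3]] := app _ _ e20 tau0.
have := nc_tri (nt t) h v; rewrite (ncC h (nt t)); have := dn t (ltW k1).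
rewrite ltr_pdivlMr ?mulr_gt0 ?ltr_wpDl ?nc_ge0 // in k2.
have := mulr_ge0 (ltW k1) (nc_ge0 dl); nra.
Qed.

Lemma near_dir (t : R) dl : 0 < t -> 0 <= dt (near (v + t%:C * dl)) dl /\
  (g (v + t%:C * dl) < g v -> 0 < dt (near (v + t%:C * dl)) dl).
Proof.
move=> t0; set n := near _.
have h1 : g (v + t%:C * dl) = nc n ^+ 2 - 2 * dt n v - 2 * t * dt n dl.
  by rewrite power_near -/n /dt !ReImE /=; ring.
have h2 : g v <= nc n ^+ 2 - 2 * dt n v by apply: power_le; case: (nearP (v + t%:C * dl)).
have h3 := vmax (v + t%:C * dl).
have h4 (x : R) : 0 <= t * x -> 0 <= x by rewrite pmulr_rge0.
have h5 (x : R) : 0 < t * x -> 0 < x by rewrite pmulr_rgt0.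
split; first by apply: h4; lra.
by move=> h; apply: h5; lra.
Qed.

(** First-order optimality: [near_dir] gives the inequality for the nearest points to [v + t * dl],
    and it survives in the limit. Over all [dl] it says that 0 is in the convex hull of the boundary
    points. *)
Lemma hit_dir dl : exists h, [/\ ~ E h, nc (h - v) = d v & 0 <= dt h dl].
Proof.
have [h [h1 h2 h3]] := near_cluster dl; exists h; split => //.
rewrite leNgt; apply/negP => lt.
have e0 : 0 < - dt h dl / (nc dl + 1) by rewrite divr_gt0 ?oppr_gt0 // ltr_wpDl ?nc_ge0.
have [t [t0 _ k]] := h3 _ 1 e0 ltr01.
have [k1 _] := near_dir dl t0; set n := near _ in k k1.
have : dt n dl = dt h dl + dt (n - h) dl by rewrite /dt !ReImE; ring.
have := dt_le (n - h) dl; rewrite ltr_pdivlMr ?ltr_wpDl ?nc_ge0 // in k.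
have := nc_ge0 (n - h); have := nc_ge0 dl; nra.
Qed.

End AtMax.

(** [hit_dir] yields two boundary points. If there were no third, 0 would be on their line, and
    sliding the centre orthogonally to it, away from 0, would strictly decrease [g] by the
    tie-break. The nearest point would then have a positive scalar product with that direction,
    whereas by isolation it is one of the two points, orthogonal to it. *)
Lemma delaunay_disc : exists v (r : R), [/\ cball v r `<=` E, nc v < r,
  forall dl, exists h, [/\ ~ E h, nc (h - v) = r & 0 <= dt h dl] &
  exists h1 h2 h3, [/\ h1 != h2, h1 != h3, h2 != h3,
     forall h, h = h1 \/ h = h2 \/ h = h3 -> ~ E h & forall h, h = h1 \/ h = h2 \/ h = h3 -> nc (h - v) = r]].
Proof.
have [v [gv vmax vtie]] := power_max.
have [vd db] := power_pos gv.
exists v, (d v); split => //; [exact: gap_disc|exact: hit_dir|].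
have nE0 n : ~ E n -> n != 0 by move=> hn; apply/eqP => h; rewrite h in hn.
have [h1 [n1 d1 _]] := hit_dir vmax 0.
have h1p : 0 < dt h1 h1 by rewrite -nc_sqr exprn_gt0 // nc_gt0 nE0.
have [h2 [n2 d2 s2]] := hit_dir vmax (- h1).
have h12 : h1 != h2.
  apply/eqP => h; move: s2; rewrite -h.
  have -> : dt h1 (- h1) = - dt h1 h1 by rewrite /dt !ReImE; ring.
  lra.
have [h3 [n3 d3 k1 k2]] : exists h3, [/\ ~ E h3, nc (h3 - v) = d v, h1 != h3 & h2 != h3]; last first.
  exists h1, h2, h3; split => // h [->|[->|->]] //.
apply: contrapT => no.
have two h : ~ E h -> nc (h - v) = d v -> h = h1 \/ h = h2.
  move=> nh dh; have [->|/eqP k1] := eqVneq h1 h; first by left.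
  have [->|/eqP k2] := eqVneq h2 h; first by right.
  by exfalso; apply: no; exists h; split => //; apply/eqP.
have cr0 : cr h1 h2 = 0.
  apply/eqP/negPn/negP => crn.
  (* Cramer's solution of [dt h1 dl = dt h2 dl = -1], which [hit_dir] excludes. *)
  pose dl : C := ((Im h1 - Im h2) / cr h1 h2) +i* ((Re h2 - Re h1) / cr h1 h2).
  have e1 : dt h1 dl = - 1 by move: crn; rewrite /dt /dl /cr /= => crn; field.
  have e2 : dt h2 dl = - 1 by move: crn; rewrite /dt /dl /cr /= => crn; field.
  have [h [nh dh]] := hit_dir vmax dl.
  by case: (two h nh dh) => ->; rewrite ?e1 ?e2; lra.
pose q : C := (- Im h1) +i* (Re h1).
have [dl [dl0 o1 o2 vdl]] : exists dl, [/\ dl != 0, dt h1 dl = 0, dt h2 dl = 0 & 0 <= dt v dl].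
  have q1 : dt h1 q = 0 by rewrite /dt /q /=; ring.
  have q2 : dt h2 q = 0 by move: cr0; rewrite /dt /q /cr /=; lra.
  have q0 : q != 0.
    apply/eqP => h; move: h1p; have := congr1 (@complex.Re R) h; have := congr1 (@complex.Im R) h.
    rewrite /q /dt /= => -> /eqP; rewrite oppr_eq0 => /eqP ->; lra.
  have dN z : dt z (- q) = - dt z q by rewrite /dt !ReImE; ring.
  have [h|h] := leP 0 (dt v q); first by exists q.
  by exists (- q); rewrite oppr_eq0 !dN q1 q2 oppr0; split => //; lra.
have oH h : ~ E h -> nc (h - v) = d v -> dt h dl = 0 by move=> nh dh; case: (two h nh dh) => ->.
(* The motion does not decrease the norm to first order and increases it to second order, so
   [v + t * dl] cannot be another maximiser. *)
have gt (t : R) : 0 < t -> g (v + t%:C * dl) < g v.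
  move=> t0; rewrite lt_neqAle vmax andbT; apply/eqP => /vtie; rewrite leNgt => /negP; apply.
  rewrite -(ltr_pXn2r (_ : (0 < 2)%N)) ?nnegrE ?nc_ge0 // nc_addsq.
  have -> : dt v (t%:C * dl) = t * dt v dl by rewrite /dt !ReImE /=; ring.
  have : 0 < nc (t%:C * dl) ^+ 2 by rewrite exprn_gt0 // nc_scale mulr_gt0 ?normr_gt0 ?gt_eqF // nc_gt0.
  have := mulr_ge0 (ltW t0) vdl; lra.
have [h [nh dh ht]] := near_cluster v dl.
have [rho rho0 iso] := isolated (@gap_disc v) vd nh dh.
have r0 : 0 < d v by exact: le_lt_trans (nc_ge0 v) vd.
have [s [s0 s1 sd]] := left_approx (@ltr01 R) (ltac:(by rewrite divr_gt0) : 0 < rho / d v).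
pose D := nc dl + 1; have D0 : 0 < D by rewrite ltr_wpDl ?nc_ge0.
(* Small enough for the disc around [v'] to contain 0 and the point [seg v h s], which it then
   shares with the disc around [v]. *)
pose tau := Num.min ((1 - s) * d v / (2 * D)) ((d v - nc v) / (2 * D)).
have tau0 : 0 < tau by rewrite lt_min !divr_gt0 ?mulr_gt0 ?subr_gt0.
have [t [t0 tt tn]] := ht _ _ rho0 tau0.
have [_ /(_ (gt t t0)) pos] := near_dir vmax dl t0.
move: tt; rewrite lt_min !ltr_pdivlMr ?mulr_gt0 // => /andP[t1 t2].
pose v' := v + t%:C * dl.
have vv : nc (v' - v) = t * nc dl.
  by rewrite (_ : v' - v = t%:C * dl) ?nc_scale ?gtr0_norm // /v'; ring.
have tD : t * nc dl <= t * D by rewrite ler_pM2l // /D lerDl.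
have dv' := gap_lip v v'; rewrite (ncC v v') vv in dv'.
have nv' : nc v' <= nc v + t * nc dl.
  by have := ncD (v' - v) v; rewrite subrK vv addrC.
have v'd : nc v' < d v' by lra.
have [nn _] := nearP v'.
have E' : near v' = h.
  apply: (iso v' (d v')) => //; first exact: gap_disc.
  exists (seg v h s); split.
  - rewrite /cball /= -{2}(seg0 v h) nc_segB subr0 ger0_norm // dh.
    by rewrite -[X in _ < X]mul1r ltr_pM2r.
  - rewrite /cball /=; have k := nc_tri v (seg v h s) v'; rewrite (ncC v v') vv in k.
    have k3 : nc (seg v h s - v) = s * d v by rewrite -{2}(seg0 v h) nc_segB subr0 ger0_norm // dh.
    lra.
  - by rewrite -{2}(seg1 v h) nc_segB dh -ltr_pdivlMr.
by move: pos; rewrite -/v' E' oH // ltxx.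
Qed.

End Delaunay.

(** * Fan triangulation of the points of a circle *)

Section Fan.
Variable R : realType.
Local Notation C := R[i].
Implicit Types (u v w y a b k P A B : C).

Definition opencone P A B y := exists s t : R, [/\ 0 < s, 0 < t & y = s%:C * (A - P) + t%:C * (B - P)].
Definition tri P A B : set C := [set w | exists s t : R, [/\ 0 <= s, 0 <= t, s + t <= 1 &
  w = P + s%:C * (A - P) + t%:C * (B - P)]].

Lemma dtC a b : dt a b = dt b a. Proof. by rewrite /dt; ring. Qed.
Lemma crN a b : cr a b = - cr b a. Proof. by rewrite /cr; ring. Qed.
Lemma dtDr a b k : dt a (b + k) = dt a b + dt a k. Proof. by rewrite /dt !ReImE; ring. Qed.
Lemma dtZr (s : R) a b : dt a (s%:C * b) = s * dt a b. Proof. by rewrite /dt !ReImE /=; ring. Qed.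
Lemma crDr a b k : cr a (b + k) = cr a b + cr a k. Proof. by rewrite /cr !ReImE; ring. Qed.
Lemma crDl a b k : cr (b + k) a = cr b a + cr k a. Proof. by rewrite /cr !ReImE; ring. Qed.
Lemma crZr (s : R) a b : cr a (s%:C * b) = s * cr a b. Proof. by rewrite /cr !ReImE /=; ring. Qed.
Lemma crZl (s : R) a b : cr (s%:C * a) b = s * cr a b. Proof. by rewrite /cr !ReImE /=; ring. Qed.
Lemma crv a : cr a a = 0. Proof. by rewrite /cr; ring. Qed.
Lemma crNr a b : cr a (- b) = - cr a b. Proof. by rewrite /cr !ReImE; ring. Qed.
Lemma dtNr a b : dt a (- b) = - dt a b. Proof. by rewrite /dt !ReImE; ring. Qed.
Lemma dtNl a b : dt (- a) b = - dt a b. Proof. by rewrite /dt !ReImE; ring. Qed.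

Lemma dt_basis a b w : cr a b != 0 -> dt a w = 0 -> dt b w = 0 -> w = 0.
Proof.
move=> c0 h1 h2; have [k1 k2] : cr a b * Re w = 0 /\ cr a b * Im w = 0.
  have -> : cr a b * Re w = Im b * dt a w - Im a * dt b w by rewrite /cr /dt; ring.
  have -> : cr a b * Im w = Re a * dt b w - Re b * dt a w by rewrite /cr /dt; ring.
  by rewrite h1 h2 !mulr0 subr0.
apply: C_eqP; apply/eqP; [move/eqP: k1|move/eqP: k2]; by rewrite mulf_eq0 (negbTE c0).
Qed.

Lemma cr_basis a b w : cr a b != 0 -> w = (cr w b / cr a b)%:C * a + (cr a w / cr a b)%:C * b.
Proof. by move=> c0; apply: C_eqP; rewrite !ReImE /=; move: c0; rewrite /cr => c0; field. Qed.

Lemma chord_dt P A : nc A = nc P -> nc (A - P) ^+ 2 = - 2 * dt P (A - P).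
Proof. by move=> h; rewrite nc_subsq h nc_sqr /dt !ReImE; ring. Qed.

Section Base.
Variables (r : R) (h0 : C).
Hypothesis r0 : 0 < r.
Hypothesis h0r : nc h0 = r.

(* The points of the circle other than [h0] are ordered by the slope of their
   chord to [h0]. *)
Definition slope (d : C) : R := cr h0 d / dt h0 d.

Let h0s : dt h0 h0 = r ^+ 2. Proof. by rewrite -nc_sqr h0r. Qed.
Let r2 : 0 < r ^+ 2. Proof. by rewrite exprn_gt0. Qed.

Lemma cr_slope d d' : dt h0 d != 0 -> dt h0 d' != 0 ->
  r ^+ 2 * cr d d' = dt h0 d * dt h0 d' * (slope d' - slope d).
Proof.
move=> n1 n2; have -> : r ^+ 2 * cr d d' = dt h0 d * cr h0 d' - cr h0 d * dt h0 d'.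
  by rewrite -h0s /dt /cr; ring.
by rewrite /slope; field; apply/andP.
Qed.

Lemma cr_slope_lt d d' : dt h0 d < 0 -> dt h0 d' < 0 -> (slope d < slope d') = (0 < cr d d').
Proof.
move=> n1 n2; rewrite -(pmulr_rgt0 _ r2) cr_slope ?lt_eqF // pmulr_rgt0 ?subr_gt0 //.
by rewrite nmulr_rgt0.
Qed.

Lemma cr_slope_le d d' : dt h0 d < 0 -> dt h0 d' < 0 -> (slope d <= slope d') = (0 <= cr d d').
Proof.
move=> n1 n2; rewrite -(pmulr_rge0 _ r2) cr_slope ?lt_eqF // pmulr_rge0 ?subr_ge0 //.
by rewrite nmulr_rgt0.
Qed.

Lemma circ_dt u : nc u = r -> u != h0 -> dt h0 (u - h0) < 0.
Proof.
move=> ur un; have := @chord_dt h0 u; rewrite ur h0r => /(_ erefl) h.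
have : 0 < nc (u - h0) ^+ 2 by rewrite exprn_gt0 // nc_gt0 subr_eq0.
lra.
Qed.

Lemma in_dt w : nc w < r -> dt h0 (w - h0) < 0.
Proof.
move=> wr; rewrite dtDr dtNr h0s; have := dt_le h0 w; rewrite h0r.
have : r * nc w < r * r by rewrite ltr_pM2l.
rewrite expr2; lra.
Qed.

(** The rational parametrisation of the circle by the slope of the chord from [h0]; cross products
    of chords become rational functions of slopes. *)
Lemma circ_E u : nc u = r -> u != h0 ->
  dt h0 (u - h0) = - 2 * r ^+ 2 / (1 + slope (u - h0) ^+ 2).
Proof.
move=> ur un; have n := circ_dt ur un; have h := @chord_dt h0 u.
rewrite ur h0r in h; have {}h := h erefl.
set d := u - h0 in n h *.
have e : r ^+ 2 * nc d ^+ 2 = dt h0 d ^+ 2 + cr h0 d ^+ 2 by rewrite nc_sqr -h0s /dt /cr; ring.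
have s0 : 1 + slope d ^+ 2 != 0 by rewrite gt_eqF // ltr_wpDr // sqr_ge0.
apply: (mulIf s0); rewrite divfK //.
have ce : cr h0 d = slope d * dt h0 d by rewrite /slope divfK // lt_eqF.
rewrite ce in e.
have n0 : dt h0 d != 0 by rewrite lt_eqF.
apply: (mulfI n0); rewrite h in e; move: e; rewrite exprMn => e.
have -> : dt h0 d * (dt h0 d * (1 + slope d ^+ 2)) = dt h0 d ^+ 2 + slope d ^+ 2 * dt h0 d ^+ 2 by ring.
by rewrite -e; ring.
Qed.

Lemma slope_inj u v : nc u = r -> nc v = r -> u != h0 -> v != h0 ->
  slope (u - h0) = slope (v - h0) -> u = v.
Proof.
move=> ur vr un vn e.
have d1 := circ_E ur un; have d2 := circ_E vr vn.
have c1 : cr h0 (u - h0) = slope (u - h0) * dt h0 (u - h0).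
  by rewrite /slope divfK // lt_eqF // circ_dt.
have c2 : cr h0 (v - h0) = slope (v - h0) * dt h0 (v - h0).
  by rewrite /slope divfK // lt_eqF // circ_dt.
apply/eqP; rewrite -subr_eq0; apply/eqP.
have e1 : dt h0 (u - v) = 0.
  have -> : u - v = (u - h0) - (v - h0) by ring.
  by rewrite dtDr dtNr d1 d2 e subrr.
have e2 : cr h0 (u - v) = 0.
  have -> : u - v = (u - h0) - (v - h0) by ring.
  by rewrite crDr crNr c1 c2 d1 d2 e subrr.
pose q : C := (- Im h0) +i* (Re h0).
apply: (@dt_basis h0 q) => //.
  by rewrite (_ : cr h0 q = r ^+ 2) ?gt_eqF // -h0s /cr /dt /q /=; ring.
by move: e2; rewrite /cr /dt /q /=; lra.
Qed.

(** In the slopes [x], [z], [t] of [a], [b], [k] the difference of the two sides is a positive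
    multiple of [(t - x) * (t - z)]: a point whose slope is not between the other two is on the same
    side of the chord [a b] as [h0]. *)
Lemma fan_side a b k : nc a = r -> nc b = r -> nc k = r -> a != h0 -> b != h0 -> k != h0 ->
  slope (a - h0) < slope (b - h0) -> ~ (slope (a - h0) < slope (k - h0) /\ slope (k - h0) < slope (b - h0)) ->
  cr (k - h0) (b - a) <= cr (a - h0) (b - h0).
Proof.
move=> ar br kr an bn kn ab nb.
have -> : b - a = (b - h0) + - (a - h0) by ring.
rewrite crDr crNr -(ler_pM2l r2) mulrDr mulrN.
rewrite !cr_slope ?lt_eqF ?circ_dt // !circ_E //.
set x := slope (a - h0) in ab nb *; set z := slope (b - h0) in ab nb *; set t := slope (k - h0) in nb *.
have X0 : 0 < 1 + x ^+ 2 by rewrite ltr_wpDr // sqr_ge0.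
have Z0 : 0 < 1 + z ^+ 2 by rewrite ltr_wpDr // sqr_ge0.
have T0 : 0 < 1 + t ^+ 2 by rewrite ltr_wpDr // sqr_ge0.
rewrite -subr_ge0.
have -> : - 2 * r ^+ 2 / (1 + x ^+ 2) * (- 2 * r ^+ 2 / (1 + z ^+ 2)) * (z - x) -
  (- 2 * r ^+ 2 / (1 + t ^+ 2) * (- 2 * r ^+ 2 / (1 + z ^+ 2)) * (z - t) -
   - 2 * r ^+ 2 / (1 + t ^+ 2) * (- 2 * r ^+ 2 / (1 + x ^+ 2)) * (x - t)) =
  (4 * r ^+ 4 * (z - x) / ((1 + x ^+ 2) * (1 + z ^+ 2) * (1 + t ^+ 2))) * ((t - x) * (t - z)).
  by field; rewrite !gt_eqF.
apply: mulr_ge0.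
  by rewrite divr_ge0 ?mulr_ge0 ?exprn_ge0 ?subr_ge0 // ?ltW.
have [h|h] := leP t x; first by rewrite mulr_le0 // subr_le0 // (le_trans h) // ltW.
have [h'|h'] := leP z t; first by rewrite mulr_ge0 // subr_ge0 // ltW.
by case: nb.
Qed.

Variable H : seq C.
Hypothesis Hr : forall k, k \in H -> nc k = r.
Hypothesis h0H : h0 \in H.

(** The pairs consecutive in the slope order, described without sorting [H]; the triangle meant is
    the one with corners [h0], [a], [b]. *)
Definition fan a b := [/\ a \in H /\ b \in H, a != h0 /\ b != h0, slope (a - h0) < slope (b - h0) &
  forall k, k \in H -> k != h0 -> ~ (slope (a - h0) < slope (k - h0) /\ slope (k - h0) < slope (b - h0))].

Lemma seq_argmax (I : eqType) (s : seq I) (Q : I -> Prop) (g : I -> R) : (exists2 i, i \in s & Q i) ->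
  exists i, [/\ i \in s, Q i & forall j, j \in s -> Q j -> g j <= g i].
Proof.
elim: s => [[ i ]|x s IH [ i ]]; first by rewrite in_nil.
rewrite inE => /predU1P[->|si] Qi.
  have [h|h] := pselect (exists2 i, i \in s & Q i); last first.
    exists x; split; rewrite ?mem_head // => j; rewrite inE => /predU1P[-> // | js Qj].
    by case: h; exists j.
  have [m [ms Qm mmax]] := IH h.
  have [le|lt] := leP (g m) (g x).
    exists x; split; rewrite ?mem_head // => j; rewrite inE => /predU1P[-> // | js Qj].
    exact: le_trans (mmax j js Qj) le.
  exists m; split => //; first by rewrite inE ms orbT.
  by move=> j; rewrite inE => /predU1P[-> _|js Qj]; [exact: ltW|exact: mmax].
have [m [ms Qm mmax]] := IH (ex_intro2 _ _ i si Qi).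
have [[le Qx]|h] := pselect (g m <= g x /\ Q x).
  exists x; split; rewrite ?mem_head // => j; rewrite inE => /predU1P[-> // | js Qj].
  exact: le_trans (mmax j js Qj) le.
exists m; split => //; first by rewrite inE ms orbT.
move=> j; rewrite inE => /predU1P[-> Qx|js Qj]; last exact: mmax.
by rewrite leNgt; apply/negP => lt; apply: h; split => //; exact: ltW.
Qed.

Lemma seq_tilt (I : eqType) (s : seq I) (f g : I -> R) : (forall i, i \in s -> f i < 0) ->
  exists2 e : R, 0 < e & forall i, i \in s -> f i + e * g i < 0.
Proof.
elim: s => [_|x s IH h]; first by exists 1.
have [e1 e10 h1] := IH (fun i si => h i (mem_behead (s := x :: s) si)).
have fx := h x (mem_head _ _).
pose K := `|g x| + 1; have K0 : 0 < K by rewrite ltr_wpDl.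
exists (Num.min e1 (- f x / (2 * K))); first by rewrite lt_min e10 divr_gt0 ?oppr_gt0 // mulr_gt0.
set e := Num.min _ _.
have e0 : 0 < e by rewrite lt_min e10 divr_gt0 ?oppr_gt0 // mulr_gt0.
have ee1 : e <= e1 by rewrite ge_min lexx.
have ef : e <= - f x / (2 * K) by rewrite ge_min lexx orbT.
move=> i; rewrite inE => /predU1P[->|si].
  have : e * g x <= e * K.
    by rewrite ler_pM2l // /K (le_trans (ler_norm _)) // lerDl.
  move: ef; rewrite ler_pdivlMr ?mulr_gt0 //; lra.
have fi := h i (mem_behead (s := x :: s) si); have gi := h1 i si.
have [gp|gn] := leP (g i) 0.
  have : e * g i <= 0 by rewrite pmulr_rle0.
  lra.
have : e * g i <= e1 * g i by rewrite ler_pM2r.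
lra.
Qed.

(** The hypothesis on all [dl] is the dual form of [w] being in the convex hull of [H]. It puts the
    slope of [w - h0] between two consecutive slopes, and, applied to the normal of the chord [a b],
    puts [w] on the side of [h0]. *)
Lemma fan_cover w : nc w < r -> (forall dl, exists2 k, k \in H & 0 <= dt (k - w) dl) ->
  (exists a b, [/\ a \in H, b \in H, a != h0, b != h0 & a != b]) ->
  exists a b, fan a b /\ tri h0 a b w.
Proof.
move=> wr hull [p [q [pH qH pn qn pq]]].
have dw := in_dt wr; set d := w - h0 in dw.
have sd k : k \in H -> k != h0 -> dt h0 (k - h0) < 0 by move=> kH kn; apply: circ_dt => //; exact: Hr.
have wh0 : 0 < dt d d.
  rewrite -nc_sqr exprn_gt0 // nc_gt0; apply/eqP => e; move: dw; rewrite e.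
  by rewrite (_ : dt h0 0 = 0) ?ltxx // /dt /=; ring.
pose J : C := (- Im d) +i* (Re d).
have dtJ z : dt z J = cr d z by rewrite /dt /cr /J /=; ring.
(* If all chords from [h0] were strictly on one side of the line through [h0] and [w], its normal
   would separate [w] from all of [H] but [h0], which is on the line; tilting the normal by [t * d]
   separates [h0] too. *)
have side (e : R) : e = 1 \/ e = -1 ->
    ~ (forall k, k \in H -> k != h0 -> 0 < e * cr d (k - h0)).
  move=> ee hk.
  have hk' k : k \in [seq k <- H | k != h0] -> - (e * cr d (k - h0)) < 0.
    by rewrite mem_filter => /andP[kn kH]; rewrite oppr_lt0; exact: hk.
  have [t t0 ht] := seq_tilt (fun k => dt (k - w) d) hk'.
  have [k kH] := hull ((- e)%:C * J + t%:C * d).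
  rewrite dtDr !dtZr dtJ.
  have -> : cr d (k - w) = cr d (k - h0).
    by rewrite (_ : k - w = (k - h0) - d) ?crDr ?crNr ?crv ?subr0 // /d; ring.
  have [->|kn] := eqVneq k h0.
    rewrite subrr (_ : cr d 0 = 0) ?mulr0 ?add0r; last by rewrite /cr /=; ring.
    rewrite (_ : h0 - w = - d) ?dtNl; last by rewrite /d; ring.
    by rewrite leNgt mulrN oppr_lt0 mulr_gt0.
  have := ht k; rewrite mem_filter kn kH => /(_ isT); rewrite mulNr leNgt => -> .
  by [].
have [m0 [m0H m0n m0s]] : exists m, [/\ m \in H, m != h0 & slope (m - h0) <= slope d].
  apply: contrapT => no; apply: (side 1 (or_introl erefl)) => k kH kn.
  rewrite mul1r -cr_slope_lt //; last exact: sd.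
  by rewrite ltNge; apply/negP => h; apply: no; exists k.
have [m1 [m1H m1n m1s]] : exists m, [/\ m \in H, m != h0 & slope d <= slope (m - h0)].
  apply: contrapT => no; apply: (side (-1) (or_intror erefl)) => k kH kn.
  rewrite mulN1r -crN -cr_slope_lt //; last exact: sd.
  by rewrite ltNge; apply/negP => h; apply: no; exists k.
have [m [mH [mn ms] mmax]] := @seq_argmax _ H (fun k => k != h0 /\ slope (k - h0) <= slope d)
   (fun k => slope (k - h0)) (ex_intro2 _ _ m0 m0H (conj m0n m0s)).
have [a [b [fab h1 h2]]] : exists a b, [/\ fan a b, slope (a - h0) <= slope d & slope d <= slope (b - h0)].
  have [[k kH [kn ks]]|no] := pselect (exists2 k, k \in H & k != h0 /\ slope (m - h0) < slope (k - h0)).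
    have [n [nH [nn ns] nmin]] := @seq_argmax _ H (fun k => k != h0 /\ slope (m - h0) < slope (k - h0))
      (fun k => - slope (k - h0)) (ex_intro2 _ _ k kH (conj kn ks)).
    exists m, n; split => //.
      split => // k' k'H k'n [k1 k2].
      by have := nmin k' k'H (conj k'n k1); rewrite lerN2 leNgt k2.
    rewrite leNgt; apply/negP => lt.
    by have := mmax n nH (conj nn (ltW lt)); rewrite leNgt ns.
  (* Here no slope exceeds that of [m], so [w] is on the line of the last chord; the pair then ends
     at [m]. *)
  have mm1 : slope (m1 - h0) <= slope (m - h0).
    by rewrite leNgt; apply/negP => lt; apply: no; exists m1.
  have sm : slope (m - h0) = slope d by apply/eqP; rewrite eq_le ms (le_trans m1s).
  have lower k : k \in H -> k != h0 -> k != m -> slope (k - h0) < slope (m - h0).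
    move=> kH kn km; rewrite lt_neqAle; apply/andP; split.
      by apply: contra km => /eqP/slope_inj -> //; exact: Hr.
    by rewrite leNgt; apply/negP => lt; apply: no; exists k.
  have [k [kH kn km]] : exists k, [/\ k \in H, k != h0 & k != m].
    by have [e|e] := eqVneq p m; [exists q; split => //; rewrite -e eq_sym|exists p].
  have [n [nH [nn nm] nmax]] := @seq_argmax _ H (fun k => k != h0 /\ k != m)
     (fun k => slope (k - h0)) (ex_intro2 _ _ k kH (conj kn km)).
  exists n, m; split; last by rewrite sm.
    split => //; first exact: lower.
    move=> k' k'H k'n [k1 k2].
    have [e|e] := eqVneq k' m; first by move: k2; rewrite e ltxx.
    by have := nmax k' k'H (conj k'n e); rewrite leNgt k1.
  by rewrite -sm ltW // lower.
exists a, b; split => //.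
have [[aH bH] [an bn] ab nb] := fab.
have sda := sd a aH an; have sdb := sd b bH bn.
have K0 : 0 < cr (a - h0) (b - h0) by rewrite -cr_slope_lt.
have Kn : cr (a - h0) (b - h0) != 0 by rewrite gt_eqF.
exists (cr d (b - h0) / cr (a - h0) (b - h0)), (cr (a - h0) d / cr (a - h0) (b - h0)); split.
- by rewrite divr_ge0 ?(ltW K0) // -cr_slope_le.
- by rewrite divr_ge0 ?(ltW K0) // -cr_slope_le.
- rewrite -mulrDl ler_pdivrMr // mul1r.
  have e1 : cr d (b - h0) + cr (a - h0) d = cr d (b - a).
    by rewrite (crN (a - h0)) -crNr -crDr; congr (cr d _); ring.
  rewrite e1 leNgt; apply/negP => lt.
  (* The normal of the chord [a b] pointing away from [h0]: its scalar product with [z] is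
     [cr z (b - a)]. *)
  pose dl : C := (Im (b - a)) +i* (- Re (b - a)).
  have [k kH] := hull dl.
  have -> : dt (k - w) dl = cr (k - h0) (b - a) - cr d (b - a).
    have dE z e : dt z ((Im e) +i* (- Re e)) = cr z e by rewrite /dt /cr /=; ring.
    by rewrite dE /cr /d !ReImE; ring.
  have [->|kn] := eqVneq k h0.
    by rewrite subrr (_ : cr 0 (b - a) = 0); [lra|rewrite /cr /=; ring].
  have := @fan_side a b k (Hr aH) (Hr bH) (Hr kH) an bn kn ab (nb k kH kn).
  lra.
- by rewrite -addrA -(cr_basis d Kn) addrC subrK.
Qed.

Lemma fan_cr a b : fan a b -> 0 < cr (a - h0) (b - h0).
Proof.
case=> [[aH bH] [an bn] ab nb]; rewrite -cr_slope_lt //; apply: circ_dt => //; exact: Hr.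
Qed.

Lemma fan_next a b b' : fan a b -> fan a b' -> b = b'.
Proof.
case=> [[aH bH] [an bn] ab nb] [[_ b'H] [_ b'n] ab' nb'].
apply: slope_inj => //; try exact: Hr.
apply/eqP; rewrite eq_le !leNgt; apply/andP; split; apply/negP => lt.
  exact: (nb b').
exact: (nb' b).
Qed.

Lemma fan_prev a a' b : fan a b -> fan a' b -> a = a'.
Proof.
case=> [[aH bH] [an bn] ab nb] [[a'H _] [a'n _] ab' nb'].
apply: slope_inj => //; try exact: Hr.
apply/eqP; rewrite eq_le !leNgt; apply/andP; split; apply/negP => lt.
  exact: (nb' a).
exact: (nb a').
Qed.

Lemma fan_base a b y : fan a b -> opencone h0 a b y ->
  [/\ dt h0 y < 0, slope (a - h0) < slope y & slope y < slope (b - h0)].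
Proof.
move=> fab [s [t [s0 t0 ->]]]; have c0 := fan_cr fab.
case: fab => [[aH bH] [an bn] ab nb].
have da : dt h0 (a - h0) < 0 by apply: circ_dt => //; exact: Hr.
have db : dt h0 (b - h0) < 0 by apply: circ_dt => //; exact: Hr.
have dy : dt h0 (s%:C * (a - h0) + t%:C * (b - h0)) < 0.
  rewrite dtDr !dtZr.
  have e1 : s * dt h0 (a - h0) < 0 by rewrite pmulr_rlt0.
  have e2 : t * dt h0 (b - h0) < 0 by rewrite pmulr_rlt0.
  lra.
split => //; rewrite cr_slope_lt //.
  by rewrite crDr !crZr crv mulr0 add0r mulr_gt0.
by rewrite crDl !crZl crv mulr0 addr0 mulr_gt0.
Qed.

Lemma fan_overlap0 a b a' b' y : fan a b -> fan a' b' -> opencone h0 a b y -> opencone h0 a' b' y ->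
  a = a' /\ b = b'.
Proof.
move=> f1 f2 /(fan_base f1)[dy y1 y2] /(fan_base f2)[_ y1' y2'].
have E : a = a'.
  case: (f1) => [[aH bH] [an bn] ab nb]; case: (f2) => [[a'H b'H] [a'n b'n] ab' nb'].
  apply: slope_inj => //; try exact: Hr.
  apply/eqP; rewrite eq_le !leNgt; apply/andP; split; apply/negP => lt.
    by apply: (nb' a) => //; split => //; exact: lt_trans y1 y2'.
  by apply: (nb a') => //; split => //; exact: lt_trans y1' y2.
by split => //; rewrite -E in f2; exact: fan_next f1 f2.
Qed.

Lemma fan_overlap1 a b a' y : fan a b -> fan a' a -> opencone a b h0 y -> opencone a h0 a' y -> False.
Proof.
move=> f1 f2 [s [t [s0 t0 E]]] [s' [t' [s'0 t'0 E']]].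
have c1 := fan_cr f1; have c2 := fan_cr f2.
have k1 : cr (a - h0) y = s * cr (a - h0) (b - h0).
  by rewrite E /cr !ReImE; ring.
have k2 : cr (a - h0) y = - (t' * cr (a' - h0) (a - h0)).
  by rewrite E' /cr !ReImE; ring.
have : 0 < s * cr (a - h0) (b - h0) by rewrite mulr_gt0.
have : 0 < t' * cr (a' - h0) (a - h0) by rewrite mulr_gt0.
lra.
Qed.

(** The cyclic rotations of [h0], [a], [b], so that the orientation is positive at each corner. *)
Definition corner a b P A B := [\/ [/\ P = h0, A = a & B = b], [/\ P = a, A = b & B = h0] |
  [/\ P = b, A = h0 & B = a]].

Lemma corner_mem a b P A B : fan a b -> corner a b P A B -> [/\ P \in H, A \in H & B \in H].
Proof. by case=> [[aH bH] _ _ _] [[-> -> ->]|[-> -> ->]|[-> -> ->]]. Qed.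

Lemma corner_cr a b P A B : fan a b -> corner a b P A B -> 0 < cr (A - P) (B - P).
Proof.
move=> /fan_cr c0 [[-> -> ->]|[-> -> ->]|[-> -> ->]] //.
  by rewrite (_ : cr _ _ = cr (a - h0) (b - h0)) // /cr !ReImE; ring.
by rewrite (_ : cr _ _ = cr (a - h0) (b - h0)) // /cr !ReImE; ring.
Qed.

(** At [h0] the cones of distinct pairs are separated by slopes; at another point [P] at most two
    triangles of the fan meet, on opposite sides of the chord from [h0] to [P]. *)
Lemma fan_overlap a b a' b' P A B A' B' y : fan a b -> fan a' b' -> corner a b P A B -> corner a' b' P A' B' ->
  opencone P A B y -> opencone P A' B' y -> a = a' /\ b = b'.
Proof.
move=> f1 f2; have [_ [an bn] _ _] := f1; have [_ [a'n b'n] _ _] := f2.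
case=> [[-> -> ->]|[-> -> ->]|[-> -> ->]].
- case=> [[_ -> ->]|[e]|[e]]; first exact: fan_overlap0.
    by move: a'n; rewrite -e eqxx.
  by move: b'n; rewrite -e eqxx.
- case=> [[e]|[e _ _ _ _]|[e -> ->]]; first by move: an; rewrite e eqxx.
    by split => //; rewrite -e in f2; exact: fan_next f1 f2.
  by rewrite -e in f2 *; move=> o1 o2; case: (fan_overlap1 f1 f2 o1 o2).
- case=> [[e]|[e -> ->]|[e _ _ _ _]]; first by move: bn; rewrite e eqxx.
    by rewrite e in f1 *; move=> o1 o2; case: (fan_overlap1 f2 f1 o2 o1).
  by split => //; rewrite -e in f2; exact: fan_prev f1 f2.
Qed.

(** The cones at the three corners and their opposites, moved to one origin, are the six sectors cut
    out by the directions of the sides. The signs of the coordinates [al], [be] and of their sum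
    tell the sector of [y]. *)
Lemma generic_corner a b y : fan a b -> cr y (a - h0) != 0 -> cr y (b - h0) != 0 -> cr y (b - a) != 0 ->
  exists P A B, exists s : bool, corner a b P A B /\ opencone P A B (if s then y else - y).
Proof.
move=> f1 n1 n2 n3; have c0 := fan_cr f1.
have cn : cr (a - h0) (b - h0) != 0 by rewrite gt_eqF.
pose al := cr y (b - h0) / cr (a - h0) (b - h0).
pose be := cr (a - h0) y / cr (a - h0) (b - h0).
have E : y = al%:C * (a - h0) + be%:C * (b - h0) by exact: cr_basis.
have a0 : al != 0 by rewrite mulf_neq0 // invr_eq0.
have b0 : be != 0 by rewrite mulf_neq0 ?invr_eq0 // crN oppr_eq0.
have s0 : al + be != 0.
  rewrite -mulrDl mulf_neq0 ?invr_eq0 // (_ : _ + _ = cr y (b - a)) //.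
  by rewrite (crN (a - h0)) -crNr -crDr; congr cr; ring.
have E1 : y = (- (al + be))%:C * (h0 - a) + be%:C * (b - a) by rewrite E rmorphN rmorphD /=; ring.
have E2 : y = (- (al + be))%:C * (h0 - b) + al%:C * (a - b) by rewrite E rmorphN rmorphD /=; ring.
have [ap|an|/eqP] := ltgtP al 0; last by rewrite (negbTE a0).
  have [bp|bn|/eqP] := ltgtP be 0; last by rewrite (negbTE b0).
    exists h0, a, b, false; split; first by constructor 1.
    by exists (- al), (- be); rewrite !oppr_gt0; split => //; rewrite E !rmorphN /=; ring.
  have [sp|sn|/eqP] := ltgtP (al + be) 0; last by rewrite (negbTE s0).
    exists a, b, h0, true; split; first by constructor 2.
    by exists be, (- (al + be)); rewrite oppr_gt0; split => //; rewrite {1}E1; ring.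
  exists b, h0, a, false; split; first by constructor 3.
  by exists (al + be), (- al); rewrite oppr_gt0; split => //; rewrite {1}E2 !rmorphN /=; ring.
have [bp|bn|/eqP] := ltgtP be 0; last by rewrite (negbTE b0).
  have [sp|sn|/eqP] := ltgtP (al + be) 0; last by rewrite (negbTE s0).
    exists b, h0, a, true; split; first by constructor 3.
    by exists (- (al + be)), al; rewrite oppr_gt0.
  exists a, b, h0, false; split; first by constructor 2.
  by exists (- be), (al + be); rewrite oppr_gt0; split => //; rewrite {1}E1 !rmorphN /=; ring.
exists h0, a, b, true; split; first by constructor 1.
by exists al, be.
Qed.

End Base.
End Fan.

(** * Generic directions and common bounds *)

Section Generic.
Variable R : realType.
Local Notation C := R[i].

(** A direction steeper than every non-vertical element of the list, but not vertical itself. *)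
Lemma generic_dir (s : seq C) : (forall e, e \in s -> e != 0) -> exists y : C, y != 0 /\ forall e, e \in s -> cr y e != 0.
Proof.
move=> hs; pose t : R := 1 + \sum_(e <- s) `|Im e / Re e|.
exists (1 +i* t); split; first by rewrite eq_complex /= oner_eq0.
move=> e es; have e0 := hs e es; rewrite /cr /= mul1r subr_eq0; apply/eqP => E.
have [r0|r0] := eqVneq (Re e) 0.
  by move: e0; rewrite eq_complex /= E r0 mulr0 !eqxx.
have te : t = Im e / Re e by rewrite E mulfK.
have : `|Im e / Re e| <= \sum_(e <- s) `|Im e / Re e|.
  rewrite (big_rem e es) /= lerDl; apply: sumr_ge0 => *; exact: normr_ge0.
have := ler_norm (Im e / Re e); rewrite -te {1}/t; lra.
Qed.

Lemma common_eps (N : nat) (Q : 'I_N -> R -> Prop) :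
  (forall i, exists2 e : R, 0 < e & forall x, 0 < x -> x < e -> Q i x) -> exists2 x : R, 0 < x & forall i, Q i x.
Proof.
move=> h.
have h' i : exists e : R, 0 < e /\ forall x, 0 < x -> x < e -> Q i x.
  by have [e e0 he] := h i; exists e.
have [e he] := choice h'.
pose S := 1 + \sum_(i < N) (e i)^-1.
have S0 : 0 < S.
  by rewrite ltr_pwDl // sumr_ge0 // => i _; rewrite invr_ge0 ltW //; case: (he i).
exists S^-1; first by rewrite invr_gt0.
move=> i; have [ei0 hi] := he i; apply: hi; first by rewrite invr_gt0.
rewrite -[X in _ < X]invrK ltf_pV2 ?posrE ?invr_gt0 //.
rewrite /S (bigD1 i) //= ltr_pwDl // lerDl sumr_ge0 // => j _.
by rewrite invr_ge0 ltW //; case: (he j).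
Qed.

End Generic.

(** * Counting the triangles *)

Section Counting.
Variables (R : realType) (T : translationSurface R).
Local Notation C := R[i].
Local Notation sing := (singularities T).
Variables (cU : T -> set T) (cF : T -> T -> C) (cm : T -> R).
Hypothesis cones : forall p, sing p -> conebox p (cU p) (cF p) (cm p).
Implicit Types (c : T) (h k v w z P A B : C).

(** The points where the largest immersed disc centred at [c] reaches zeros, in the development at
    [c]: when there are at least three, the corners of the Delaunay polygon of [c]. *)
Definition hits c : set C := [set h | ~ expdom c h /\ forall h', ~ expdom c h' -> nc h <= nc h'].

Lemma hits_disc c h : hits c h -> cball 0 (nc h) `<=` expdom c.
Proof.
move=> [h1 h2] z; rewrite /cball /= subr0 => zh; apply: contrapT => nz.
by have := h2 z nz; rewrite leNgt zh.
Qed.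

Lemma hits_same c h h' : hits c h -> hits c h' -> nc h = nc h'.
Proof. by move=> [h1 h2] [h3 h4]; apply/eqP; rewrite eq_le h2 // h4. Qed.

Lemma hits_gt0 c h : ~ sing c -> hits c h -> 0 < nc h.
Proof.
move=> ns [h1 _]; rewrite nc_gt0; apply/eqP => E; apply: h1; rewrite E.
by case: (exp0 ns).
Qed.

Lemma hits_hit c h : ~ sing c -> hits c h -> exists p, hit cU cF (expmap c) (cball 0 (nc h)) h p.
Proof.
move=> ns hh; apply: (hit_ex cones) => //; first exact: hits_disc.
- by rewrite nc0; exact: hits_gt0 hh.
- by rewrite subr0.
- by case: hh.
Qed.

Lemma ball_adherent v (r : R) h : 0 < r -> nc (h - v) = r -> adherent (cball v r) h.
Proof.
move=> r0 hr e e0.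
have er : 0 < e / r by rewrite divr_gt0.
have [s [s0 s1 sd]] := left_approx (@ltr01 R) er.
exists (seg v h s).
  by rewrite /cball /= -{2}(seg0 v h) nc_segB subr0 ger0_norm // hr -[X in _ < X]mul1r ltr_pM2r.
by rewrite -{2}(seg1 v h) nc_segB hr -ltr_pdivlMr.
Qed.

Lemma exp_isolated x v (r : R) h : ~ sing x -> cball v r `<=` expdom x -> nc v < r -> ~ expdom x h -> nc (h - v) = r ->
  exists2 rho : R, 0 < rho & forall v' (r' : R) h', cball v' r' `<=` expdom x -> nc v' < r' -> ~ expdom x h' ->
    nc (h' - v') = r' -> (exists z, [/\ cball v r z, cball v' r' z & nc (z - h) < rho]) ->
    nc (h' - h) < rho -> h' = h.
Proof.
move=> nsx sub vr nh hr; have [p hp] := hit_ex cones sub nsx vr hr nh.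
have [rho rho0 hrho] := hit_discrete cones hp; exists rho => // v' r' h' sub' vr' nh' hr' hz hh.
have [p' hp'] := hit_ex cones sub' nsx vr' hr' nh'.
apply: (hrho (cball v' r') h' p') => //; [exact: cball_oset|exact: cball_cvx| |].
- by move=> z /sub'; exact: exp_imm.
- by apply: ball_adherent => //; exact: le_lt_trans (nc_ge0 v') vr'.
Qed.

(** The set is compact, being the part of the closed complement of [expdom c] in a closed disc, and
    [exp_isolated] makes it discrete. *)
Lemma hits_fin c h : ~ sing c -> hits c h -> exists hs : seq C, forall k, hits c k <-> k \in hs.
Proof.
move=> ns hh; have r0 := hits_gt0 ns hh; set r := nc h in r0.
have hr k : hits c k -> nc k = r by move=> hk; exact: hits_same hk hh.
have sub0 : cball 0 r `<=` expdom c by exact: hits_disc hh.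
have z0 : nc (0 : C) < r by rewrite nc0.
have kr k : hits c k -> nc (k - 0) = r by move=> hk; rewrite subr0; exact: hr.
have iso k : exists rho : R, hits c k -> 0 < rho /\ forall k', hits c k' -> nc (k' - k) < rho -> k' = k.
  have [hk|nk] := pselect (hits c k); last by exists 0.
  have [rho rho0 hrho] := exp_isolated ns sub0 z0 (proj1 hk) (kr k hk).
  exists rho => _; split => // k' hk'; apply: (hrho 0 r k' sub0 z0 (proj1 hk') (kr k' hk')).
  by have [z z1 z2] := ball_adherent r0 (kr k hk) rho0; exists z.
have [rho hrho] := choice iso.
have cK : compact (hits c).
  have -> : hits c = [set k : C | nc (k - 0) <= r] `&` ~` expdom c.
    apply/seteqP; split => k.
      by move=> hk; split; [rewrite /= subr0 (hr k hk)|case: hk].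
    rewrite /= subr0 => -[k1 k2]; split => // k' nk'.
    by apply: (le_trans k1); case: hh => _; apply.
  apply: compact_closedI; first exact: compact_disc.
  by rewrite closedC; apply/openCP; exact: exp_oset.
move: cK; rewrite compact_cover => /(_ _ (hits c) (fun k => [set z | nc (z - k) < rho k])) cov.
have [||D sD cD] := cov.
- by move=> k hk; apply/openCP; exact: (@oset_ball R k (rho k)).
- by move=> k hk; exists k => //=; rewrite subrr nc0; case: (hrho k hk).
exists [seq k <- finmap.enum_fset D | `[< hits c k >]] => k; rewrite mem_filter; split.
  move=> hk; have [k' k'D] := cD k hk => /= kk.
  have hk' : hits c k' by have := sD _ k'D; rewrite inE.
  have [_ h2] := hrho k' hk'; rewrite (h2 k hk kk).
  by apply/andP; split => //; apply/asboolP.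
by move=> /andP[/asboolP].
Qed.

(** The chosen list and its head [hbase] depend on [c] only, so any two triangles with the same
    centre belong to one fan and can be compared. *)
Definition hseq c : seq C := xget [::] [set hs : seq C | forall k, hits c k <-> k \in hs].
Definition hbase c : C := head 0 (hseq c).

Lemma hseqP c h : ~ sing c -> hits c h -> (forall k, hits c k <-> k \in hseq c) /\ hbase c \in hseq c.
Proof.
move=> ns hh; have [hs hhs] := hits_fin ns hh.
have H : forall k, hits c k <-> k \in hseq c by rewrite /hseq; case: xgetP => [s _ //|/(_ hs)].
split => //; rewrite /hbase; have := (proj1 (H h)) hh.
by case: (hseq c) => [|a s] //= _; rewrite mem_head.
Qed.

(** A triangle is recorded by the centre of its circle, a point of the surface, and by its corners
    [a] and [b] in the development at that centre; the third corner is [hbase c]. *)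
Definition fanT (t : T * C * C) : Prop := let: (c, a, b) := t in
  [/\ ~ sing c, hits c (hbase c) & fan (hbase c) (hseq c) a b].

Lemma fanTP c a b : fanT (c, a, b) -> [/\ 0 < nc (hbase c), forall k, k \in hseq c -> nc k = nc (hbase c),
   hbase c \in hseq c & forall k, hits c k <-> k \in hseq c].
Proof.
move=> [ns hh _]; have [H1 H2] := hseqP ns hh; split => //; first exact: hits_gt0 hh.
by move=> k /H1 hk; exact: hits_same hk hh.
Qed.

Lemma opencone_in P A B (y : C) : nc A = nc P -> nc B = nc P -> A != P -> B != P -> opencone P A B y -> dt P y < 0.
Proof.
move=> hA hB nA nB [s [t [s0 t0 ->]]].
have h (D : C) : nc D = nc P -> D != P -> dt P (D - P) < 0.
  move=> hD nD; have := chord_dt hD.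
  have : 0 < nc (D - P) ^+ 2 by rewrite exprn_gt0 // nc_gt0 subr_eq0.
  lra.
rewrite dtDr !dtZr.
have e1 : s * dt P (A - P) < 0 by rewrite pmulr_rlt0 // h.
have e2 : t * dt P (B - P) < 0 by rewrite pmulr_rlt0 // h.
lra.
Qed.

Lemma step_in P (y : C) : dt P y < 0 -> exists2 e : R, 0 < e & forall x, 0 < x -> x < e -> cball 0 (nc P) (P + x%:C * y).
Proof.
move=> h; pose K := nc y ^+ 2 + 1; have K0 : 0 < K by rewrite ltr_wpDl // sqr_ge0.
exists (- dt P y / K); first by rewrite divr_gt0 // oppr_gt0.
move=> x x0; rewrite ltr_pdivlMr // => xe; rewrite /cball /= subr0.
rewrite -(ltr_pXn2r (_ : (0 < 2)%N)) ?nnegrE ?nc_ge0 // nc_addsq nc_scale exprMn dtZr gtr0_norm //.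
have e1 : x * (x * nc y ^+ 2) <= x * (- dt P y).
  by rewrite ler_pM2l //; apply: le_trans (ltW xe); rewrite ler_pM2l // /K lerDl.
have e2 : 0 < x * (- dt P y) by rewrite mulr_gt0 // oppr_gt0.
lra.
Qed.

Lemma hit_shift (phi : C -> T) (D : set C) h (p : T) (a : C) : hit cU cF phi D h p ->
  hit cU cF (fun z => phi (z + a)) [set z | D (z + a)] (h - a) p.
Proof.
move=> [sp [e e0 he]]; split => //; exists e => // z Dz zh.
have [|k1 k2] := he (z + a) Dz; first by rewrite (_ : z + a - h = z - (h - a)) //; ring.
by split => //; rewrite k2; ring.
Qed.

(* Neither of two overlapping discs contains a zero hit by the other one, so
   [P'] is separated from the hits of [c] by the radical axis. *)
Lemma lens_sep c c' P P' A (y : C) : ~ sing c -> ~ sing c' -> hits c P -> hits c A -> hits c' P' ->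
  cball 0 (nc P) (P + y) -> cball 0 (nc P') (P' + y) -> expmap c (P + y) = expmap c' (P' + y) ->
  0 <= dt (A - P) (P' - P).
Proof.
move=> ns ns' hP hA hP' y1 y2 E.
have nA : nc A = nc P by exact: hits_same hA hP.
have nP0 := hits_gt0 ns hP; have nP'0 := hits_gt0 ns' hP'.
suff k : nc P' <= nc (A - P + P').
  have k2 : nc P' ^+ 2 <= nc (A - P + P') ^+ 2 by rewrite lerXn2r ?nnegrE ?nc_ge0.
  have k3 := chord_dt nA; rewrite nc_addsq in k2.
  rewrite dtDr dtNr (dtC _ P); lra.
rewrite leNgt; apply/negP => lt.
pose D : set C := [set z | cball 0 (nc P) (z + P)].
pose D' : set C := [set z | cball 0 (nc P') (z + P')].
have DE (Q : C) : [set z | cball 0 (nc Q) (z + Q)] = cball (- Q) (nc Q).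
  by apply/seteqP; split => z; rewrite /cball /= subr0 opprK.
have oD : oset D by rewrite /D DE; exact: cball_oset.
have oD' : oset D' by rewrite /D' DE; exact: cball_oset.
have cD : cvx D by rewrite /D DE; exact: cball_cvx.
have cD' : cvx D' by rewrite /D' DE; exact: cball_cvx.
have iD : imm D (fun z => expmap c (z + P)).
  by move=> z Dz; apply: imm_at_shift; apply: exp_imm; exact: (hits_disc hP).
have iD' : imm D' (fun z => expmap c' (z + P')).
  by move=> z Dz; apply: imm_at_shift; apply: exp_imm; exact: (hits_disc hP').
have Dy : D y by rewrite /D /= addrC.
have D'y : D' y by rewrite /D' /= addrC.
have agree z : D z -> D' z -> expmap c (z + P) = expmap c' (z + P').
  move=> Dz D'z.
  apply: (@imm_uniq R T (D `&` D') (fun z => expmap c (z + P)) (fun z => expmap c' (z + P')) y z) => //.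
  - exact: osetI.
  - exact: cvxI.
  - by move=> u [Du _]; exact: iD.
  - by move=> u [_ Du]; exact: iD'.
  - by rewrite addrC E addrC.
have [p hp] := hits_hit ns hA; rewrite nA in hp.
have hp' := hit_shift P hp.
have D'A : D' (A - P) by rewrite /D' /cball /= subr0.
apply: (hit_notin cones hp' iD' D'A) => e e0.
have K0 : 0 < e / (nc (A - P - y) + 1) by rewrite divr_gt0 // ltr_wpDl ?nc_ge0.
have [s [s0 s1 sd]] := left_approx (@ltr01 R) K0.
have Ds : D (seg y (A - P) s).
  rewrite /D /cball /= subr0.
  have -> : seg y (A - P) s + P = (1 - s)%:C * (P + y) + s%:C * A.
    by rewrite /seg rmorphB rmorph1 /=; ring.
  apply: (le_lt_trans (ncD _ _)); rewrite !nc_scale !ger0_norm ?subr_ge0 ?(ltW s1) // nA.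
  have : (1 - s) * nc (P + y) < (1 - s) * nc P.
    by rewrite ltr_pM2l ?subr_gt0 //; move: y1; rewrite /cball /= subr0.
  lra.
have D's : D' (seg y (A - P) s) by apply: cD' => //; exact: ltW.
exists (seg y (A - P) s); split => //; last exact: agree.
rewrite -{2}(seg1 y (A - P)) nc_segB.
move: sd; rewrite ltr_pdivlMr ?ltr_wpDl ?nc_ge0 // => sd.
by apply: le_lt_trans sd; rewrite ler_wpM2l // lerDl.
Qed.

(** [lens_sep] gives an inequality for each of the two edges at [P] and at [P']. As [y] is a
    positive combination of either pair, its scalar product with [P' - P] is both nonnegative and
    nonpositive; so [P' - P] is orthogonal to two independent edges and vanishes. The developments
    then agree on a disc containing 0. *)
Lemma lens c c' P P' A B A' B' (y : C) (e : R) : ~ sing c -> ~ sing c' ->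
  hits c P -> hits c A -> hits c B -> hits c' P' -> hits c' A' -> hits c' B' ->
  0 < cr (A - P) (B - P) -> opencone P A B y -> opencone P' A' B' y -> 0 < e ->
  cball 0 (nc P) (P + e%:C * y) -> cball 0 (nc P') (P' + e%:C * y) ->
  expmap c (P + e%:C * y) = expmap c' (P' + e%:C * y) -> P = P' /\ c = c'.
Proof.
move=> ns ns' hP hA hB hP' hA' hB' crp [s [t [s0 t0 Ey]]] [s' [t' [s'0 t'0 Ey']]] e0 y1 y2 E.
have k1 := lens_sep ns ns' hP hA hP' y1 y2 E.
have k2 := lens_sep ns ns' hP hB hP' y1 y2 E.
have k3 := lens_sep ns' ns hP' hA' hP y2 y1 (esym E).
have k4 := lens_sep ns' ns hP' hB' hP y2 y1 (esym E).
have j1 : dt y (P' - P) = s * dt (A - P) (P' - P) + t * dt (B - P) (P' - P).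
  by rewrite Ey /dt !ReImE; ring.
have j2 : - dt y (P' - P) = s' * dt (A' - P') (P - P') + t' * dt (B' - P') (P - P').
  by rewrite Ey' /dt !ReImE; ring.
have m1 := mulr_ge0 (ltW s0) k1; have m2 := mulr_ge0 (ltW t0) k2.
have m3 := mulr_ge0 (ltW s'0) k3; have m4 := mulr_ge0 (ltW t'0) k4.
have z1 : s * dt (A - P) (P' - P) = 0 by lra.
have z2 : t * dt (B - P) (P' - P) = 0 by lra.
have PP : P = P'.
  apply/esym/eqP; rewrite -subr_eq0; apply/eqP.
  apply: (@dt_basis R (A - P) (B - P)); first by rewrite gt_eqF.
    by apply/eqP; move/eqP: z1; rewrite mulf_eq0 gt_eqF.
  by apply/eqP; move/eqP: z2; rewrite mulf_eq0 gt_eqF.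
split => //; rewrite -PP in hP' y2 E.
have nP0 := hits_gt0 ns hP.
have [c0 ec0] := exp0 ns; have [c'0 ec'0] := exp0 ns'.
rewrite -ec0 -ec'0.
apply: (@imm_uniq R T (cball 0 (nc P)) _ _ (P + e%:C * y) 0) => //; [exact: cball_oset|exact: cball_cvx| | |].
- by move=> z /(hits_disc hP); exact: exp_imm.
- by move=> z /(hits_disc hP'); exact: exp_imm.
- by rewrite /cball /= subrr nc0.
Qed.

Section Count.
Variables (l : nat) (p : 'I_l -> T) (k : 'I_l -> nat).
Hypothesis psing : forall x, sing x -> exists j, p j = x.
Hypothesis pcount : forall j (y : C) (q : 'I_(k j).+2 -> T), y != 0 -> injective q ->
  ~ (forall i, cU (p j) (q i) /\ cF (p j) (q i) = y).

(* For a generic direction each triangle yields one point close to a zero [p] in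
   the direction [+- y]; distinct triangles yield distinct points, and at most
   [k + 1] of them are sent to the same point by the primitive at [p]. *)
Lemma fan_count (ts : seq (T * C * C)) : uniq ts -> (forall t, t \in ts -> fanT t) ->
  (size ts <= \sum_(j < l) 2 * (k j).+1)%N.
Proof.
move=> uts fts; set N := size ts.
have [[t00 _]|no] := pselect (exists t : T * C * C, t \in ts); last first.
  have -> : N = 0%N by rewrite /N; case: (ts) no => // t ts' []; exists t; rewrite mem_head.
  exact: leq0n.
pose tt (i : 'I_N) := nth t00 ts i.
have ftt i : fanT (tt i) by apply: fts; rewrite mem_nth.
pose cc i := (tt i).1.1; pose aa i := (tt i).1.2; pose bb i := (tt i).2.
have ttE i : tt i = (cc i, aa i, bb i) by rewrite /cc /aa /bb; case: (tt i) => -[].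
have fti i : fanT (cc i, aa i, bb i) by rewrite -ttE.
pose edges := flatten [seq [:: aa i - hbase (cc i); bb i - hbase (cc i); bb i - aa i] | i <- enum 'I_N].
have [y [y0 hy]] : exists y : C, y != 0 /\ forall e, e \in edges -> cr y e != 0.
  apply: generic_dir => e /flatten_mapP[i _].
  have [_ _ [_ [an bn] ab _]] := fti i.
  rewrite !inE => /or3P[] /eqP ->; rewrite subr_eq0 //.
  by apply/eqP => h; move: ab; rewrite h ltxx.
have hyi i : [/\ cr y (aa i - hbase (cc i)) != 0, cr y (bb i - hbase (cc i)) != 0 & cr y (bb i - aa i) != 0].
  by split; apply: hy; apply/flatten_mapP; exists i; rewrite ?mem_enum // !inE eqxx ?orbT.
pose sy (s : bool) := if s then y else - y.
have sy0 s : sy s != 0 by case: s; rewrite /sy ?oppr_eq0.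
(* [P] is the corner selected by the direction, [s] the sign of the direction and [j] the index of
   the zero at that corner. The conditions hold for all small [x], so that one [x] can serve all
   triangles. *)
pose ok i (D : C * C * C * bool * 'I_l) := let: (P, A, B, s, j) := D in
  [/\ corner (hbase (cc i)) (aa i) (bb i) P A B, opencone P A B (sy s) &
    exists2 e : R, 0 < e & forall x, 0 < x -> x < e -> [/\ cball 0 (nc P) (P + x%:C * sy s),
      cU (p j) (expmap (cc i) (P + x%:C * sy s)) & cF (p j) (expmap (cc i) (P + x%:C * sy s)) = x%:C * sy s]].
have ex i : exists D, ok i D.
  have [n0 nk hb hE] := fanTP (fti i); have [nsi hbi fi] := fti i.
  have [m1 m2 m3] := hyi i.
  have [P [A [B [s [co oc]]]]] := generic_corner n0 erefl nk fi m1 m2 m3.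
  have [PH AH BH] := corner_mem hb fi co.
  have hP := (proj2 (hE P)) PH; have hA := (proj2 (hE A)) AH; have hB := (proj2 (hE B)) BH.
  have [q hq] := hits_hit nsi hP; have [sq [eta eta0 heta]] := hq.
  have [j pj] := psing sq.
  exists (P, A, B, s, j); split => //.
  have crp := corner_cr n0 erefl nk fi co.
  have nAP : A != P by apply/eqP => h; move: crp; rewrite h subrr (_ : cr 0 _ = 0) ?ltxx // /cr /=; ring.
  have nBP : B != P by apply/eqP => h; move: crp; rewrite h subrr (_ : cr _ 0 = 0) ?ltxx // /cr /=; ring.
  have dPy := opencone_in (hits_same hA hP) (hits_same hB hP) nAP nBP oc.
  have [e1 e10 he1] := step_in dPy.
  have ny : 0 < nc (sy s) by rewrite nc_gt0.
  exists (Num.min e1 (eta / nc (sy s))); first by rewrite lt_min e10 divr_gt0.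
  move=> x x0; rewrite lt_min ltr_pdivlMr // => /andP[xe1 xe2].
  have inD := he1 x x0 xe1.
  have [|u1 u2] := heta _ inD.
    by rewrite addrAC subrr add0r nc_scale gtr0_norm.
  by rewrite pj; split => //; rewrite u2 addrAC subrr add0r.
have [D hD] := choice ex.
pose PP i := (D i).1.1.1.1; pose AA i := (D i).1.1.1.2; pose BB i := (D i).1.1.2.
pose ss i := (D i).1.2; pose jj i := (D i).2.
have DE i : D i = (PP i, AA i, BB i, ss i, jj i).
  by rewrite /PP /AA /BB /ss /jj; case: (D i) => -[[[]]].
have okD i : ok i (PP i, AA i, BB i, ss i, jj i) by rewrite -DE.
have [x x0 hx] := @common_eps R N (fun i x => [/\ cball 0 (nc (PP i)) (PP i + x%:C * sy (ss i)),
      cU (p (jj i)) (expmap (cc i) (PP i + x%:C * sy (ss i))) &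
      cF (p (jj i)) (expmap (cc i) (PP i + x%:C * sy (ss i))) = x%:C * sy (ss i)])
   (fun i => let: And3 _ _ h := okD i in h).
pose Q i := expmap (cc i) (PP i + x%:C * sy (ss i)).
(* Equal points with equal signs have the same centre and corner by [lens], hence the same triangle
   by [fan_overlap]. *)
have inj i i' : ss i = ss i' -> Q i = Q i' -> i = i'.
  move=> es eQ.
  have [n0 nk hb hE] := fanTP (fti i); have [nsi hbi fi] := fti i.
  have [n0' nk' hb' hE'] := fanTP (fti i'); have [nsi' hbi' fi'] := fti i'.
  have [co oc _] := okD i; have [co' oc' _] := okD i'.
  have [PH AH BH] := corner_mem hb fi co.
  have [PH' AH' BH'] := corner_mem hb' fi' co'.
  have crp := corner_cr n0 erefl nk fi co.
  have [in1 _ _] := hx i; have [in1' _ _] := hx i'.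
  rewrite -es in in1' oc'.
  have eQ' : expmap (cc i) (PP i + x%:C * sy (ss i)) = expmap (cc i') (PP i' + x%:C * sy (ss i)).
    by rewrite es; rewrite /Q es in eQ.
  have [ePP ecc] := lens nsi nsi' ((proj2 (hE _)) PH) ((proj2 (hE _)) AH) ((proj2 (hE _)) BH)
     ((proj2 (hE' _)) PH') ((proj2 (hE' _)) AH') ((proj2 (hE' _)) BH') crp oc oc' x0 in1 in1' eQ'.
  rewrite -ecc -ePP in fi' co' oc'.
  have [ea eb] := fan_overlap n0 erefl nk fi fi' co co' oc oc'.
  have ett : tt i = tt i' by rewrite !ttE ecc ea eb.
  apply/val_inj/eqP; rewrite -(nth_uniq t00 (ltn_ord i) (ltn_ord i') uts).
  exact/eqP.
have cardN : N = (\sum_(x : 'I_l * bool) #|[pred i : 'I_N | (jj i, ss i) == x]|)%N.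
  rewrite -[LHS](card_ord N) -sum1_card (partition_big (fun i => (jj i, ss i)) predT) //=.
  by apply: eq_bigr => u _; rewrite -sum1_card.
rewrite cardN (eq_bigr (fun u : 'I_l * bool => #|[pred i : 'I_N | (jj i, ss i) == (u.1, u.2)]|)); last by move=> [].
rewrite -(pair_bigA _ (fun j s => #|[pred i : 'I_N | (jj i, ss i) == (j, s)]|)) /=.
apply: leq_sum => j _.
(* One more triangle for the same zero and sign would give [(k j).+2] distinct points with the same
   nonzero image [x * sy s] under the primitive. *)
have bd s : (#|[pred i : 'I_N | (jj i, ss i) == (j, s)]| <= (k j).+1)%N.
  rewrite leqNgt; apply/negP => lt.
  pose e (u : 'I_(k j).+2) : 'I_N := enum_val (widen_ord lt u).
  have eP u : (jj (e u), ss (e u)) = (j, s) by apply/eqP; have := enum_valP (widen_ord lt u).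
  apply: (@pcount j (x%:C * sy s) (fun u => Q (e u))).
  - by rewrite mulf_neq0 // eq_complex /= gt_eqF.
  - move=> u u' eu; have [ej es] := eP u; have [ej' es'] := eP u'.
    have := inj (e u) (e u'); rewrite es es' => /(_ erefl eu) /enum_val_inj h.
    by apply/val_inj; have := congr1 val h.
  - by move=> u; have [_ h1 h2] := hx (e u); have [ej es] := eP u; rewrite /Q; rewrite es ej in h1 h2 *.
by rewrite big_bool mul2n -addnn leq_add.
Qed.

End Count.

(** * The triangles cover the regular points *)

Section Cover.
Variable b : R.
Hypothesis short : forall (r : R) (phi : C -> T), imm (cball 0 r) phi -> 0 < r -> r <= b.

(** The Delaunay disc is found in the development at [x]; moving its centre [v] to the origin turns
    it into the largest disc of [c = expmap x v], in whose development [x] sits at [- v]. *)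
Lemma fan_cover_surface x : ~ sing x -> exists c a d, fanT (c, a, d) /\
  exists w, [/\ nc w < nc (hbase c), tri (hbase c) a d w & expmap c w = x].
Proof.
move=> ns.
have bounded v (r : R) : nc v < r -> cball v r `<=` expdom x -> r <= b.
  move=> vr sub; have r0 := le_lt_trans (nc_ge0 v) vr.
  apply: (@short r (fun w => expmap x (w + v))) => // w hw.
  by apply: imm_at_shift; apply: exp_imm; apply: sub; move: hw; rewrite /cball /= subr0 addrK.
have [x0 ex0] := exp0 ns.
have [v [r [sub vr hull three]]] := delaunay_disc (@exp_oset R T x) x0 bounded
  (fun v r h s1 s2 s3 s4 => @exp_isolated x v r h ns s1 s2 s3 s4).
have r0 := le_lt_trans (nc_ge0 v) vr.
pose c := expmap x v.
have rec := exp_recenter (erefl c) r0 sub.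
have Ev : expdom x v by apply: sub; rewrite /cball /= subrr nc0.
have nsc : ~ sing c by case: (exp_imm Ev).
have hc h : ~ expdom x h -> nc (h - v) = r -> hits c (h - v).
  move=> nh hr; have [p hp] := hit_ex cones sub ns vr hr nh.
  split.
    move=> dh; have hp' := hit_shift v hp.
    apply: (hit_notin cones hp' (@exp_imm R T c) dh) => e e0.
    have [z z1 z2] := ball_adherent r0 hr e0.
    exists (z - v); rewrite /= subrK; split => //.
      by rewrite (_ : z - v - (h - v) = z - h) //; ring.
    have [|_ ->] := rec (z - v); first by rewrite /cball /= subr0.
    by rewrite subrK.
  move=> h' nh'; rewrite hr leNgt; apply/negP => lt; apply: nh'.
  by have [|] := rec h'; first by rewrite /cball /= subr0.
have [h1 [h2 [h3 [n12 n13 n23 nE nr]]]] := three.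
have hc1 : hits c (h1 - v) by apply: hc; [apply: nE|apply: nr]; tauto.
have hc2 : hits c (h2 - v) by apply: hc; [apply: nE|apply: nr]; tauto.
have hc3 : hits c (h3 - v) by apply: hc; [apply: nE|apply: nr]; tauto.
have [hE hb] := hseqP nsc hc1.
have hbc := (proj2 (hE _)) hb.
have nb : nc (hbase c) = r by rewrite (hits_same hbc hc1); apply: nr; tauto.
have [a [d [fad tw]]] : exists a d, fan (hbase c) (hseq c) a d /\ tri (hbase c) a d (- v).
  apply: (@fan_cover R r) => //.
  - by move=> k0 /hE hk; rewrite (hits_same hk hbc).
  - by rewrite ncN.
  - move=> dl; have [h [nh hr hd]] := hull dl.
    by exists (h - v); [apply/hE/hc|rewrite opprK subrK].
  - have H1 := (proj1 (hE _)) hc1; have H2 := (proj1 (hE _)) hc2; have H3 := (proj1 (hE _)) hc3.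
    have [e1|e1] := eqVneq (h1 - v) (hbase c).
      exists (h2 - v), (h3 - v); rewrite -e1 H2 H3; split => //.
      - by apply: contra n12 => /eqP/addIr ->.
      - by apply: contra n13 => /eqP/addIr ->.
      - by apply: contra n23 => /eqP/addIr ->.
    have [e2|e2] := eqVneq (h2 - v) (hbase c).
      exists (h1 - v), (h3 - v); rewrite H1 H3 e1; split => //.
      - by rewrite -e2; apply: contra n23 => /eqP/addIr ->.
      - by apply: contra n13 => /eqP/addIr ->.
    exists (h1 - v), (h2 - v); rewrite H1 H2 e1 e2; split => //.
    by apply: contra n12 => /eqP/addIr ->.
exists c, a, d; split => //.
exists (- v); split => //; first by rewrite ncN nb.
have [|_ ->] := rec (- v); first by rewrite /cball /= subr0 ncN.
by rewrite addNr.
Qed.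

End Cover.
End Counting.

(** * Area *)

Section PushMeasure.
Local Open Scope ereal_scope.
Context d d' (T1 : measurableType d) (T2 : measurableType d') (R : realType).
Variables (m : {measure set T1 -> \bar R}) (D : set T1) (f : T1 -> T2).

(** The image of the restriction of [m] to [D], for a map that is measurable on [D] only. As a
    declared measure it is open to uniqueness theorems, as is [density] below. *)
Definition push_on (mD : measurable D) (mf : measurable_fun D f) (A : set T2) := m (D `&` f @^-1` A).
Variables (mD : measurable D) (mf : measurable_fun D f).
Let pushr0 : push_on mD mf set0 = 0.
Proof. by rewrite /push_on preimage_set0 setI0 measure0. Qed.
Let pushr_ge0 A : 0 <= push_on mD mf A.
Proof. exact: measure_ge0. Qed.
Let pushr_sigma_additive : semi_sigma_additive (push_on mD mf).
Proof.
move=> F mF tF mUF; rewrite /push_on preimage_bigcup setI_bigcupr.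
apply: measure_semi_sigma_additive.
- by move=> n; exact: mf.
- apply/trivIsetP => /= i j _ _ ij; rewrite setIACA -preimage_setI.
  by move/trivIsetP : tF => /(_ _ _ _ _ ij) ->//; rewrite preimage_set0 setI0.
- by rewrite -setI_bigcupr -preimage_bigcup; exact: mf.
Qed.
HB.instance Definition _ := isMeasure.Build _ _ _ (push_on mD mf) pushr0 pushr_ge0 pushr_sigma_additive.
End PushMeasure.

Section DensityMeasure.
Local Open Scope ereal_scope.
Context d (T : measurableType d) (R : realType).
Variables (m : {measure set T -> \bar R}) (D : set T) (g : T -> \bar R).

Definition density (mD : measurable D) (mg : measurable_fun D g) (g0 : forall x, 0 <= g x) (A : set T) :=
  \int[m]_(x in D `&` A) g x.
Variables (mD : measurable D) (mg : measurable_fun D g) (g0 : forall x, 0 <= g x).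
Let dens0 : density mD mg g0 set0 = 0.
Proof. by rewrite /density setI0 integral_set0. Qed.
Let dens_ge0 A : 0 <= density mD mg g0 A.
Proof. by apply: integral_ge0 => x _. Qed.
Let dens_sigma_additive : semi_sigma_additive (density mD mg g0).
Proof.
move=> F mF tF mUF; rewrite /density setI_bigcupr ge0_integral_bigcup //.
- by apply: is_cvg_ereal_nneg_natsum_cond => n _ _; exact: integral_ge0.
- by move=> n; exact: measurableI.
- by apply: measurable_funS mg => // x [n _ []].
- apply/trivIsetP => /= i j _ _ ij; rewrite setIACA.
  by move/trivIsetP : tF => /(_ _ _ _ _ ij) ->//; rewrite setI0.
Qed.
HB.instance Definition _ := isMeasure.Build _ _ _ (density mD mg g0) dens0 dens_ge0 dens_sigma_additive.
End DensityMeasure.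

(** * Area under affine maps *)

Section AffineArea.
Variable R : realType.
Local Notation RR := (measurableTypeR R).
Local Notation lam := (@lebesgue_measure R).
Local Notation Pl := (RR * RR)%type.
Local Notation lam2 := (lam \x lam)%E.
Local Open Scope ereal_scope.

Lemma measurable_affine1 (be m : R) : measurable_fun [set: RR] (fun y : RR => (be * y + m)%R : RR).
Proof. by apply: measurable_funD => //; exact: mulrl_measurable. Qed.

(** Rescaled by the modulus of [be], the image measure gives half-open intervals their length, which
    characterises Lebesgue measure. The sign of [be] only decides which end of the preimage is
    closed. *)
Lemma lebesgue_affine (be m : R) (B : set RR) : be != 0%R -> measurable B ->
  lam [set y : RR | B (be * y + m)%R] = (`|be|^-1)%:E * lam B.
Proof.
move=> be0 mB; have n0 : (0 < `|be|)%R by rewrite normr_gt0.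
pose mu : {measure set RR -> \bar R} := mscale (NngNum (normr_ge0 be)) (push_on lam measurableT (measurable_affine1 be m)).
suff h : lam B = `|be|%:E * lam [set y : RR | B (be * y + m)%R].
  by rewrite h muleA -EFinM mulVf ?mul1e // gt_eqF.
rewrite (@lebesgue_measure_unique R mu) // ?/mu /= ?/mscale /push_on /= ?setTI //; clear B mB => _ [[u v] _ <-].
rewrite /mu /= /mscale /push_on /= setTI.
have -> : (fun y : RR => (be * y + m)%R : RR) @^-1` `]u, v] =
    if (0 < be)%R then `]((u - m) / be)%R, ((v - m) / be)%R]%classic else `[((v - m) / be)%R, ((u - m) / be)%R[%classic.
  case: ltP => hb; apply/seteqP; split => y /=; rewrite !in_itv /=.
  - by rewrite ltr_pdivrMr // ler_pdivlMr // => /andP[? ?]; apply/andP; split; lra.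
  - by rewrite ltr_pdivrMr // ler_pdivlMr // => /andP[? ?]; apply/andP; split; lra.
  - have hn : (be < 0)%R by rewrite lt_neqAle be0.
    by rewrite ltr_ndivlMr // ler_ndivrMr // => /andP[? ?]; apply/andP; split; lra.
  - have hn : (be < 0)%R by rewrite lt_neqAle be0.
    by rewrite ltr_ndivlMr // ler_ndivrMr // => /andP[? ?]; apply/andP; split; lra.
case: ltP => hb.
  rewrite !lebesgue_measure_itv /= !lte_fin ltr_pM2r ?invr_gt0 // ltrD2r.
  case: ifP => _; last by rewrite mule0.
  rewrite -!EFinB -EFinM gtr0_norm //; congr (_%:E); field.
  by rewrite gt_eqF.
have hn : (be < 0)%R by rewrite lt_neqAle be0.
rewrite !lebesgue_measure_itv /= !lte_fin ltr_nM2r ?invr_lt0 // ltrD2r.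
case: ifP => _; last by rewrite mule0.
rewrite -!EFinB -EFinM ltr0_norm //; congr (_%:E); field.
by rewrite lt_eqF.
Qed.

Lemma measurable_affine2 (a b m : R) : measurable_fun [set: Pl] (fun p : Pl => (a * p.1 + b * p.2 + m)%R : RR).
Proof.
apply: measurable_funD => //; apply: measurable_funD.
  by apply: measurable_funM => //; exact: measurable_fst.
by apply: measurable_funM => //; exact: measurable_snd.
Qed.

Lemma measurable_affine (a b c d m n : R) : measurable_fun [set: Pl]
  (fun p : Pl => ((a * p.1 + b * p.2 + m)%R, (c * p.1 + d * p.2 + n)%R) : Pl).
Proof. by apply: measurable_fun_pair; exact: measurable_affine2. Qed.

Lemma measurable_affine_set (a b c d m n : R) (A : set Pl) : measurable A ->
  measurable [set p : Pl | A ((a * p.1 + b * p.2 + m)%R, (c * p.1 + d * p.2 + n)%R)].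
Proof. by move=> mA; rewrite -[X in measurable X]setTI; exact: measurable_affine. Qed.

Lemma area_shear_y (be k m : R) (A : set Pl) : be != 0%R -> measurable A ->
  lam2 [set p : Pl | A (p.1, (k * p.1 + be * p.2 + m)%R)] = (`|be|^-1)%:E * lam2 A.
Proof.
move=> be0 mA; rewrite /product_measure1 -ge0_integralZl //; last exact: measurable_fun_xsection.
apply: eq_integral => x _ /=.
rewrite -(lebesgue_affine (k * x + m)) //; last exact: measurable_xsection.
congr lam; apply/seteqP; split => y; rewrite /xsection /= ?inE /= ?inE /=.
  by rewrite (_ : (k * x + be * y + m = be * y + (k * x + m))%R) //; ring.
by rewrite (_ : (k * x + be * y + m = be * y + (k * x + m))%R) //; ring.
Qed.

Lemma area_ysection (A : set Pl) : measurable A -> lam2 A = \int[lam]_y lam (ysection A y).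
Proof.
move=> mA; have := @product_measure_unique _ _ RR RR R lam lam (lam \x^ lam).
by move=> ->//= B C mB mC; rewrite product_measure2E.
Qed.

Lemma area_shear_x (al k m : R) (A : set Pl) : al != 0%R -> measurable A ->
  lam2 [set p : Pl | A ((al * p.1 + k * p.2 + m)%R, p.2)] = (`|al|^-1)%:E * lam2 A.
Proof.
move=> al0 mA; rewrite area_ysection; last first.
  have := @measurable_affine_set al k 0 1 m 0 A mA.
  by congr measurable; apply/seteqP; split => p /=; rewrite mul0r add0r mul1r addr0.
rewrite (area_ysection mA) -ge0_integralZl //; last exact: measurable_fun_ysection.
apply: eq_integral => y _ /=.
rewrite -(lebesgue_affine (k * y + m)) //; last exact: measurable_ysection.
congr lam; apply/seteqP; split => x; rewrite /ysection /= ?inE /= ?inE /=.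
  by rewrite addrA.
by rewrite addrA.
Qed.

(** The map is factored into two shears with scaling, handled by Fubini on vertical and horizontal
    sections. The factorisation divides by [a]; when [a] vanishes, adding the second row to the
    first makes that entry nonzero. *)
Lemma area_affine (a b c d m n : R) (A : set Pl) : (a * d - b * c != 0)%R -> measurable A ->
  lam2 [set p : Pl | A ((a * p.1 + b * p.2 + m)%R, (c * p.1 + d * p.2 + n)%R)] = (`|a * d - b * c|^-1)%:E * lam2 A.
Proof.
have main (a' b' m' : R) (A' : set Pl) : a' != 0%R -> (a' * d - b' * c != 0)%R -> measurable A' ->
  lam2 [set p : Pl | A' ((a' * p.1 + b' * p.2 + m')%R, (c * p.1 + d * p.2 + n)%R)] = (`|a' * d - b' * c|^-1)%:E * lam2 A'.
  move=> a0 det mA.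
  pose be := (d - c * b' / a')%R.
  have be0 : be != 0%R.
    have E : (a' * d - b' * c = a' * be)%R by rewrite /be; field.
    by apply: contra det => /eqP h; rewrite E h mulr0.
  pose A1 : set Pl := [set p : Pl | A' (p.1, (c / a' * p.1 + be * p.2 + (n - c / a' * m'))%R)].
  have mA1 : measurable A1.
    have := @measurable_affine_set 1 0 (c / a') be 0 (n - c / a' * m') A' mA.
    by congr measurable; apply/seteqP; split => p /=; rewrite mul1r mul0r !addr0.
  have -> : [set p : Pl | A' ((a' * p.1 + b' * p.2 + m')%R, (c * p.1 + d * p.2 + n)%R)] =
     [set p : Pl | A1 ((a' * p.1 + b' * p.2 + m')%R, p.2)].
    apply/seteqP; split => p; rewrite /A1 /=.
      by rewrite (_ : (c / a' * (a' * p.1 + b' * p.2 + m') + be * p.2 + (n - c / a' * m') = c * p.1 + d * p.2 + n)%R) //; rewrite /be; field.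
    by rewrite (_ : (c / a' * (a' * p.1 + b' * p.2 + m') + be * p.2 + (n - c / a' * m') = c * p.1 + d * p.2 + n)%R) //; rewrite /be; field.
  rewrite area_shear_x // area_shear_y // muleA -EFinM; congr (_%:E * _).
  rewrite -invfM -normrM; apply: (congr1 (fun t => `|t|^-1)%R).
  by rewrite /be; field.
move=> det mA; have [a0|a0] := eqVneq a 0%R; last exact: main.
have c0 : c != 0%R by apply: contra det => /eqP ->; rewrite a0 mul0r mulr0 subrr.
pose A1 : set Pl := [set p : Pl | A ((1 * p.1 + (-1) * p.2 + 0)%R, p.2)].
have mA1 : measurable A1.
  have := @measurable_affine_set 1 (-1) 0 1 0 0 A mA.
  by congr measurable; apply/seteqP; split => p; rewrite /A1 /= !mul0r !addr0 !add0r !mul1r.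
have -> : [set p : Pl | A ((a * p.1 + b * p.2 + m)%R, (c * p.1 + d * p.2 + n)%R)] =
  [set p : Pl | A1 (((a + c) * p.1 + (b + d) * p.2 + (m + n))%R, (c * p.1 + d * p.2 + n)%R)].
  apply/seteqP; split => p; rewrite /A1 /=.
    by rewrite (_ : (1 * ((a + c) * p.1 + (b + d) * p.2 + (m + n)) + -1 * (c * p.1 + d * p.2 + n) + 0 = a * p.1 + b * p.2 + m)%R) //; ring.
  by rewrite (_ : (1 * ((a + c) * p.1 + (b + d) * p.2 + (m + n)) + -1 * (c * p.1 + d * p.2 + n) + 0 = a * p.1 + b * p.2 + m)%R) //; ring.
have E : ((a + c) * d - (b + d) * c = a * d - b * c)%R by ring.
rewrite main ?E //; last by rewrite a0 add0r.
rewrite area_shear_x ?oner_eq0 // normr1 invr1 mul1e.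
by [].
Qed.

Lemma area_setX (A B : set RR) : measurable A -> measurable B -> lam2 (A `*` B) = lam A * lam B.
Proof. by move=> mA mB; rewrite product_measure1E. Qed.

End AffineArea.

(** * Measurable sets of the complex plane *)

Section PlaneMeasure.
Variable R : realType.
Local Notation C := R[i].
Local Notation RR := (measurableTypeR R).
Local Notation lam := (@lebesgue_measure R).
Local Notation Pl := (RR * RR)%type.
Local Notation lam2 := (lam \x lam)%E.

Definition zc (p : Pl) : C := p.1 +i* p.2.
Definition pc (z : C) : Pl := (Re z, Im z).

Lemma zcK p : pc (zc p) = p. Proof. by case: p. Qed.
Lemma pcK z : zc (pc z) = z. Proof. by case: z. Qed.

(** Half-open grid squares of side [1 / n.+1], indexed by a countable type: every point lies in
    arbitrarily small cells, so open sets are countable unions of cells. *)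
Definition cell (q : nat * int * int) : set Pl :=
  `[q.1.2%:~R / q.1.1.+1%:R, (q.1.2 + 1)%:~R / q.1.1.+1%:R[ `*`
  `[q.2%:~R / q.1.1.+1%:R, (q.2 + 1)%:~R / q.1.1.+1%:R[.

Lemma measurable_cell q : measurable (cell q).
Proof. by apply: measurableX; exact: measurable_itv. Qed.

Lemma cell_ex (z : C) (r : R) : 0 < r -> exists q, cell q (pc z) /\
  forall p, cell q p -> nc (zc p - z) < r.
Proof.
move=> r0; have [n hn] : exists n : nat, 2 / r < n.+1%:R.
  exists (Num.truncn (2 / r)); have h : 0 <= 2 / r by rewrite divr_ge0 // ltW.
  by case/andP: (truncn_itv h).
have N0 : (0 : R) < n.+1%:R by [].
have itv (x : R) : (Num.floor (x * n.+1%:R))%:~R / n.+1%:R <= x < (Num.floor (x * n.+1%:R) + 1)%:~R / n.+1%:R.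
  by rewrite ler_pdivrMr // ltr_pdivlMr // floor_itv.
exists (n, Num.floor (Re z * n.+1%:R), Num.floor (Im z * n.+1%:R)); split.
  by split; rewrite /= in_itv /= itv.
move=> [x y] [] /=; rewrite !in_itv /= => /andP[x1 x2] /andP[y1 y2].
have /andP[u1 u2] := itv (Re z); have /andP[v1 v2] := itv (Im z).
have w : 2 / n.+1%:R < r.
  by rewrite ltr_pdivrMr // mulrC -ltr_pdivrMr.
apply: le_lt_trans (nc_ReIm _) _; apply: le_lt_trans w.
have aux (k : int) (s t : R) : k%:~R / n.+1%:R <= s -> s < (k + 1)%:~R / n.+1%:R ->
    k%:~R / n.+1%:R <= t -> t < (k + 1)%:~R / n.+1%:R -> `|s - t| <= 1 / n.+1%:R.
  rewrite intrD mulrDl; move: (_ / _) (_ / _) => u v a1 a2 a3 a4.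
  by rewrite ler_norml; apply/andP; split; lra.
have E : 2 / n.+1%:R = 1 / n.+1%:R + 1 / n.+1%:R :> R by rewrite -mulrDl.
by rewrite E !ReImE; apply: lerD; [exact: aux x1 x2 u1 u2|exact: aux y1 y2 v1 v2].
Qed.

Lemma oset_measurable (U : set C) : oset U -> measurable [set p : Pl | U (zc p)].
Proof.
move=> oU.
pose Q n : set Pl := if @unpickle (nat * int * int)%type n is Some q then
   if `[< forall p, cell q p -> U (zc p) >] then cell q else set0 else set0.
have -> : [set p : Pl | U (zc p)] = \bigcup_n Q n.
  apply/seteqP; split => [p /= Up|p [n _]].
    have [r r0 hr] := oU _ Up; have [q [qp hq]] := cell_ex (zc p) r0.
    exists (pickle q) => //; rewrite /Q pickleK.
    rewrite asboolT; first by rewrite -(zcK p).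
    by move=> w /hq /hr.
  rewrite /Q; case: unpickle => // q; case: asboolP => // h; exact: h.
apply: bigcupT_measurable => n; rewrite /Q.
case: unpickle => [q|]; last exact: measurable0.
by case: ifP => _; [exact: measurable_cell|exact: measurable0].
Qed.

Lemma oset_real_measurable (V : set C) (g : C -> R) : oset V ->
  (forall z, V z -> forall e : R, 0 < e -> exists2 r : R, 0 < r & forall w, nc (w - z) < r -> `|g w - g z| < e) ->
  measurable_fun [set p : Pl | V (zc p)] (fun p => g (zc p) : RR).
Proof.
move=> oV cg; apply: (measurability _ (RGenOpens.measurableE R)).
move=> _ [_ [a [b ->] <-]].
apply: (@oset_measurable [set z | V z /\ g z \in `]a, b[]) => z [Vz].
rewrite in_itv /= => /andP[az zb].
have [s s0 hs] := oV z Vz.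
have e0 : 0 < Num.min (g z - a) (b - g z) by rewrite lt_min !subr_gt0 az.
have [r r0 hr] := cg z Vz _ e0.
exists (Num.min r s) => [|w]; first by rewrite lt_min r0.
rewrite lt_min => /andP[/hr h /hs ?]; split => //.
by move: h; rewrite lt_min !ltr_norml in_itv /= => /andP[/andP[? ?] /andP[? ?]]; apply/andP; split; lra.
Qed.

Definition ocrect (a b c d : R) : set Pl := `]a, b] `*` `]c, d].
Definition ocrects : set (set Pl) := [set E | exists a b c d : R, E = ocrect a b c d].

Lemma setT_ocitv : [set: R] = \bigcup_(n : nat) `](- (n%:R : R)), n%:R]%classic.
Proof.
apply/seteqP; split => // x _; exists (Num.truncn `|x|).+1 => //=.
rewrite in_itv /=; have /andP[_ h] := truncn_itv (normr_ge0 x).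
by move: h; rewrite ltr_norml => /andP[-> /ltW ->].
Qed.

(** The projections are measurable for the generated algebra because a strip is a countable union of
    rectangles. *)
Lemma plane_generated : @measurable _ Pl = <<s ocrects >>.
Proof.
apply/seteqP; split; last first.
  apply: smallest_sub; first exact: sigma_algebra_measurable.
  by move=> _ [a [b [c [d ->]]]]; apply: measurableX; exact: measurable_itv.
rewrite measurable_prod_measurableType.
apply: smallest_sub; first exact: smallest_sigma_algebra.
pose GT := g_sigma_algebraType ocrects.
have m1 : measurable_fun [set: GT] (fst : GT -> RR).
  apply: (@measurability _ _ GT RR setT fst (@ocitv R)) => //.
  move=> _ [_ [[a b] _ <-] <-].
  rewrite (_ : _ `&` _ = \bigcup_n (ocrect a b (- n%:R) n%:R : set GT)); last first.
    apply/seteqP; split => [[x y] [_ /= h]|[x y] [n _ [/= h _]] //].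
    have : [set: R] y by []. rewrite setT_ocitv => -[n _ hn]; by exists n.
  by apply: bigcupT_measurable => n; apply: sub_sigma_algebra; do 4 eexists.
have m2 : measurable_fun [set: GT] (snd : GT -> RR).
  apply: (@measurability _ _ GT RR setT snd (@ocitv R)) => //.
  move=> _ [_ [[a b] _ <-] <-].
  rewrite (_ : _ `&` _ = \bigcup_n (ocrect (- n%:R) n%:R a b : set GT)); last first.
    apply/seteqP; split => [[x y] [_ /= h]|[x y] [n _ [/= _ h]] //].
    have : [set: R] x by []. rewrite setT_ocitv => -[n _ hn]; by exists n.
  by apply: bigcupT_measurable => n; apply: sub_sigma_algebra; do 4 eexists.
move=> _ [A mA [B mB <-]].
have -> : A `*` B = ([set: GT] `&` fst @^-1` A) `&` ([set: GT] `&` snd @^-1` B).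
  by apply/seteqP; split => [[x y] [/= ? ?]|[x y] [[_ /= ?] [_ /= ?]]].
apply: (@measurableI _ GT); [exact: m1|exact: m2].
Qed.

Lemma oset_cont_measurable (V : set C) (F : C -> C) : oset V -> (forall z, V z -> ccont F z) ->
  measurable_fun [set p : Pl | V (zc p)] (fun p => pc (F (zc p))).
Proof.
move=> oV cF; have mV := oset_measurable oV.
have mR : measurable_fun [set p : Pl | V (zc p)] (fun p => Re (F (zc p)) : RR).
  apply: (@oset_real_measurable V (fun z => Re (F z))) => // z Vz e e0.
  have [r r0 hr] := cF z Vz e e0; exists r => // w hw.
  by rewrite -ReN -ReD; apply: le_lt_trans (Re_nc _) (hr w hw).
have mI : measurable_fun [set p : Pl | V (zc p)] (fun p => Im (F (zc p)) : RR).
  apply: (@oset_real_measurable V (fun z => Im (F z))) => // z Vz e e0.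
  have [r r0 hr] := cF z Vz e e0; exists r => // w hw.
  by rewrite -ImN -ImD; apply: le_lt_trans (Im_nc _) (hr w hw).
apply: (measurability _ plane_generated) => _ [_ [a [b [c [d ->]]]] <-].
have -> : [set p : Pl | V (zc p)] `&` (fun p => pc (F (zc p))) @^-1` ocrect a b c d =
   ([set p : Pl | V (zc p)] `&` (fun p => Re (F (zc p)) : RR) @^-1` `]a, b]) `&`
   ([set p : Pl | V (zc p)] `&` (fun p => Im (F (zc p)) : RR) @^-1` `]c, d]).
  by apply/seteqP; split => [p [Vp [? ?]]|p [[Vp ?] [_ ?]]].
by apply: measurableI; [apply: mR|apply: mI] => //; exact: measurable_itv.
Qed.

Lemma ocrectI a b c d a' b' c' d' :
  ocrect a b c d `&` ocrect a' b' c' d' = ocrect (Num.max a a') (Num.min b b') (Num.max c c') (Num.min d d').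
Proof.
by apply/seteqP; split => -[x y]; rewrite /ocrect /= !in_itv /= ?gt_max ?le_min;
  [move=> [[/andP[-> ->] /andP[-> ->]] [/andP[-> ->] /andP[-> ->]]]|
   move=> [/andP[/andP[-> ->] /andP[-> ->]] /andP[/andP[-> ->] /andP[-> ->]]]].
Qed.

Lemma ocrect_area a b c d : a <= b -> c <= d -> lam2 (ocrect a b c d) = ((b - a) * (d - c))%:E.
Proof.
move=> ab cd; rewrite /ocrect area_setX; try exact: measurable_itv.
rewrite !lebesgue_measure_itv /= !lte_fin.
case: ltP => [_|ba]; last by rewrite mul0e (@le_anti _ _ a b) ?ab ?ba // subrr mul0r.
by case: ltP => [_|dc]; [rewrite EFinM|rewrite mule0 (@le_anti _ _ c d) ?cd ?dc // subrr mulr0].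
Qed.

Lemma ocrect_measure_unique (m1 m2 : {measure set Pl -> \bar R}) :
  (forall a b c d, m1 (ocrect a b c d) = m2 (ocrect a b c d)) ->
  (forall a b c d, m1 (ocrect a b c d) < +oo)%E ->
  forall E, measurable E -> m1 E = m2 E.
Proof.
move=> h fin E mE.
apply: (measure_unique ocrects (fun n => ocrect (- n%:R) n%:R (- n%:R) n%:R)) => //.
- exact: plane_generated.
- by move=> _ _ [a [b [c [d ->]]]] [a' [b' [c' [d' ->]]]]; rewrite ocrectI; do 4 eexists.
- by move=> n; do 4 eexists.
- apply/seteqP; split => // -[x y] _.
  have : [set: R] (`|x| + `|y|) by []. rewrite setT_ocitv => -[n _].
  rewrite /= in_itv /= => /andP[_ hn]; exists n.+1 => //.
  have := ler_norm x; have := ler_norm y; have := ler_norm (- x); have := ler_norm (- y).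
  rewrite !normrN => ? ? ? ?; have := normr_ge0 x; have := normr_ge0 y => ? ?.
  by rewrite /ocrect /= !in_itv /= -natr1; split; apply/andP; split; lra.
- by move=> _ [a [b [c [d ->]]]].
Qed.

End PlaneMeasure.

(** * Change of variables for a local primitive *)

Section LocalChange.
Variable R : realType.
Local Notation C := R[i].
Local Notation RR := (measurableTypeR R).
Local Notation lam := (@lebesgue_measure R).
Local Notation Pl := (RR * RR)%type.
Local Notation lam2 := (lam \x lam)%E.

Definition crect (q : C) (s t : R) : set Pl :=
  [set p | `|Re (zc p - q)| <= s /\ `|Im (zc p - q)| <= t].

Lemma crect_pc q s t z : crect q s t (pc z) = (`|Re (z - q)| <= s /\ `|Im (z - q)| <= t).
Proof. by rewrite /crect /mkset pcK. Qed.

Lemma ocrect_crect (q : C) s t z : ocrect (Re q - s) (Re q + s) (Im q - t) (Im q + t) (pc z) ->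
  `|Re (z - q)| <= s /\ `|Im (z - q)| <= t.
Proof.
rewrite /ocrect /= !in_itv /= !ReImE !ler_norml => -[/andP[? ?] /andP[? ?]].
by split; apply/andP; split; lra.
Qed.

Lemma crect_measurable q s t : measurable (crect q s t).
Proof.
have -> : crect q s t = `[(Re q - s), (Re q + s)]%classic `*` `[(Im q - t), (Im q + t)]%classic.
  apply/seteqP; split => -[x y]; rewrite /crect /= !in_itv /= !ReImE /= !ler_norml => -[/andP[? ?] /andP[? ?]];
   by split; apply/andP; split; lra.
by apply: measurableX; exact: measurable_itv.
Qed.

Lemma crect_area q s t : 0 < s -> 0 < t -> lam2 (crect q s t) = (4 * (s * t))%:E.
Proof.
move=> s0 t0.
have -> : crect q s t = `[(Re q - s), (Re q + s)]%classic `*` `[(Im q - t), (Im q + t)]%classic.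
  apply/seteqP; split => -[x y]; rewrite /crect /= !in_itv /= !ReImE /= !ler_norml => -[/andP[? ?] /andP[? ?]];
   by split; apply/andP; split; lra.
rewrite area_setX; try exact: measurable_itv.
rewrite !lebesgue_measure_itv /= !lte_fin !ifT; [|lra|lra].
by rewrite -!EFinB -EFinM; congr (_%:E); ring.
Qed.

Lemma crect_preimage_area (k z0 : C) (s t : R) : k != 0 -> 0 < s -> 0 < t ->
  let D := [set p : Pl | crect 0 s t (pc (k * (zc p - z0)))] in
  measurable D /\ lam2 D = ((nc k ^+ 2)^-1 * (4 * (s * t)))%:E.
Proof.
move=> k0 s0 t0 D.
have DE : D = [set p : Pl | crect 0 s t ((Re k * p.1 + (- Im k) * p.2 + Re (- (k * z0)), Im k * p.1 + Re k * p.2 + Im (- (k * z0))) : Pl)].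
  have E (x y : R) : pc (k * ((x +i* y) - z0)) = (Re k * x + - Im k * y + Re (- (k * z0)), Im k * x + Re k * y + Im (- (k * z0))).
    by rewrite /pc !ReImE /=; apply: (congr2 pair); ring.
  by rewrite /D; apply/seteqP; split => -[x y] /=; rewrite -E.
have E : Re k * Re k - - Im k * Im k = nc k ^+ 2 by rewrite nc_sqr /dt; ring.
have nk : 0 < nc k ^+ 2 by rewrite exprn_gt0 // nc_gt0.
split; rewrite DE; first exact: measurable_affine_set (crect_measurable _ _ _).
rewrite area_affine ?E ?gt_eqF //; last exact: crect_measurable.
by rewrite gtr0_norm // crect_area.
Qed.

Variables (z0 : C) (d e a : R) (F G f : C -> C).
Let V : set C := [set z | nc (z - z0) < d].
Hypothesis (d0 : 0 < d) (e0 : 0 < e) (a0 : 0 < a).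
Hypothesis hF : forall z, V z -> [/\ f z != 0, cder F z (f z) & ccont f z].
Hypothesis low : forall z w, V z -> V w -> a * nc (z - w) <= nc (F z - F w).
Hypothesis hG : forall y, nc y < e -> V (G y) /\ F (G y) = y.

Let oV : oset V. Proof. exact: oset_ball. Qed.
Let VP : set Pl := [set p | V (zc p)].
Let mVP : measurable VP. Proof. exact: oset_measurable. Qed.
Let mF : measurable_fun VP (fun p => pc (F (zc p))).
Proof. by apply: oset_cont_measurable => // z /hF[_ /cder_cont]. Qed.
Let g (p : Pl) : \bar R := (nc (f (zc p)) ^+ 2)%:E.
Let g0 p : (0 <= g p)%E. Proof. by rewrite lee_fin sqr_ge0. Qed.
Let mg : measurable_fun VP g.
Proof.
apply/measurable_EFinP; apply: measurable_funX.
apply: (@oset_real_measurable _ V (fun z => nc (f z))) => // z Vz t t0.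
have [_ _ cf] := hF Vz; have [r r0 hr] := cf t t0; exists r => // w hw.
by apply: le_lt_trans (nc_dist _ _) (hr w hw).
Qed.
Let nu : {measure set Pl -> \bar R} := density lam2 mVP mg g0.
(** The image under [F] of the area form with density |f|^2; the section shows that it is Lebesgue
    measure near 0, by evaluating it on half-open rectangles. *)
Let mu : {measure set Pl -> \bar R} := push_on nu mVP mF.

Let low_inj z w : V z -> V w -> F z = F w -> z = w.
Proof.
move=> Vz Vw E; apply/eqP; rewrite -subr_eq0 -nc_eq0 eq_le nc_ge0 andbT.
by have := low Vz Vw; rewrite E subrr nc0 pmulr_rle0.
Qed.
Let GF z : V z -> nc (F z) < e -> G (F z) = z.
Proof. by move=> Vz h; have [VG FG] := hG h; apply: low_inj. Qed.

Let aux_in (x x' u s t ze : R) : `|x| <= (1 - ze) * s -> `|x' - u - x| <= t -> 2 * t <= ze * s ->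
  0 < ze * s -> u - s < x' <= u + s.
Proof. by rewrite !ler_norml => /andP[? ?] /andP[? ?] ? ?; apply/andP; split; lra. Qed.

Let aux_out (x x' u s t ze : R) : `|x' - u| <= s -> `|x' - u - x| <= t -> t <= ze * s ->
  `|x| <= (1 + ze) * s.
Proof. by rewrite !ler_norml => /andP[? ?] /andP[? ?] ?; apply/andP; split; lra. Qed.

Lemma push_area_bounds (S D1 D2 : set Pl) (Q : set Pl) (u v : R) :
  measurable Q -> S = VP `&` [set p | Q (pc (F (zc p)))] ->
  measurable D1 -> measurable D2 -> D1 `<=` S -> S `<=` D2 -> 0 <= u -> 0 <= v ->
  (forall p, S p -> u <= nc (f (zc p)) ^+ 2 <= v) ->
  (u%:E * lam2 D1 <= mu Q <= v%:E * lam2 D2)%E.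
Proof.
move=> mQ SE mD1 mD2 D1S SD2 u0 v0 h.
have mS : measurable S by rewrite SE; exact: mF.
have muE : mu Q = (\int[lam2]_(p in S) g p)%E.
  by rewrite SE /mu /= /push_on /nu /= /density setIA setIid.
have mgS : measurable_fun S g by apply: measurable_funS mg => //; rewrite SE => p [].
rewrite muE; apply/andP; split.
  apply: (@le_trans _ _ (u%:E * lam2 S)%E).
    apply: lee_wpmul2l; [by rewrite lee_fin|by apply: le_measure; rewrite ?inE].
  rewrite -integral_cst //; apply: ge0_le_integral => // p Sp; rewrite lee_fin.
  by case/andP: (h p Sp).
apply: (@le_trans _ _ (v%:E * lam2 S)%E).
  rewrite -integral_cst //; apply: ge0_le_integral => // p Sp; rewrite lee_fin.
  by case/andP: (h p Sp).
apply: lee_wpmul2l; [by rewrite lee_fin|by apply: le_measure; rewrite ?inE].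
Qed.

(* [F] is nearly affine on a small rectangle, whose preimage is therefore between
   two parallelograms of nearly the same area. *)
Lemma push_area_local (ze sg : R) (y0 : C) : nc y0 < e -> 0 < ze -> ze < 1 -> 0 < sg ->
  exists2 r : R, 0 < r & forall (q : C) (s t : R), 0 < s -> 0 < t -> s = sg * t ->
    s < r -> t < r -> crect q s t (pc y0) ->
    (forall p, crect q s t p -> nc (zc p) < e) ->
    (((1 - ze) ^+ 4 * (4 * (s * t)))%:E <= mu (ocrect (Re q - s) (Re q + s) (Im q - t) (Im q + t)) <= ((1 + ze) ^+ 4 * (4 * (s * t)))%:E)%E.
Proof.
move=> hy0 ze0 ze1 sg0; have [VG FG0] := hG hy0.
pose k := f (G y0); have [k0 _ cf] := hF VG.
have kk0 : 0 < nc k by rewrite nc_gt0.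
(* [sg] is the fixed ratio of [s] to [t]. With this [eta] the error [eta * (s + t)] of the linear
   approximation is at most [ze / 2] times either of [s] and [t]. *)
pose eta := ze / (2 * (2 + sg + sg^-1)).
have isg : 0 < sg^-1 by rewrite invr_gt0.
have den0 : 0 < 2 * (2 + sg + sg^-1) by lra.
have eta0 : 0 < eta by rewrite divr_gt0.
have etaE : 2 * eta * (2 + sg + sg^-1) = ze by rewrite mulrAC mulrC /eta divfK // gt_eqF.
have eta2 : eta <= 1 / 2 by nra.
have etaz : eta <= ze by nra.
have etak : 0 < eta * nc k by rewrite mulr_gt0.
have [r1 r10 hr1] := cf _ etak; have [r2 r20 hr2] := oV VG.
pose rho := Num.min r1 r2; have rho0 : 0 < rho by rewrite lt_min r10.
have near z : nc (z - G y0) < rho -> V z /\ nc (f z - k) <= eta * nc k.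
  by rewrite lt_min => /andP[/hr1/ltW ? /hr2 ?].
have mvt := @ball_mvt R F f (G y0) rho k (eta * nc k) _.
have {}mvt : forall z w, nc (z - G y0) < rho -> nc (w - G y0) < rho ->
    nc (F z - F w - k * (z - w)) <= eta * nc k * nc (z - w).
  by apply: mvt => z /near[Vz ?]; split => //; have [_ ? _] := hF Vz.
exists (Num.min (rho * a / 8) (rho * nc k / 8)) => [|q s t s0 t0 st sr tr qy0 qe].
  by rewrite lt_min !divr_gt0 ?mulr_gt0.
move: sr tr; rewrite !lt_min => /andP[sr1 sr2] /andP[tr1 tr2].
have qq : nc q < e.
  by rewrite -(pcK q); apply: qe; rewrite crect_pc subrr /= normr0 !ltW.
have [Vq Fq] := hG qq; pose zq := G q.
have lowG y : nc y < e -> a * nc (G y - G y0) <= nc (y - y0).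
  by move=> /hG[Vy Fy]; have := low Vy VG; rewrite Fy FG0.
have farq y : nc y < e -> nc (y - y0) <= 2 * s + 2 * t -> nc (G y - G y0) < rho / 2.
  move=> ye hy; have := lowG y ye => h; rewrite -(ltr_pM2l a0).
  by apply: le_lt_trans h _; apply: le_lt_trans hy _; lra.
have hqy : nc (q - y0) <= s + t.
  move: qy0; rewrite crect_pc => -[u v]; rewrite ncC; apply: le_trans (nc_ReIm _) _.
  exact: lerD.
have zqn : nc (zq - G y0) < rho / 2 by apply: farq => //; lra.
have es : 2 * (eta * (s + t)) <= ze * s.
  have -> : ze * s = 2 * eta * (2 + sg + sg^-1) * s by rewrite etaE.
  have -> : t = sg^-1 * s by rewrite st mulKf ?gt_eqF.
  have := mulr_gt0 eta0 s0; have := mulr_gt0 sg0 (mulr_gt0 eta0 s0); nra.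
have et : 2 * (eta * (s + t)) <= ze * t.
  have -> : ze * t = 2 * eta * (2 + sg + sg^-1) * t by rewrite etaE.
  rewrite st.
  have := mulr_gt0 eta0 t0; have := mulr_gt0 isg (mulr_gt0 eta0 t0); nra.
pose Q := ocrect (Re q - s) (Re q + s) (Im q - t) (Im q + t).
have QP y : Q (pc y) -> `|Re (y - q)| <= s /\ `|Im (y - q)| <= t.
  exact: ocrect_crect.
pose S := VP `&` [set p | Q (pc (F (zc p)))].
have Snear p : S p -> nc (zc p - G y0) < rho / 2.
  move=> [/= Vp /QP[u v]].
  have Fe : nc (F (zc p)) < e by rewrite -(pcK (F _)); apply: qe; rewrite crect_pc.
  rewrite -(GF Vp Fe); apply: farq => //.
  have := nc_tri q (F (zc p)) y0; have := nc_ReIm (F (zc p) - q); lra.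
pose D1 := [set p : Pl | crect 0 ((1 - ze) * s) ((1 - ze) * t) (pc (k * (zc p - zq)))].
pose D2 := [set p : Pl | crect 0 ((1 + ze) * s) ((1 + ze) * t) (pc (k * (zc p - zq)))].
have z1 : 0 < 1 - ze by lra.
have z2 : 0 < 1 + ze by lra.
have [mD1 aD1] := crect_preimage_area zq k0 (mulr_gt0 z1 s0) (mulr_gt0 z1 t0).
have [mD2 aD2] := crect_preimage_area zq k0 (mulr_gt0 z2 s0) (mulr_gt0 z2 t0).
have D1S : D1 `<=` S.
  move=> p; rewrite /D1 /mkset crect_pc subr0 => -[u v].
  have kz : nc k * nc (zc p - zq) <= s + t.
    rewrite -ncM; apply: le_trans (nc_ReIm _) _; nra.
  have pn : nc (zc p - G y0) < rho.
    have := nc_tri zq (zc p) (G y0).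
    suff : nc (zc p - zq) < rho / 4 by lra.
    by rewrite -(ltr_pM2l kk0); lra.
  have [Vp _] := near _ pn; split => //=.
  have zqn' : nc (zq - G y0) < rho by lra.
  have := mvt _ _ pn zqn'; rewrite Fq -/zq => h.
  have {}h : nc (F (zc p) - q - k * (zc p - zq)) <= eta * (s + t).
    apply: le_trans h _; rewrite -mulrA ler_pM2l //.
  have hR := le_trans (Re_nc _) h; have hI := le_trans (Im_nc _) h; rewrite !ReD !ReN in hR; rewrite !ImD !ImN in hI.
  rewrite /Q /ocrect /pc /= !in_itv /=.
  by split; [exact: aux_in u hR es (mulr_gt0 ze0 s0)|exact: aux_in v hI et (mulr_gt0 ze0 t0)].
have SD2 : S `<=` D2.
  move=> p Sp; have pn := Snear p Sp; case: Sp => /= Vp /QP[u v].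
  have pn' : nc (zc p - G y0) < rho by lra.
  have zqn' : nc (zq - G y0) < rho by lra.
  have := mvt _ _ pn' zqn'; rewrite Fq -/zq => h.
  have kz : nc k * nc (zc p - zq) <= 2 * (s + t).
    have h1 := nc_tri (F (zc p) - q) (k * (zc p - zq)) 0.
    rewrite !subr0 ncM (ncC (k * _) (F _ - q)) in h1.
    have := nc_ReIm (F (zc p) - q).
    have := mulr_ge0 (ltW kk0) (nc_ge0 (zc p - zq)).
    move: h h1; rewrite -mulrA; move: (nc k * _) => A; nra.
  have {}h : nc (F (zc p) - q - k * (zc p - zq)) <= 2 * (eta * (s + t)).
    by apply: le_trans h _; rewrite -mulrA (mulrCA 2) ler_pM2l.
  rewrite /D2 /mkset crect_pc subr0.
  have hR := le_trans (Re_nc _) h; have hI := le_trans (Im_nc _) h; rewrite !ReD !ReN in hR u; rewrite !ImD !ImN in hI v.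
  by split; [exact: aux_out u hR es|exact: aux_out v hI et].
have mQ : measurable Q by apply: measurableX; exact: measurable_itv.
have bnd p : S p -> ((1 - ze) * nc k) ^+ 2 <= nc (f (zc p)) ^+ 2 <= ((1 + ze) * nc k) ^+ 2.
  move=> Sp; have pn := Snear p Sp.
  have [|_ hf] := near (zc p); first by lra.
  have hd := le_trans (nc_dist _ _) hf.
  have zk : eta * nc k <= ze * nc k by rewrite ler_pM2r.
  move: hd; rewrite ler_norml => /andP[? ?].
  have l1 : (1 - ze) * nc k <= nc (f (zc p)) by lra.
  have l2 : nc (f (zc p)) <= (1 + ze) * nc k by lra.
  by rewrite !ler_pXn2r ?nnegrE ?nc_ge0 ?mulr_ge0 ?l1 ?l2 // ltW.
have := push_area_bounds mQ (erefl S) mD1 mD2 D1S SD2 (sqr_ge0 _) (sqr_ge0 _) bnd.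
rewrite aD1 aD2 -!EFinM.
have E1 : ((1 - ze) * nc k) ^+ 2 * ((nc k ^+ 2)^-1 * (4 * ((1 - ze) * s * ((1 - ze) * t)))) = (1 - ze) ^+ 4 * (4 * (s * t)).
  by field; rewrite gt_eqF.
have E2 : ((1 + ze) * nc k) ^+ 2 * ((nc k ^+ 2)^-1 * (4 * ((1 + ze) * s * ((1 + ze) * t)))) = (1 + ze) ^+ 4 * (4 * (s * t)).
  by field; rewrite gt_eqF.
by rewrite E1 E2.
Qed.

Let ocrect0 a1 b1 c1 d1 : (b1 <= a1) || (d1 <= c1) -> ocrect a1 b1 c1 d1 = set0 :> set Pl.
Proof.
move=> h; apply/seteqP; split => // -[x y]; rewrite /ocrect /= !in_itv /= => -[/andP[? ?] /andP[? ?]].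
by case/orP: h => ?; lra.
Qed.

Let mu_splitx a1 m b1 c1 d1 : a1 <= m -> m <= b1 ->
  mu (ocrect a1 b1 c1 d1) = (mu (ocrect a1 m c1 d1) + mu (ocrect m b1 c1 d1))%E.
Proof.
move=> am mb; rewrite -measureU.
- congr (mu _); apply/seteqP; split => -[x y]; rewrite /ocrect /= !in_itv /=.
    move=> [/andP[h1 h2] hy]; have [?|?] := leP x m; [left|right]; split => //; apply/andP; split => //.
  by move=> [[/andP[? ?] ?]|[/andP[? ?] ?]]; split => //; apply/andP; split; lra.
- by apply: measurableX; exact: measurable_itv.
- by apply: measurableX; exact: measurable_itv.
- apply/seteqP; split => // -[x y]; rewrite /ocrect /= !in_itv /= => -[[/andP[? ?] _] [/andP[? ?] _]]; lra.
Qed.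

Let mu_splity a1 b1 c1 m d1 : c1 <= m -> m <= d1 ->
  mu (ocrect a1 b1 c1 d1) = (mu (ocrect a1 b1 c1 m) + mu (ocrect a1 b1 m d1))%E.
Proof.
move=> am mb; rewrite -measureU.
- congr (mu _); apply/seteqP; split => -[x y]; rewrite /ocrect /= !in_itv /=.
    move=> [hx /andP[h1 h2]]; have [?|?] := leP y m; [left|right]; split => //; apply/andP; split => //.
  by move=> [[? /andP[? ?]]|[? /andP[? ?]]]; split => //; apply/andP; split; lra.
- by apply: measurableX; exact: measurable_itv.
- by apply: measurableX; exact: measurable_itv.
- apply/seteqP; split => // -[x y]; rewrite /ocrect /= !in_itv /= => -[[_ /andP[? ?]] [_ /andP[? ?]]]; lra.
Qed.

Let aux_mid (x u v : R) : u <= x -> x <= v -> `|x - (u + v) / 2| <= (v - u) / 2.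
Proof. by move=> ? ?; rewrite ler_norml; apply/andP; split; lra. Qed.

Let aux_sub (x u v w : R) : `|x - (u + v) / 2| <= (v - u) / 2 -> - w <= u -> v <= w -> `|x| <= w.
Proof. by rewrite !ler_norml => /andP[? ?] ? ?; apply/andP; split; lra. Qed.

(** Both bounds are additive over quarters, and [push_area_local] provides them on small rectangles;
    the subdivision keeps the proportions, which is why a single ratio [sg] is enough. *)
Let mu_rect_approx (ze a0' b0 c0 d0' : R) : 0 < ze -> ze < 1 -> - (e / 3) <= a0' -> a0' < b0 -> b0 <= e / 3 ->
  - (e / 3) <= c0 -> c0 < d0' -> d0' <= e / 3 ->
  (((1 - ze) ^+ 4 * ((b0 - a0') * (d0' - c0)))%:E <= mu (ocrect a0' b0 c0 d0')
     <= ((1 + ze) ^+ 4 * ((b0 - a0') * (d0' - c0)))%:E)%E.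
Proof.
move=> ze0 ze1 ea ab be ec cd de.
apply: (@rect_bisect R (fun a b c d => (((1 - ze) ^+ 4 * ((b - a) * (d - c)))%:E <= mu (ocrect a b c d)
     <= ((1 + ze) ^+ 4 * ((b - a) * (d - c)))%:E)%E) a0' b0 c0 d0' (ltW ab) (ltW cd)).
  move=> a1 b1 c1 d1 _ ab1 _ _ cd1 _ m n /andP[l1 u1] /andP[l2 u2] /andP[l3 u3] /andP[l4 u4].
  have am : a1 <= m by rewrite /m; lra.
  have mb : m <= b1 by rewrite /m; lra.
  have cn : c1 <= n by rewrite /n; lra.
  have nd : n <= d1 by rewrite /n; lra.
  rewrite (mu_splitx c1 d1 am mb) !(mu_splity _ _ cn nd).
  have E (w : R) : w * ((b1 - a1) * (d1 - c1)) = w * ((m - a1) * (n - c1)) + w * ((m - a1) * (d1 - n)) +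
      (w * ((b1 - m) * (n - c1)) + w * ((b1 - m) * (d1 - n))) by ring.
  by rewrite !E !EFinD; apply/andP; split; do ?apply: leeD.
move=> x y ax xb cy yd.
have hy0 : nc (x +i* y) < e.
  apply: le_lt_trans (nc_ReIm _) _; rewrite /=.
  suff : `|x| <= e / 3 /\ `|y| <= e / 3 by move=> [? ?]; lra.
  by rewrite !ler_norml; split; apply/andP; split; lra.
have sg0 : 0 < (b0 - a0') / (d0' - c0) by rewrite divr_gt0 ?subr_gt0.
have [r r0 hr] := push_area_local hy0 ze0 ze1 sg0; exists r => // a1 b1 c1 d1 aa1 a1x xb1 bb1 cc1 c1y yd1 dd1 br dr EE.
have dc0 : 0 < d0' - c0 by rewrite subr_gt0.
have ba0 : 0 < b0 - a0' by rewrite subr_gt0.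
have [/eqP s0|s0] := boolP (b1 - a1 == 0).
  have t0 : d1 - c1 = 0.
    by move: EE; rewrite s0 mul0r => /esym/eqP; rewrite mulf_eq0 (gt_eqF ba0) orbF => /eqP.
  by rewrite s0 mul0r !mulr0 ocrect0 ?measure0 ?lexx //; apply/orP; left; lra.
have s1 : 0 < b1 - a1 by rewrite lt_neqAle eq_sym s0 /=; lra.
have t1 : 0 < d1 - c1.
  rewrite -(pmulr_lgt0 _ ba0) -EE; exact: mulr_gt0.
have [q [qR qI]] : exists q : C, Re q = (a1 + b1) / 2 /\ Im q = (c1 + d1) / 2.
  by exists (((a1 + b1) / 2) +i* ((c1 + d1) / 2)).
have := hr q ((b1 - a1) / 2) ((d1 - c1) / 2).
have -> : Re q - (b1 - a1) / 2 = a1 by rewrite qR; lra.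
have -> : Re q + (b1 - a1) / 2 = b1 by rewrite qR; lra.
have -> : Im q - (d1 - c1) / 2 = c1 by rewrite qI; lra.
have -> : Im q + (d1 - c1) / 2 = d1 by rewrite qI; lra.
have -> : 4 * ((b1 - a1) / 2 * ((d1 - c1) / 2)) = (b1 - a1) * (d1 - c1) by field.
apply.
- by rewrite divr_gt0.
- by rewrite divr_gt0.
- apply: (mulIf (lt0r_neq0 dc0)).
  have -> : (b1 - a1) / 2 * (d0' - c0) = (d1 - c1) * (b0 - a0') / 2 by rewrite -EE; ring.
  by field; rewrite gt_eqF.
- lra.
- lra.
- have xR : Re (x +i* y) = x by [].
  have yI : Im (x +i* y) = y by [].
  by rewrite crect_pc !(ReD, ImD, ReN, ImN) qR qI xR yI; split; apply: aux_mid.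
- move=> p; rewrite -(zcK p) crect_pc zcK !(ReD, ImD, ReN, ImN) qR qI => -[u v].
  apply: le_lt_trans (nc_ReIm _) _.
  have u1 : `|Re (zc p)| <= e / 3 by apply: (aux_sub u (le_trans ea aa1) (le_trans bb1 be)).
  have v1 : `|Im (zc p)| <= e / 3 by apply: (aux_sub v (le_trans ec cc1) (le_trans dd1 de)).
  by apply: le_lt_trans (lerD u1 v1) _; lra.
Qed.

Let mu_rect (a1 b1 c1 d1 : R) : - (e / 3) <= a1 -> a1 < b1 -> b1 <= e / 3 ->
  - (e / 3) <= c1 -> c1 < d1 -> d1 <= e / 3 ->
  mu (ocrect a1 b1 c1 d1) = ((b1 - a1) * (d1 - c1))%:E.
Proof.
move=> h1 h2 h3 h4 h5 h6; have h ze ze0 ze1 := @mu_rect_approx ze a1 b1 c1 d1 ze0 ze1 h1 h2 h3 h4 h5 h6.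
have A0 : 0 < (b1 - a1) * (d1 - c1) by apply: mulr_gt0; lra.
move: h; move: ((b1 - a1) * (d1 - c1)) A0 => A A0 h.
have half0 : (0 : R) < 1 / 2 by lra.
have half1 : (1 / 2 : R) < 1 by lra.
have fin : mu (ocrect a1 b1 c1 d1) \is a fin_num.
  rewrite ge0_fin_numE //; have /andP[_ hu] := h _ half0 half1.
  by apply: le_lt_trans hu _; rewrite ltry.
rewrite -(fineK fin); congr (_%:E); move: h; rewrite -(fineK fin); move: (fine _) => v h.
apply/eqP; rewrite -subr_eq0 -normr_eq0 eq_le normr_ge0 andbT.
apply/ler_addgt0Pl => t t0; rewrite addr0.
(* 15 is the sum of the nonconstant coefficients of [(1 + ze) ^+ 4], so both fourth powers are
   within [15 * ze] of 1. *)
pose ze := Num.min (1 / 2) (t / (15 * A)).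
have ze0 : 0 < ze by rewrite lt_min half0 divr_gt0 // mulr_gt0.
have ze1 : ze <= 1 / 2 by rewrite ge_min lexx.
have zeA : 15 * ze * A <= t.
  have : ze <= t / (15 * A) by rewrite ge_min lexx orbT.
  by rewrite ler_pdivlMr ?mulr_gt0 //; lra.
have /andP[] := h ze ze0 (le_lt_trans ze1 half1); rewrite !lee_fin => l u.
have u1 : (1 + ze) ^+ 4 <= 1 + 15 * ze.
  have e2 : ze * ze <= ze by nra.
  have e3 : ze * ze * ze <= ze by nra.
  have e4 : ze * ze * ze * ze <= ze by nra.
  rewrite !exprS expr0 mulr1; lra.
have l1 : 1 - 15 * ze <= (1 - ze) ^+ 4.
  have e2 : ze * ze <= ze by nra.
  have e3 : ze * ze * ze <= ze by nra.
  have e5 : 0 <= ze * ze by nra.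
  have e4 : 0 <= ze * ze * ze * ze by nra.
  rewrite !exprS expr0 mulr1; lra.
have {}u := le_trans u (ler_wpM2r (ltW A0) u1); have {}l := le_trans (ler_wpM2r (ltW A0) l1) l.
by rewrite /= ler_norml; apply/andP; split; lra.
Qed.

(* Both sides are measures in [E], which agree on half-open rectangles. *)
Lemma flat_change E : (forall p, E p -> nc (zc p) < e / 3) -> measurable E ->
  (\int[lam2]_(p in VP `&` [set p | E (pc (F (zc p)))]) (nc (f (zc p)) ^+ 2)%:E = lam2 E)%E.
Proof.
move=> Ee mE; pose W := ocrect (- (e / 3)) (e / 3) (- (e / 3)) (e / 3).
have mW : measurable W by apply: measurableX; exact: measurable_itv.
have EW : E `&` W = E.
  rewrite setIidl // => p /Ee h; have := le_lt_trans (Re_nc _) h; have := le_lt_trans (Im_nc _) h.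
  by rewrite /W /ocrect /= !in_itv /= !ltr_norml => /andP[-> /ltW ->] /andP[-> /ltW ->].
pose m1 : {measure set Pl -> \bar R} := mrestr mu mW.
pose m2 : {measure set Pl -> \bar R} := mrestr lam2 mW.
have m12 a1 b1 c1 d1 : m1 (ocrect a1 b1 c1 d1) = m2 (ocrect a1 b1 c1 d1).
  rewrite /m1 /m2 /= /mrestr ocrectI.
  set a2 := Num.max _ _; set b2 := Num.min _ _; set c2 := Num.max _ _; set d2 := Num.min _ _.
  have a2e : - (e / 3) <= a2 by rewrite /a2 le_max lexx orbT.
  have b2e : b2 <= e / 3 by rewrite /b2 ge_min lexx orbT.
  have c2e : - (e / 3) <= c2 by rewrite /c2 le_max lexx orbT.
  have d2e : d2 <= e / 3 by rewrite /d2 ge_min lexx orbT.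
  have [ab|ba] := ltP a2 b2; last first.
    by rewrite ocrect0 ?ba // !measure0.
  have [cd|dc] := ltP c2 d2; last first.
    by rewrite ocrect0 ?dc ?orbT // !measure0.
  by rewrite mu_rect // ocrect_area // ltW.
have fin a1 b1 c1 d1 : (m1 (ocrect a1 b1 c1 d1) < +oo)%E.
  rewrite m12 /m2 /= /mrestr; apply: (@le_lt_trans _ _ (lam2 W)).
    by apply: le_measure; rewrite ?inE //; apply: measurableI => //; apply: measurableX; exact: measurable_itv.
  have e3 : 0 < e / 3 by rewrite divr_gt0.
  have ee : - (e / 3) <= e / 3 by rewrite (le_trans _ (ltW e3)) // oppr_le0 ltW.
  by rewrite (ocrect_area ee ee) ltry.
have := @ocrect_measure_unique R m1 m2 m12 fin E mE.
by rewrite /m1 /m2 /= /mrestr EW /mu /= /push_on /nu /= /density setIA setIid.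
Qed.

End LocalChange.

(** * Transfer of area to the surface *)

Section SurfaceArea.
Variables (R : realType) (T : translationSurface R).
Local Notation C := R[i].
Local Notation RR := (measurableTypeR R).
Local Notation lam := (@lebesgue_measure R).
Local Notation Pl := (RR * RR)%type.
Local Notation lam2 := (lam \x lam)%E.
Local Notation f := (form_coef (omega T)).
Local Notation ch i := (chart_map (atlas i)).
Local Notation chi i := (chart_inv (atlas i)).
Local Notation dom i := (chart_dom (atlas i)).
Local Notation img i := (chart_img (atlas i)).
Local Notation sing := (singularities T).
Implicit Types (i j : chart_index T) (x y : T) (p : Pl) (phi psi : C -> T) (z w a : C).

Lemma translate_area w (E : set Pl) : measurable E ->
  measurable [set p | E (pc (zc p + w))] /\ lam2 [set p | E (pc (zc p + w))] = lam2 E.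
Proof.
move=> mE; have -> : [set p | E (pc (zc p + w))] =
    [set p : Pl | E ((1 * p.1 + 0 * p.2 + Re w), (0 * p.1 + 1 * p.2 + Im w))].
  have h (x y : R) : pc ((x +i* y) + w) = (1 * x + 0 * y + Re w, 0 * x + 1 * y + Im w).
    by rewrite /pc ReD ImD /= !mul1r !mul0r addr0 add0r.
  by apply/seteqP; split => -[x y] /=; rewrite -h.
split; first exact: measurable_affine_set.
have det : 1 * 1 - 0 * 0 = 1 :> R by ring.
by rewrite area_affine ?det ?oner_eq0 // normr1 invr1 mul1e.
Qed.

(** On [K] the map [phi] is [chi i] after [G], up to the translation by [w]. The set [S], an image
    under [G], is described as a preimage under [F], so that it is measurable and [flat_change]
    computes its area. *)
Lemma flatbox_change phi i (B : set T) (K : set Pl) x (w : C) (d e a : R) (F G : C -> C) :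
  flatbox x i d e a F G -> B `<=` dom i -> measurable (chart_plane_img i B) -> measurable K ->
  (forall p, K p -> nc (zc p - w) < e / 3 /\ phi (zc p) = chi i (G (zc p - w))) ->
  measurable (K `&` [set p | B (phi (zc p))]) /\
  exists S : set Pl, [/\ measurable S, forall p, S p -> img i (zc p) /\ f i (zc p) != 0,
    (\int[lam2]_(p in S) (nc (f i (zc p)) ^+ 2)%:E = lam2 (K `&` [set p | B (phi (zc p))]))%E &
    forall p, K p -> B (phi (zc p)) -> S (pc (ch i (phi (zc p))))].
Proof.
move=> fb Bd mP mK hK; case: (fb) => -[dx d0 e0 a0 F0] h low hG.
have BP z : img i z -> B (chi i z) <-> chart_plane_img i B (pc z).
  move=> iz; rewrite /chart_plane_img /= -/(zc (pc z)) pcK; split.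
    by exists (chi i z) => //; rewrite chiK.
  by case=> y By <-; rewrite chK //; exact: Bd.
set E := K `&` _.
have mV1 : measurable [set p : Pl | [set z | nc (z - w) < e] (zc p)].
  by apply: oset_measurable; exact: oset_ball.
have mV2 : measurable [set p : Pl | [set z | nc (z - ch i x) < d] (zc p)].
  by apply: oset_measurable; exact: oset_ball.
have mg : measurable_fun [set p : Pl | [set z | nc (z - w) < e] (zc p)] (fun p => pc (G (zc p - w))).
  apply: (@oset_cont_measurable R [set z | nc (z - w) < e] (fun z => G (z - w))); first exact: oset_ball.
  move=> z /= hz; apply: (@cder_cont _ _ _ ((f i (G (z - w)))^-1 * 1)).
  exact: (cder_comp (cder_translate (- w) z) (fb_G_cder fb hz)).
have mF : measurable_fun [set p : Pl | [set z | nc (z - ch i x) < d] (zc p)] (fun p => pc (F (zc p))).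
  apply: (@oset_cont_measurable R [set z | nc (z - ch i x) < d] F); first exact: oset_ball.
  by move=> z /h[_ _]; exact: cder_cont.
have mE : measurable E.
  have -> : E = K `&` ([set p | nc (zc p - w) < e] `&` [set p | chart_plane_img i B (pc (G (zc p - w)))]).
    apply/seteqP; split => [p [Kp Bp]|p [Kp [pe Pp]]]; have [h1 h2] := hK p Kp.
      have pe : nc (zc p - w) < e by lra.
      have [gd _] := hG _ pe; have [gi _ _] := h _ gd.
      by split => //; split => //=; apply/BP => //; rewrite -h2.
    have [gd _] := hG _ pe; have [gi _ _] := h _ gd.
    by split => //=; rewrite h2; apply/BP.
  by apply: measurableI => //; exact: (mg mV1 _ mP).
split => //.
have [mE' aE'] := translate_area w mE; set E' := [set p | E (pc (zc p + w))] in mE' aE'.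
have E'e p : E' p -> nc (zc p) < e / 3.
  by move=> [/hK[+ _] _]; rewrite pcK addrK.
exists ([set p | nc (zc p - ch i x) < d] `&` [set p | E' (pc (F (zc p)))]); split.
- exact: (mF mV2 _ mE').
- by move=> p [/= /h[? ? _] _].
- rewrite -aE'; apply: (flat_change e0 a0 _ low hG E'e mE').
  by move=> z /h[iz ? ?]; split => //; exact: f_cont.
- move=> p Kp Bp; have [h1 h2] := hK p Kp.
  have pe : nc (zc p - w) < e by lra.
  have [gd FG] := hG _ pe; have [gi _ _] := h _ gd.
  split => /=; rewrite pcK h2 chiK // FG /E' /= pcK subrK zcK.
  by [].
Qed.

Definition regdom i : set C := [set z | img i z /\ f i z != 0].

Lemma regdom_oset i : oset (regdom i).
Proof.
move=> z [iz fz]; have [r r0 hr] := img_ball iz.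
have n0 : 0 < nc (f i z) by rewrite nc_gt0.
have [s s0 hs] := f_cont iz n0.
exists (Num.min r s) => [|w]; first by rewrite lt_min r0.
rewrite lt_min => /andP[/hr iw /hs h]; split => //; apply/eqP => fw.
by move: h; rewrite fw sub0r ncN ltxx.
Qed.

Let mD i : measurable [set p : Pl | regdom i (zc p)].
Proof. by apply: oset_measurable; exact: regdom_oset. Qed.

Let dg i (p : Pl) : \bar R := (nc (f i (zc p)) ^+ 2)%:E.
Let dg0 i p : (0 <= dg i p)%E. Proof. by rewrite lee_fin sqr_ge0. Qed.
Let mdg i : measurable_fun [set p : Pl | regdom i (zc p)] (dg i).
Proof.
apply/measurable_EFinP; apply: measurable_funX.
apply: (@oset_real_measurable _ (regdom i) (fun z => nc (f i z))) => [|z [iz _] t t0]; first exact: regdom_oset.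
have [r r0 hr] := f_cont iz t0; exists r => // w hw.
by apply: le_lt_trans (nc_dist _ _) (hr w hw).
Qed.
Let nu i : {measure set Pl -> \bar R} := density lam2 (mD i) (@mdg i) (@dg0 i).

Let nu_sub i (S : set Pl) : (forall p, S p -> regdom i (zc p)) ->
  nu i S = (\int[lam2]_(p in S) dg i p)%E.
Proof. by move=> h; rewrite /nu /= /density setIidr // => p /h. Qed.

Lemma imm_flatbox phi (D : set C) i w : oset D -> imm D phi -> D w -> dom i (phi w) ->
  exists (d e a : R) (F G : C -> C), flatbox (phi w) i d e a F G /\ exists2 r : R, 0 < r &
    forall z, nc (z - w) < r -> nc (z - w) < e / 3 /\ phi z = chi i (G (z - w)).
Proof.
move=> oD iD Dw di; have ns : ~ sing (phi w) by case: (iD w Dw).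
have [d [e [a [F [G fb]]]]] := flatbox_ex di ns.
exists d, e, a, F, G; split => //; case: (fb) => -[_ _ e0 _ _] _ _ _.
have [r r0 hr] := oD w Dw.
have re0 : 0 < Num.min r e by rewrite lt_min r0.
have := @imm_uniq_loc R T phi (fun z => chi i (G (z - w))) w _ re0.
case=> [z|| r' r'0 hr'].
- rewrite lt_min => /andP[/hr Dz ze]; split; first exact: iD.
  exact: (imm_at_shift (fb_imm fb ze)).
- by rewrite subrr (fb0 fb).
exists (Num.min r' (e / 3)) => [|z]; first by rewrite lt_min r'0 divr_gt0.
by rewrite lt_min => /andP[/hr' ? ?].
Qed.

(** [A] is cut into countably many disjoint parts of grid cells, each contained in a flat box, and
    [flatbox_change] treats each part. The images of different parts may overlap, hence only an
    inequality. *)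
Lemma map_change phi (D : set C) (A : set Pl) i (B : set T) :
  oset D -> imm D phi -> measurable A -> (forall p, A p -> D (zc p)) ->
  B `<=` dom i -> measurable (chart_plane_img i B) ->
  measurable (A `&` [set p | B (phi (zc p))]) /\
  exists S : set Pl, [/\ measurable S, forall p, S p -> regdom i (zc p),
    (nu i S <= lam2 (A `&` [set p | B (phi (zc p))]))%E &
    forall p, A p -> B (phi (zc p)) -> S (pc (ch i (phi (zc p))))].
Proof.
move=> oD iD mA AD Bd mP.
pose valid q := exists x w (d e a : R) (F G : C -> C), flatbox x i d e a F G /\
  forall p, cell q p -> nc (zc p - w) < e / 3 /\ phi (zc p) = chi i (G (zc p - w)).
pose Y k : set Pl := if @unpickle (nat * int * int)%type k is Some q then
   if `[< valid q >] then cell q else set0 else set0.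
have mY k : measurable (Y k).
  rewrite /Y; case: unpickle => [q|]; last exact: measurable0.
  by case: ifP => _; [exact: measurable_cell|exact: measurable0].
pose K k := seqDU Y k `&` A.
have mK k : measurable (K k).
  by apply: measurableI => //; apply: measurableD => //; exact: bigsetU_measurable.
have KY k : K k `<=` Y k by move=> p [[]].
have hk k : exists S : set Pl, measurable (K k `&` [set p | B (phi (zc p))]) /\
    [/\ measurable S, forall p, S p -> regdom i (zc p),
    nu i S = lam2 (K k `&` [set p | B (phi (zc p))]) &
    forall p, K k p -> B (phi (zc p)) -> S (pc (ch i (phi (zc p))))].
  have triv : Y k = set0 -> exists S : set Pl, measurable (K k `&` [set p | B (phi (zc p))]) /\
    [/\ measurable S, forall p, S p -> regdom i (zc p),
    nu i S = lam2 (K k `&` [set p | B (phi (zc p))]) &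
    forall p, K k p -> B (phi (zc p)) -> S (pc (ch i (phi (zc p))))].
    move=> Y0; have K0 : K k = set0 by apply/seteqP; split => // p /KY; rewrite Y0.
    exists set0; rewrite K0 set0I; split; first exact: measurable0.
    by split => //; rewrite !measure0.
  move: triv; rewrite {1}/Y; case E : unpickle => [q|]; last by apply.
  case: asboolP => [[x [w [d [e [a [F [G [fb hq]]]]]]]] _|_]; last by apply.
  have hK p : K k p -> nc (zc p - w) < e / 3 /\ phi (zc p) = chi i (G (zc p - w)).
    move=> /KY; rewrite /Y E; case: asboolP => // _; exact: hq.
  have [mE [S [mS Sr Sa Sp]]] := flatbox_change fb Bd mP (mK k) hK.
  by exists S; split => //; split => //; rewrite nu_sub.
have [S hS] := choice hk.
have AE : A `&` [set p | B (phi (zc p))] = \bigcup_k (K k `&` [set p | B (phi (zc p))]).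
  rewrite -setI_bigcupl; apply/seteqP; split => [p [Ap Bp]|p [[k _ [_ Ap]] Bp]] //; split => //.
  have : (\bigcup_k seqDU Y k) p.
    rewrite -seqDU_bigcup_eq.
    have [d [e [a [F [G [fb [r r0 hr]]]]]]] := imm_flatbox oD iD (AD p Ap) (Bd _ Bp).
    have [q [qp hq]] := cell_ex (zc p) r0; rewrite zcK in qp.
    exists (pickle q) => //; rewrite /Y pickleK asboolT //.
    by exists (phi (zc p)), (zc p), d, e, a, F, G; split => // p' /hq /hr.
  by case=> k _ kp; exists k.
have mE : measurable (A `&` [set p | B (phi (zc p))]).
  by rewrite AE; apply: bigcupT_measurable => k; case: (hS k).
split => //; exists (\bigcup_k S k); split.
- by apply: bigcupT_measurable => k; case: (hS k) => _ [].
- by move=> p [k _]; case: (hS k) => _ [_ h _ _]; exact: h.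
- have mS : measurable (\bigcup_k S k) by apply: bigcupT_measurable => k; case: (hS k) => _ [].
  apply: (@le_trans _ _ (\sum_(k <oo) nu i (S k))%E).
    by apply: measure_sigma_subadditive => // k; case: (hS k) => _ [].
  have -> : (\sum_(k <oo) nu i (S k) = \sum_(k <oo) lam2 (K k `&` [set p | B (phi (zc p))]))%E.
    by apply: eq_eseriesr => k _; case: (hS k) => _ [].
  rewrite AE measure_semi_bigcup //.
  + by move=> k; case: (hS k).
  + apply/trivIsetP => /= j k _ _ jk; apply/seteqP; split => // p [[[sj _] _] [[sk _] _]].
    by move/trivIsetP : (trivIset_seqDU Y) => /(_ j k Logic.I Logic.I jk) <-.
  + by rewrite -AE.
- move=> p Ap Bp; have : (A `&` [set p | B (phi (zc p))]) p by [].
  rewrite AE => -[k _ [Kp _]]; exists k => //.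
  by case: (hS k) => _ [_ _ _ h]; exact: h.
Qed.

Lemma measure_bigsetU_le (m : {measure set Pl -> \bar R}) (I : eqType) (r : seq I) (S : I -> set Pl) :
  (forall t, t \in r -> measurable (S t)) ->
  measurable (\big[setU/set0]_(t <- r) S t) /\ (m (\big[setU/set0]_(t <- r) S t) <= \sum_(t <- r) m (S t))%E.
Proof.
elim: r => [|t r IH] mS; first by rewrite !big_nil measure0; split => //; exact: measurable0.
have [mr hr] := IH (fun u hu => mS u (mem_behead (s := t :: r) hu)).
have mt : measurable (S t) by apply: mS; exact: mem_head.
 rewrite !big_cons; split; first exact: measurableU.
by apply: le_trans (measureU2 _ mt mr) _; exact: leeD.
Qed.

Lemma mem_bigsetU (I : eqType) (r : seq I) (S : I -> set Pl) t p : t \in r -> S t p -> (\big[setU/set0]_(u <- r) S u) p.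
Proof.
elim: r => // u r IH; rewrite inE big_cons => /orP[/eqP <-|h] Sp; first by left.
by right; exact: IH.
Qed.

Section Cover.
Variables (I : eqType) (r : seq I) (phi : I -> C -> T) (D : I -> set C) (A : I -> set Pl).
Hypothesis oD : forall t, t \in r -> oset (D t).
Hypothesis iD : forall t, t \in r -> imm (D t) (phi t).
Hypothesis mA : forall t, t \in r -> measurable (A t).
Hypothesis AD : forall t p, t \in r -> A t p -> D t (zc p).
Hypothesis cover : forall x, ~ sing x -> exists t p, [/\ t \in r, A t p & phi t (zc p) = x].

(** The integrand vanishes at the zeros of the coefficient, so these contribute nothing; every other
    point of [B] is covered by one of the maps, and [map_change] bounds the area of what each map
    covers. *)
Lemma chart_area_le i (B : set T) : B `<=` dom i -> measurable (chart_plane_img i B) ->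
  (chart_area i B <= \sum_(t <- r) lam2 (A t `&` [set p | B (phi t (zc p))]))%E.
Proof.
move=> Bd mP.
have hS t : exists S : set Pl, t \in r -> [/\ measurable S, forall p, S p -> regdom i (zc p),
    (nu i S <= lam2 (A t `&` [set p | B (phi t (zc p))]))%E &
    forall p, A t p -> B (phi t (zc p)) -> S (pc (ch i (phi t (zc p))))].
  have [tr|tr] := boolP (t \in r); last by exists set0.
  by have [_ [S ?]] := map_change (oD tr) (iD tr) (mA tr) (fun p => AD tr) Bd mP; exists S.
have [S {}hS] := choice hS.
have -> : chart_area i B = nu i (chart_plane_img i B).
  rewrite /chart_area /nu /= /density [LHS]integral_mkcond [RHS]integral_mkcond.
  apply: eq_integral => -[x y] _; rewrite /patch in_setI.
  case: ifP => hp; rewrite ?andbF // andbT; case: ifP => // hn.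
  move: hp; rewrite inE => -[z Bz zE].
  suff -> : f i (x +i* y) = 0 by rewrite nc0 expr0n.
  apply: contrapT => /eqP fn; move: hn; rewrite (_ : (_ \in _) = true) //; apply/mem_set.
  by split => //; exists z => //; exact: Bd.
have mS t : t \in r -> measurable (S t) by case/hS.
have [mU hU] := measure_bigsetU_le (nu i) mS.
have : (nu i (chart_plane_img i B) <= nu i (\big[setU/set0]_(t <- r) S t))%E.
  have -> : nu i (chart_plane_img i B) = nu i ([set p | regdom i (zc p)] `&` chart_plane_img i B).
    by rewrite /nu /= /density setIA setIid.
  apply: le_measure; rewrite ?inE //; first exact: measurableI.
  move=> p [[_ fp] [x Bx xE]]; have xE' : ch i x = zc p by [].
  have ns : ~ sing x by move=> /(sing_chart (Bd _ Bx)); rewrite xE' => /eqP; rewrite (negbTE fp).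
  have [t [q [tr Aq qE]]] := cover ns; apply: (mem_bigsetU tr).
  have [_ _ _ h] := hS t tr; have := h q Aq; rewrite qE xE' zcK; exact.
move=> h; apply: le_trans h _; apply: le_trans hU _.
rewrite big_seq [leRHS]big_seq; apply: lee_sum => t tr.
by have [] := hS t tr.
Qed.

(** After exchanging the two sums, the preimages of the disjoint pieces [B m] are disjoint parts of
    each [A t], so their areas add up to at most that of [A t]. *)
Lemma area_cover (al : \bar R) : has_area T al -> (al <= \sum_(t <- r) lam2 (A t))%E.
Proof.
move=> [n [i [B [tB _ Bd mP ->]]]].
apply: (@le_trans _ _ (\sum_(m < n) \sum_(t <- r) lam2 (A t `&` [set p | B m (phi t (zc p))]))%E).
  by apply: lee_sum => m _; exact: chart_area_le.
rewrite exchange_big /= big_seq [leRHS]big_seq; apply: lee_sum => t tr.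
have mE m : measurable (A t `&` [set p | B m (phi t (zc p))]).
  by have [] := map_change (oD tr) (iD tr) (mA tr) (fun p => AD tr) (Bd m) (mP m).
have tE : trivIset setT (fun m : 'I_n => A t `&` [set p | B m (phi t (zc p))]).
  apply/trivIsetP => m m' _ _ mm'; apply/seteqP; split => // p [[_ h1] [_ h2]].
  have : (B m `&` B m') (phi t (zc p)) by [].
  by move/trivIsetP : tB => /(_ m m' Logic.I Logic.I mm') ->.
rewrite -(@measure_bigsetU_ord _ _ _ lam2 n xpredT) //.
apply: le_measure; rewrite ?inE //; [exact: bigsetU_measurable|exact: mA|].
move=> p; elim/big_ind: _ => //; first by move=> X Y hX hY [/hX|/hY].
by move=> m _ [].
Qed.
End Cover.

End SurfaceArea.

(** * The covering triangles *)

Section TriangleArea.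
Variable R : realType.
Local Notation C := R[i].
Local Notation RR := (measurableTypeR R).
Local Notation lam := (@lebesgue_measure R).
Local Notation Pl := (RR * RR)%type.
Local Notation lam2 := (lam \x lam)%E.

Definition simplex : set Pl := [set p | [/\ 0 <= p.1, 0 <= p.2 & p.1 + p.2 <= 1]].
Definition diagonal : set Pl := [set p | p.1 + p.2 = 1].

Lemma measurable_simplex : measurable simplex.
Proof.
have -> : simplex = (`[0, +oo[%classic `*` `[0, +oo[%classic) `&`
    [set p : Pl | (`]-oo, 1]%classic `*` setT) ((1 * p.1 + 1 * p.2 + 0, 0 * p.1 + 1 * p.2 + 0) : Pl)].
  apply/seteqP; split => -[x y]; rewrite /simplex /= !in_itv /= !andbT !mul1r addr0.
    by move=> [? ? ?]; split.
  by move=> [[? ?] [? _]]; split.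
apply: measurableI; first by apply: measurableX; exact: measurable_itv.
by apply: measurable_affine_set; apply: measurableX; [exact: measurable_itv|exact: measurableT].
Qed.

Lemma measurable_diagonal : measurable diagonal.
Proof.
have -> : diagonal = [set p : Pl | (`[1, 1]%classic `*` setT) ((1 * p.1 + 1 * p.2 + 0, 0 * p.1 + 1 * p.2 + 0) : Pl)].
  apply/seteqP; split => -[x y]; rewrite /diagonal /= in_itv /= !mul1r addr0.
    by move=> ->; rewrite lexx.
  by move=> [h _]; apply/eqP; rewrite eq_le andbC.
by apply: measurable_affine_set; apply: measurableX; [exact: measurable_itv|exact: measurableT].
Qed.

Lemma diagonal_area : lam2 diagonal = 0%E.
Proof.
rewrite /product_measure1; apply: integral0_eq => x _ /=.
have -> : xsection diagonal x = [set (1 - x : RR)].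
  apply/seteqP; split => y; rewrite /xsection /= inE /diagonal /=.
    by move=> h; rewrite -h addrAC subrr add0r.
  by move=> ->; rewrite addrCA subrr addr0.
exact: lebesgue_measure_set1.
Qed.

(* The unit square contains the simplex and its image under a half-turn, which
   only meet on the diagonal. *)
Lemma simplex_area : (lam2 simplex <= (1 / 2)%:E)%E.
Proof.
have mS := measurable_simplex; have mG := measurable_diagonal.
pose S' : set Pl := [set p | simplex (((-1) * p.1 + 0 * p.2 + 1), (0 * p.1 + (-1) * p.2 + 1))].
have mS' : measurable S' by exact: measurable_affine_set.
have S'E : lam2 S' = lam2 simplex.
  have det : (-1) * (-1) - 0 * 0 = 1 :> R by ring.
  by rewrite /S' area_affine ?det ?oner_eq0 // normr1 invr1 mul1e.
have mD : measurable (simplex `\` diagonal) by exact: measurableD.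
have SD : (lam2 simplex <= lam2 (simplex `\` diagonal))%E.
  have h : lam2 simplex = (lam2 (simplex `\` diagonal) + lam2 (simplex `&` diagonal))%E.
    exact: measureDI.
  have : (lam2 (simplex `&` diagonal) <= lam2 diagonal)%E.
    by apply: le_measure; rewrite ?inE //; exact: measurableI.
  by rewrite h diagonal_area => hd; rewrite -[leRHS]adde0 leeD2l.
have sq : (lam2 (simplex `\` diagonal) + lam2 S' <= 1%:E)%E.
  rewrite -measureU //; last first.
    apply/seteqP; split => // -[x y]; rewrite /S' /simplex /diagonal /= => -[[[? ? ?] ne] [? ? ?]].
    by apply: ne; lra.
  apply: (@le_trans _ _ (lam2 (`[(0:R), 1]%classic `*` `[(0:R), 1]%classic : set Pl))).
    apply: le_measure; rewrite ?inE; [exact: measurableU|by apply: measurableX; exact: measurable_itv|].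
    move=> [x y]; rewrite /S' /simplex /diagonal /= !in_itv /= => -[[[? ? ?] ne]|[? ? ?]];
      by split; apply/andP; split; lra.
  rewrite area_setX; try exact: measurable_itv.
  by rewrite !lebesgue_measure_itv /= !lte_fin ltr01 -EFinB subr0 mule1.
have two : (lam2 simplex + lam2 simplex <= 1%:E)%E.
  by apply: le_trans sq; rewrite S'E; exact: leeD.
have fin : lam2 simplex \is a fin_num.
  rewrite ge0_fin_numE //; apply: (@le_lt_trans _ _ 1%:E); last exact: ltry.
  by apply: le_trans two; rewrite leeDl.
move: two; rewrite -(fineK fin) -EFinD !lee_fin; lra.
Qed.

(** The preimage of the standard simplex under barycentric coordinates, the form to which
    [area_affine] applies. *)
Definition triangle (P A B : C) : set Pl :=
  [set p | simplex (cr (zc p - P) (B - P) / cr (A - P) (B - P), cr (A - P) (zc p - P) / cr (A - P) (B - P))].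

Lemma triangle_area P A B : cr (A - P) (B - P) != 0 ->
  measurable (triangle P A B) /\ (lam2 (triangle P A B) <= (`|cr (A - P) (B - P)| / 2)%:E)%E.
Proof.
move=> K0; pose K := cr (A - P) (B - P).
have E (x y : R) : (cr ((x +i* y) - P) (B - P) / K, cr (A - P) ((x +i* y) - P) / K) =
    ((Im (B - P) / K) * x + (- Re (B - P) / K) * y + cr (- P) (B - P) / K,
     (- Im (A - P) / K) * x + (Re (A - P) / K) * y + cr (A - P) (- P) / K).
  by rewrite /cr !(ReD, ImD, ReN, ImN) /=; apply: (congr2 pair); ring.
have -> : triangle P A B = [set p : Pl | simplex ((Im (B - P) / K) * p.1 + (- Re (B - P) / K) * p.2 + cr (- P) (B - P) / K,
     (- Im (A - P) / K) * p.1 + (Re (A - P) / K) * p.2 + cr (A - P) (- P) / K)].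
  by apply/seteqP; split => -[x y]; rewrite /triangle /= -E.
have det : Im (B - P) / K * (Re (A - P) / K) - (- Re (B - P) / K) * (- Im (A - P) / K) = K^-1.
  have -> : Im (B - P) / K * (Re (A - P) / K) - (- Re (B - P) / K) * (- Im (A - P) / K) = K / K ^+ 2.
    by rewrite {5}/K /cr; field.
  by rewrite expr2 invfM mulrA mulfV // mul1r.
split; first exact: measurable_affine_set measurable_simplex.
rewrite area_affine ?det ?invr_eq0 //; last exact: measurable_simplex.
rewrite normfV invrK EFinM; apply: lee_wpmul2l; first by rewrite lee_fin.
by have := simplex_area; rewrite div1r.
Qed.

Lemma tri_triangle P A B p : cr (A - P) (B - P) != 0 -> tri P A B (zc p) -> triangle P A B p.
Proof.
move=> K0 [s [t [s0 t0 st E]]]; rewrite /triangle /mkset E.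
have -> : P + s%:C * (A - P) + t%:C * (B - P) - P = s%:C * (A - P) + t%:C * (B - P) by ring.
have -> : cr (s%:C * (A - P) + t%:C * (B - P)) (B - P) = s * cr (A - P) (B - P).
  by rewrite crDl !crZl crv mulr0 addr0.
have -> : cr (A - P) (s%:C * (A - P) + t%:C * (B - P)) = t * cr (A - P) (B - P).
  by rewrite crDr !crZr crv mulr0 add0r.
by rewrite !mulfK.
Qed.

(** The base has length [v] and the height is at most [u / 2 + r], since the midpoint of the base is
    at distance [u / 2] from the centre; [u] and [v] are tied by Pythagoras. Equilateral triangles
    attain the bound. *)
Lemma inscribed_triangle P A B (r : R) : nc P = r -> nc A = r -> nc B = r ->
  `|cr (A - P) (B - P)| <= 3 * Num.sqrt 3 / 2 * r ^+ 2.
Proof.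
move=> hP hA hB; have r0 : 0 <= r by rewrite -hP nc_ge0.
pose u := nc (A + B); pose v := nc (B - A).
have u0 : 0 <= u by exact: nc_ge0.
have v0 : 0 <= v by exact: nc_ge0.
have uv : u ^+ 2 + v ^+ 2 = 4 * r ^+ 2.
  have hA2 : nc A ^+ 2 = r ^+ 2 by rewrite hA.
  have hB2 : nc B ^+ 2 = r ^+ 2 by rewrite hB.
  by move: hA2 hB2; rewrite /u /v !nc_sqr /dt !(ReD, ImD, ReN, ImN) => h1 h2; lra.
have crle (x y : C) : `|cr x y| <= nc x * nc y.
  rewrite -(ler_pXn2r (n := 2)) ?nnegrE ?mulr_ge0 ?nc_ge0 // real_normK ?num_real // exprMn !nc_sqr.
  rewrite (_ : dt x x * dt y y = cr x y ^+ 2 + dt x y ^+ 2); first by rewrite lerDl sqr_ge0.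
  by rewrite /dt /cr; ring.
have K1 : `|cr (A - P) (B - P)| <= v * (u / 2 + r).
  have -> : cr (A - P) (B - P) = cr (A + B) (B - A) / 2 - cr P (B - A).
    by rewrite /cr !(ReD, ImD, ReN, ImN); field.
  apply: le_trans (ler_normB _ _) _; rewrite normrM [`|2^-1|]ger0_norm ?invr_ge0 //.
  have := crle (A + B) (B - A); have := crle P (B - A); rewrite hP -/u -/v; lra.
apply: le_trans K1 _.
have s3 : 0 <= Num.sqrt 3 :> R by exact: sqrtr_ge0.
have s32 : Num.sqrt 3 ^+ 2 = 3 :> R by rewrite sqr_sqrtr.
rewrite -(ler_pXn2r (n := 2)) ?nnegrE ?mulr_ge0 ?addr_ge0 ?divr_ge0 ?sqr_ge0 //.
have -> : (3 * Num.sqrt 3 / 2 * r ^+ 2) ^+ 2 = 27 / 4 * r ^+ 4.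
  have -> : (3 * Num.sqrt 3 / 2 * r ^+ 2) ^+ 2 = 9 / 4 * Num.sqrt 3 ^+ 2 * r ^+ 4 by field.
  by rewrite s32; field.
have -> : (v * (u / 2 + r)) ^+ 2 = (4 * r ^+ 2 - u ^+ 2) * (u / 2 + r) ^+ 2.
  by rewrite -uv; ring.
rewrite -subr_ge0.
(* The double root [u = r] is the equilateral case. *)
have -> : 27 / 4 * r ^+ 4 - (4 * r ^+ 2 - u ^+ 2) * (u / 2 + r) ^+ 2 =
    (u - r) ^+ 2 * ((u / 2) ^+ 2 + 3 / 2 * u * r + 11 / 4 * r ^+ 2) by field.
by rewrite mulr_ge0 ?sqr_ge0 // !addr_ge0 ?mulr_ge0 ?sqr_ge0.
Qed.
End TriangleArea.

(** If every such list could be extended, there would be one longer than [N]. This turns the count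
    of triangles into a finite list of all of them. *)
Lemma maximal_uniq_seq (I : eqType) (Q : I -> Prop) (N : nat) :
  (forall s : seq I, uniq s -> (forall t, t \in s -> Q t) -> (size s <= N)%N) ->
  exists s : seq I, [/\ uniq s, forall t, t \in s -> Q t & forall t, Q t -> t \in s].
Proof.
move=> bnd; apply: contrapT => no.
have grow n : exists s : seq I, [/\ uniq s, forall t, t \in s -> Q t & size s = n].
  elim: n => [|n [s [us sQ sn]]]; first by exists [::].
  have [t [Qt ts]] : exists t, Q t /\ t \notin s.
    apply: contrapT => h; apply: no; exists s; split => // t Qt.
    by apply: contrapT => ts; apply: h; exists t; split => //; apply/negP.
  exists (t :: s); split => //=; [by rewrite ts|by move=> u; rewrite inE => /orP[/eqP ->//|/sQ]|by rewrite sn].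
have [s [us sQ sn]] := grow N.+1.
by have := bnd s us sQ; rewrite sn ltnn.
Qed.

(** * The inequality between area and covering radius *)

Section Surface.
Variables (R : realType) (T : translationSurface R).
Local Notation C := R[i].
Local Notation sing := (singularities T).

(** Distances to an empty set of zeros are infima of the empty set, that is [+oo]; the nonzero form
    provides a point. *)
Lemma c_rad_no_singularity : (forall x, ~ sing x) -> c_rad T = +oo%E.
Proof.
move=> no; have [i [z [iz _]]] := omega_neq0 T.
apply/eqP; rewrite -leye_eq; apply: ereal_sup_ubound; exists (chart_inv (atlas i) z) => //.
rewrite /dist_to_singularities (_ : [set _ | _ in _] = set0) ?ereal_inf0 //.
by apply/seteqP; split => // y [s /no].
Qed.

Lemma covering_disc_area (l : nat) (p : 'I_l -> T) (k : 'I_l -> nat) (b : R) :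
  injective p -> range p = sing -> (forall j, form_order (p j) (k j)) -> has_area T 1%E ->
  (forall (r : R) (phi : C -> T), imm (cball 0 r) phi -> 0 < r -> r <= b) -> 0 <= b ->
  1 <= (\sum_(j < l) 2 * (k j).+1)%:R * (3 * Num.sqrt 3 / 4 * b ^+ 2).
Proof.
move=> pinj pr ord area short b0.
have psing x : sing x -> exists j, p j = x by rewrite -pr => -[j _ <-]; exists j.
have sp j : sing (p j) by rewrite -pr; exists j.
(* Cone data are chosen once for each zero, with dummy values elsewhere; injectivity of [p] makes
   the order attached to a zero unambiguous. *)
have hx (x : T) : exists d : set T * (T -> C) * R, sing x -> conebox x d.1.1 d.1.2 d.2 /\
    forall j, p j = x -> forall (y : C) (q : 'I_(k j).+2 -> T), y != 0 -> injective q ->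
      ~ (forall i, d.1.1 (q i) /\ d.1.2 (q i) = y).
  have [sx|?] := pselect (sing x); last by exists (set0, fun=> 0, 0).
  have [j jx] := psing x sx; have [U [F [m [h1 h2]]]] := conebox_ex (sp j) (ord j).
  exists (U, F, m) => _ /=; rewrite -jx; split => // j' /pinj -> y q; exact: h2.
have [d hd] := choice hx.
pose cU x := (d x).1.1; pose cF x := (d x).1.2; pose cm x := (d x).2.
have cones x : sing x -> conebox x (cU x) (cF x) (cm x) by move=> /hd[].
have pcount j (y : C) (q : 'I_(k j).+2 -> T) : y != 0 -> injective q ->
  ~ (forall i, cU (p j) (q i) /\ cF (p j) (q i) = y) by have [_ h] := hd _ (sp j); exact: h.
have [ts [uts tfan tall]] := maximal_uniq_seq (fan_count cones psing pcount).
(* The intersection with the open disc, where the development is defined, only removes the three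
   corners of the triangle, which are zeros. *)
pose A (t : T * C * C) : set (measurableTypeR R * measurableTypeR R) :=
  [set p | cball 0 (nc (hbase t.1.1)) (zc p)] `&` triangle (hbase t.1.1) t.1.2 t.2.
have K0 t : t \in ts -> [/\ 0 < nc (hbase t.1.1), nc t.1.2 = nc (hbase t.1.1), nc t.2 = nc (hbase t.1.1) &
    cr (t.1.2 - hbase t.1.1) (t.2 - hbase t.1.1) != 0].
  move=> /tfan; case: t => -[c u] v ft; have [h0 hr hm _] := fanTP cones ft.
  case: ft => _ _ fn; have := fan_cr h0 erefl hr fn => /lt0r_neq0 ?.
  by case: fn => [[/hr ? /hr ?] _ _ _].
have tdisc t : t \in ts -> cball 0 (nc (hbase t.1.1)) `<=` expdom t.1.1.
  by move=> /tfan; case: t => -[c u] v [_ h _]; exact: hits_disc h.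
have mA t : t \in ts -> measurable (A t).
  move=> tt; have [_ _ _ K] := K0 t tt; apply: measurableI; last exact: (triangle_area K).1.
  exact: (@oset_measurable R _ (@cball_oset R 0 (nc (hbase t.1.1)))).
have Aarea t : t \in ts -> (((@lebesgue_measure R) \x (@lebesgue_measure R)) (A t) <= (3 * Num.sqrt 3 / 4 * b ^+ 2)%:E)%E.
  move=> tt; have [h0 h1 h2 K] := K0 t tt; have [mT aT] := triangle_area K.
  apply: (@le_trans _ _ ((@lebesgue_measure R \x @lebesgue_measure R) (triangle (hbase t.1.1) t.1.2 t.2)))%E.
    by apply: le_measure; rewrite ?inE; [exact: (mA t tt)|exact: mT|move=> q []].
  apply: le_trans aT _; rewrite lee_fin.
  have := inscribed_triangle erefl h1 h2.
  have hb : nc (hbase t.1.1) <= b.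
    by apply: (short _ (expmap t.1.1)) => // z /(tdisc t tt); exact: exp_imm.
  have : nc (hbase t.1.1) ^+ 2 <= b ^+ 2 by rewrite ler_pXn2r ?nnegrE ?nc_ge0.
  move=> h3 h4; have s3 : 0 <= 3 * Num.sqrt 3 / 2 :> R by rewrite divr_ge0 // mulr_ge0 ?sqrtr_ge0.
  by have := ler_wpM2l s3 h3; lra.
have := @area_cover R T _ ts (fun t => expmap t.1.1) (fun t => cball 0 (nc (hbase t.1.1))) A
  (fun t _ => @cball_oset R 0 _) (fun t tt z zt => exp_imm (tdisc t tt z zt)) mA (fun t q _ => @proj1 _ _) _ _ area.
move=> h; rewrite -lee_fin; apply: le_trans (h _) _.
  move=> x /(fan_cover_surface cones short)[c [u [v [ft [w [w1 w2 w3]]]]]].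
  have tt := tall _ ft; have [_ _ _ K] := K0 _ tt.
  exists (c, u, v), (pc w); rewrite pcK; split => //; split; first by rewrite /mkset pcK /cball /= subr0.
  by apply: (tri_triangle K); rewrite pcK.
apply: (@le_trans _ _ (\sum_(t <- ts) (3 * Num.sqrt 3 / 4 * b ^+ 2)%:E)%E).
  by rewrite big_seq [leRHS]big_seq; apply: lee_sum.
rewrite sumEFin lee_fin big_const_seq count_predT iter_addr_0 -[leLHS]mulr_natl.
apply: ler_wpM2r; first by rewrite !mulr_ge0 ?sqr_ge0 ?sqrtr_ge0 // invr_ge0.
by rewrite ler_nat; exact: (fan_count cones psing pcount uts tfan).
Qed.

End Surface.

Theorem proposition3 (R : realType) (g l : nat) (kappa : l.-tuple nat)
  (kappa_gt0 : forall j, (0 < tnth kappa j)%N)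
  (sum_kappa : (\sum_(j < l) tnth kappa j + 2 = 2 * g)%N)
  (T : translationSurface R) (T_H1 : in_H1 g kappa T) :
  ((Num.sqrt (2 / (3 * Num.sqrt 3 * (2 * g%:R + l%:R - 2))) : R)%:E
     <= c_rad T)%E.
Proof.
case: T_H1 => _ area [p [pinj pr ord]].
have E : 2 * g%:R + l%:R - 2 = (\sum_(j < l) (tnth kappa j).+1)%:R :> R.
  have -> : (\sum_(j < l) (tnth kappa j).+1 = \sum_(j < l) tnth kappa j + l)%N.
    by under eq_bigr do rewrite -addn1; rewrite big_split /= sum1_card card_ord.
  by rewrite -natrM -sum_kappa !natrD; ring.
rewrite E; set K : R := _%:R.
(* Without zeros [K] is 0 and the square root is taken of a quotient by zero; the covering radius is
   infinite in that case. *)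
have [l0|l0] := posnP l.
  rewrite c_rad_no_singularity ?leey // => x; rewrite -pr => -[j _ _].
  by case: j => j; rewrite {1}l0.
have K1 : 0 < K.
  rewrite /K ltr0n; apply: leq_trans (_ : \sum_(j < l) 1 <= _)%N; first by rewrite sum1_card card_ord.
  exact: leq_sum.
set b := Num.sqrt _.
have s3 : 0 < Num.sqrt 3 :> R by rewrite sqrtr_gt0.
have bb : b ^+ 2 = 2 / (3 * Num.sqrt 3 * K).
  by rewrite sqr_sqrtr // divr_ge0 // !mulr_ge0 // ltW.
have bpos : 0 < b by rewrite sqrtr_gt0 divr_gt0 // !mulr_gt0.
rewrite leNgt; apply/negP => hc.
(* If the covering radius is below [b], this is a real number below [b] that bounds the radii of
   immersed discs; [fine] sends [-oo] to 0, and the maximum ensures a nonnegative value. *)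
pose b0 : R := Num.max 0 (fine (c_rad T)).
have b0b : b0 < b.
  rewrite gt_max bpos /b0; case: (c_rad T) hc => [r|//|] /=; last by rewrite bpos.
  by rewrite lte_fin.
have short (r : R) (phi : R[i] -> T) : imm (cball 0 r) phi -> 0 < r -> r <= b0.
  move=> iphi r0; have := disc_bound iphi r0; rewrite /b0 le_max.
  by case: (c_rad T) hc => [s|//|//] _ /=; rewrite lee_fin => ->; rewrite orbT.
have b00 : 0 <= b0 by rewrite /b0 le_max lexx.
have := covering_disc_area pinj pr ord area short b00.
rewrite leNgt => /negP; apply.
have -> : (\sum_(j < l) 2 * (tnth kappa j).+1)%:R = 2 * K.
  by rewrite -big_distrr natrM.
have : b0 ^+ 2 < b ^+ 2 by rewrite ltr_pXn2r // nnegrE ltW.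
rewrite bb => h.
have c0 : 0 < 2 * K * (3 * Num.sqrt 3 / 4) by rewrite !mulr_gt0 // divr_gt0 // mulr_gt0.
have := h; rewrite -(ltr_pM2l c0) => {}h; rewrite mulrA; apply: lt_le_trans h _.
rewrite le_eqVlt; apply/orP; left; apply/eqP; field.
by rewrite !gt_eqF.
Qed.
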